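(* Let $n\ge2$ and let $\lambda\in\mathscr P_n\cup\mathscr P_n^{\rm sp}$. The map $\Psi_\lambda:\mathbf{KN}^{\mathfrak b_n}_\lambda\to\mathbf T^{\mathfrak b_n}_\lambda$ given by $$\Psi_\lambda(T)=\begin{cases}(\Psi_{\lambda'_\ell}(T_\ell),\dots,\Psi_{\lambda'_1}(T_1)), & \text{if }\lambda\in\mathscr P_n\text{ with }\ell=\lambda_1,\\ (\Psi_{\mu'_\ell}(T_\ell),\dots,\Psi_{\mu'_1}(T_1),\Psi_{\rm sp}(T_0)), & \text{if }\lambda=\mu+\sigma_n\in\mathscr P_n^{\rm sp}\text{ with }\ell=\mu_1,\end{cases}$$ is an isomorphism of $\mathfrak b_n$-crystals, where $T_i$ denotes the $i$-th column of $T$ of width $1$ from the right and $T_0$ denotes the column of $T$ of half width.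
   Context: **Crystals.** A crystal for a Lie algebra with index set $I$, weight lattice $P$, simple roots $\alpha_i$, simple coroots $h_i$ is a set $B$ with $\mathrm{wt}:B\to P$, $\varepsilon_i,\varphi_i:B\to\mathbb Z\cup\{-\infty\}$, $\tilde e_i,\tilde f_i:B\to B\cup\{\mathbf 0\}$ satisfying Kashiwara's usual axioms. Tensor product: $\mathrm{wt}$ is additive, $\varepsilon_i(b_1\otimes b_2)=\max\{\varepsilon_i(b_1),\varepsilon_i(b_2)-\langle\mathrm{wt}(b_1),h_i\rangle\}$, $\varphi_i(b_1\otimes b_2)=\max\{\varphi_i(b_1)+\langle\mathrm{wt}(b_2),h_i\rangle,\varphi_i(b_2)\}$, $\tilde e_i(b_1\otimes b_2)=\tilde e_ib_1\otimes b_2$ if $\varphi_i(b_1)\ge\varepsilon_i(b_2)$ and $b_1\otimes\tilde e_ib_2$ otherwise; $\tilde f_i(b_1\otimes b_2)=\tilde f_ib_1\otimes b_2$ if $\varphi_i(b_1)>\varepsilon_i(b_2)$ and $b_1\otimes\tilde f_ib_2$ otherwise. An isomorphism is a bijection preserving $\mathrm{wt},\varepsilon_i,\varphi_i$ and commuting with $\tilde e_i,\tilde f_i$. In all crystals below, $\varepsilon_i,\varphi_i$ are the maximal numbers of applications of $\tilde e_i,\tilde f_i$ with nonzero result. **Notation.** $\mathfrak b_n$ is the simple Lie algebra of type $B_n$, $I=\{1,\dots,n\}$, $\alpha_i=\epsilon_i-\epsilon_{i+1}$ ($i<n$), $\alpha_n=\epsilon_n$, $\omega_n=\frac12(\epsilon_1+\cdots+\epsilon_n)$;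 $\mathfrak l$ is the Levi subalgebra for $\alpha_1,\dots,\alpha_{n-1}$. $\mathscr P_n$ is the set of partitions $(\lambda_1\ge\cdots\ge\lambda_n\ge0)$, $\mathscr P_n^{\rm sp}=\{\mu+\sigma_n:\mu\in\mathscr P_n\}$, $\sigma_n=(\frac12,\dots,\frac12)$; $\lambda'$ is the conjugate, $\lambda^\pi$ the $180^\circ$ rotation of the Young diagram. $[n]=\{1<\cdots<n\}$, $[\overline n]=\{\overline n<\cdots<\overline1\}$, $\mathbb J_n=\{1<\cdots<n<0<\overline n<\cdots<\overline1\}$, $\mathbb J_n^\times=\mathbb J_n\setminus\{0\}$. Semistandard ($SST_{\mathcal A}$): entries weakly increase along rows (left to right) and columns (top to bottom); entries other than $0$ strictly increase in columns; $0$ occurs at most once in each row. $w(T)$ reads rows from top to bottom, each from right to left. For a one-column tableau $U$, $\mathrm{ht}(U)$ is its height, $U(i)$ its $i$-th entry from the bottom. **KN tableaux.** $T(i,j)$ is the entry in the $i$-th row from the bottom and $j$-th column from the right. For $\lambda\in\mathscr P_n$, $\mathbf{KN}^{\mathfrak b_n}_\lambda$ is the set of $T\in SST_{\mathbb J_n}(\lambda^\pi)$ such that: (b-1) if $T(i_1,j)=\overline a$, $T(i_2,j)=a$ for some $a\in[n]$ and $i_1<i_2$, then $i_1+(\lambda'_j-i_2+1)\le a$; (b-2) if either $T(p,j)=\overline a,T(q,j)=\overline b,T(r,j)=b,T(s,j+1)=a$, or $T(p,j)=\overline a,T(q,j+1)=\overline b,T(r,j+1)=b,T(s,j+1)=a$,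 for some $1\le a\le b<n$ and $p\le q<r\le s$, then $(q-p)+(s-r)<b-a$; (b-3) if either $T(p,j)=\overline a$, $T(s,j+1)=a$, $T(q,j),T(r,j)\in\{n,0,\overline n\}$, or $T(p,j)=\overline a$, $T(s,j+1)=a$, $T(q,j+1),T(r,j+1)\in\{n,0,\overline n\}$, for some $1\le a<n$ and $p\le q<r=q+1\le s$, then $(q-p)+(s-r)<n-a$; (b-4) there are no $j$ and $p<q$ with $T(p,j)\in\{0,\overline n\}$, $T(q,j+1)\in\{n,0\}$. $\mathbf{KN}^{\rm sp}$ is the set of $\mathbb J_n^\times$-semistandard single columns of height $n$ and half width not containing both $a$ and $\overline a$ for any $a$. For $\lambda=\mu+\sigma_n\in\mathscr P_n^{\rm sp}$, $\mathbf{KN}^{\mathfrak b_n}_\lambda$ is the set of $\mathbb J_n$-semistandard tableaux whose rightmost column lies in $\mathbf{KN}^{\rm sp}$, whose remaining columns form a tableau in $\mathbf{KN}^{\mathfrak b_n}_\mu$ (bottoms aligned), and whose two rightmost columns satisfy (b-2)–(b-4). Crystal structure: for $\lambda\in\mathscr P_n$, $T\leftrightarrow w_1\otimes\cdots\otimes w_m$ for $w(T)=w_1\cdots w_m$, with $1\xrightarrow{1}\cdots\xrightarrow{n-1}n\xrightarrow{n}0\xrightarrow{n}\overline n\xrightarrow{n-1}\cdots\xrightarrow{1}\overline1$ on letters ($b\xrightarrow{i}b'$ means $b'=\tilde f_ib$), $\mathrm{wt}(i)=\epsilon_i$, $\mathrm{wt}(\overline i)=-\epsilon_i$, $\mathrm{wt}(0)=0$.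 On $\mathbf{KN}^{\rm sp}$: $\mathrm{wt}(T)=\frac12\sum c_i\epsilon_i$, $c_i=1$ if $i\in T$, $c_i=-1$ if $\overline i\in T$; $\tilde e_iT$ is the element of weight $\mathrm{wt}(T)+\alpha_i$ if it exists and $\mathbf 0$ otherwise. For $\lambda=\mu+\sigma_n$, $\mathbf{KN}^{\mathfrak b_n}_\lambda\subset\mathbf{KN}^{\rm sp}\otimes\mathbf{KN}^{\mathfrak b_n}_\mu$. **Two-column tableaux.** $\lambda(a,b,c)=(2^{b+c},1^a)/(1^b)$. For $T$ of this shape, $T^{\tt L},T^{\tt R}$ are its left and right columns. For semistandard $T$, $\mathfrak r_T$ is the maximal $0\le k\le\min\{a,b\}$ such that sliding $T^{\tt R}$ down by $k$ positions gives a semistandard tableau of shape $\lambda(a-k,b-k,c+k)$. If $\mathfrak r_T=0$: for $a>0$, $\mathcal ET$ (shape $\lambda(a-1,b+1,c)$) is obtained by the jeu de taquin slide into the cell just below the bottom of $T^{\tt R}$ (row $b+c+1$, column 2); for $b>0$, $\mathcal FT$ (shape $\lambda(a+1,b-1,c)$) by the jeu de taquin slide into the cell just above the top of $T^{\tt L}$ (row $b$, column 1); $\mathcal ET=\mathbf 0$ if $a=0$, $\mathcal FT=\mathbf 0$ if $b=0$. For a pair $(U,V)$ of semistandard columns of heights $u,v$, there is a unique $T$ of some shape $\lambda(u-k,v-k,k)$ with $(T^{\tt L},T^{\tt R})=(U,V)$ and $\mathfrak r_T=0$; put $\mathcal X(U,V)=((\mathcal XT)^{\tt L},(\mathcal XT)^{\tt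 R})$ (or $\mathbf 0$) for $\mathcal X=\mathcal E,\mathcal F$. **Spinor model.** For $0\le a<n$, $\mathbf T^{\mathfrak b_n}(a)=\bigsqcup_{b,c\ge0}\{T\in SST_{[\overline n]}(\lambda(a,b,c)):\mathfrak r_T=0\}$; $\mathbf T^{\rm sp}=\bigsqcup_{0\le a\le n}SST_{[\overline n]}((1^a))$. For $i<n$ the operators come from the word $w(T)$ and the $\mathfrak l$-crystal $\overline n\xrightarrow{n-1}\cdots\xrightarrow{1}\overline1$, $\mathrm{wt}_{\mathfrak l}(\overline i)=-\epsilon_i$; on $\mathbf T^{\rm sp}$, $\tilde e_n$ (resp. $\tilde f_n$) removes (resp. adds) a box $\overline n$ on top if possible, otherwise gives $\mathbf 0$; on $\mathbf T^{\mathfrak b_n}(a)$, use $T\leftrightarrow T^{\tt R}\otimes T^{\tt L}\in(\mathbf T^{\rm sp})^{\otimes2}$. $\mathrm{wt}(T)=2\omega_n+\mathrm{wt}_{\mathfrak l}(T)$ on $\mathbf T^{\mathfrak b_n}(a)$, $\omega_n+\mathrm{wt}_{\mathfrak l}(T)$ on $\mathbf T^{\rm sp}$. Put ${}^{\tt L}T=(\mathcal E^aT)^{\tt L}$, ${}^{\tt R}T=(\mathcal E^aT)^{\tt R}$ for $T\in\mathbf T^{\mathfrak b_n}(a)$. For $0\le a_1\le a_2<n$, $T_2\in\mathbf T^{\mathfrak b_n}(a_2)$, $T_1\in\mathbf T^{\mathfrak b_n}(a_1)$ or $T_1\in\mathbf T^{\rm sp}$ (then $a_1=0$, $T_1=T_1^{\tt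 L}={}^{\tt L}T_1$), write $T_2\prec T_1$ if (i) $\mathrm{ht}(T_2^{\tt R})\le\mathrm{ht}(T_1^{\tt L})-a_1$, (ii) $T_2^{\tt R}(i)\le{}^{\tt L}T_1(i)$, (iii) ${}^{\tt R}T_2(i+a_2-a_1)\le T_1^{\tt L}(i)$, for all $i\ge1$ for which both sides are defined. For $\lambda\in\mathscr P_n$ put $\ell=\lambda_1$, $a_i=n-\lambda_i'$ and $\mathbf T^{\mathfrak b_n}_\lambda=\{(T_\ell,\dots,T_1):T_i\in\mathbf T^{\mathfrak b_n}(a_i),\ T_\ell\prec\cdots\prec T_1\}$; for $\lambda=\mu+\sigma_n$ put $\ell=\mu_1$, $a_i=n-\mu'_i$ and $\mathbf T^{\mathfrak b_n}_\lambda=\{(T_\ell,\dots,T_1,T_0):T_i\in\mathbf T^{\mathfrak b_n}(a_i)\ (i\ge1),\ T_0\in\mathbf T^{\rm sp},\ T_\ell\prec\cdots\prec T_1\prec T_0\}$. It is a crystal via $(\dots,T_2,T_1)\leftrightarrow T_1\otimes T_2\otimes\cdots$ (resp. $T_0\otimes T_1\otimes\cdots$). **$\Psi_a$ and $\Psi_{\rm sp}$.** For $0<a\le n$ and $T\in\mathbf{KN}^{\mathfrak b_n}_{(1^a)}$, let $T_+$ (resp. $T_-$) be the subtableau of $T$ with entries in $[n]$ (resp. $[\overline n]$), let $\widetilde{T_+}\in SST_{[\overline n]}(1^m)$, $m=n-\mathrm{ht}(T_+)$, be the column in which $\overline k$ appears iff $k$ does not appear in $T_+$, and put $\Psi_a(T)=\mathcal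 F^{n-a}(T_-,\widetilde{T_+})$, regarded as a two-column skew tableau with $\mathfrak r_{\Psi_a(T)}=0$. For $T\in\mathbf{KN}^{\rm sp}$, $\Psi_{\rm sp}(T)=T_-$.
   Formalization: The crystal structure on KN tableaux uses the column reading (columns right to left, each top to bottom) instead of the row reading w(T), under which KN_λ is not stable: for n=2, λ=(2,2), rows (2,2̄),(2̄,1̄), ẽ_1 leaves KN_λ. *)

(* Defs.v *)
From HB Require Import structures.
From mathcomp Require Import all_boot all_order all_algebra.

Set Implicit Arguments.
Unset Strict Implicit.
Unset Printing Implicit Defensive.

Import Order.TTheory GRing.Theory Num.Theory.

Local Open Scope nat_scope.

(* * Weights of type B_n *)

(* The weight \sum_k c_k eps_k is encoded by the integers 2 * c_k, k = 1..n,
   stored in position k - 1.  P is the set of vectors all of whose entries have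
   the same parity. *)
Definition weight (n : nat) := 'rV[int]_n.

Definition mkweight (n : nat) (c2 : nat -> int) : weight n :=
  (\row_(k < n) c2 k.+1)%R.

Definition coord2 (n : nat) (w : weight n) (k : nat) : int :=
  if insub k.-1 is Some j then w ord0 j else 0%R.

Definition in_P (n : nat) (w : weight n) : Prop :=
  forall k l : nat, 1 <= k <= n -> 1 <= l <= n ->
    (coord2 w k = coord2 w l %[mod 2])%Z.

(* alpha_i = eps_i - eps_(i+1) for i < n, and alpha_n = eps_n. *)
Definition alpha (n i : nat) : weight n :=
  mkweight n (fun k =>
    ((k == i)%:R - ((i < n)%N && (k == i.+1))%:R) *+ 2)%R.

(* <w, h_i> = c_i - c_(i+1) for i < n, and <w, h_n> = 2 c_n; the division is
   exact on P. *)
Definition pairing (n : nat) (w : weight n) (i : nat) : int :=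
  if i < n then ((coord2 w i - coord2 w i.+1)%R %/ 2)%Z else coord2 w i.

(* * Crystals *)

(* The data of a b_n-crystal; i ranges over 1..n and None is the element 0.
   The value -oo of eps and phi never occurs below. *)
Record crystal_data (n : nat) := CrystalData {
  cr_sort :> Type;
  wt  : cr_sort -> weight n;
  eps : nat -> cr_sort -> int;
  phi : nat -> cr_sort -> int;
  te  : nat -> cr_sort -> option cr_sort;
  tf  : nat -> cr_sort -> option cr_sort }.

(* The subset B is stable under the operators and, with the restricted data,
   satisfies Kashiwara's axioms.  The last two clauses express that eps and phi
   are the maximal numbers of applications of te and tf. *)
Definition is_crystal (n : nat) (C : crystal_data n) (B : C -> Prop) : Prop :=
  forall x : C, B x -> in_P (wt x) /\ forall i : nat, 1 <= i <= n ->
    [/\ phi i x = (eps i x + pairing (wt x) i)%R,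
        forall y : C, te i x = Some y ->
          [/\ B y, wt y = (wt x + alpha n i)%R, eps i y = (eps i x - 1)%R,
              phi i y = (phi i x + 1)%R & tf i y = Some x],
        forall y : C, tf i x = Some y ->
          [/\ B y, wt y = (wt x - alpha n i)%R, eps i y = (eps i x + 1)%R,
              phi i y = (phi i x - 1)%R & te i y = Some x],
        te i x = None -> eps i x = 0%R &
        tf i x = None -> phi i x = 0%R].

Definition crystal_iso (n : nat) (C D : crystal_data n)
    (B : C -> Prop) (B' : D -> Prop) (psi : C -> D) : Prop :=
  [/\ is_crystal B /\ is_crystal B',
      forall x, B x -> B' (psi x),
      forall x y, B x -> B y -> psi x = psi y -> x = y,
      forall z, B' z -> exists2 x, B x & psi x = z &
      forall x, B x -> wt (psi x) = wt x /\ forall i : nat, 1 <= i <= n ->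
        [/\ eps i (psi x) = eps i x, phi i (psi x) = phi i x,
            te i (psi x) = omap psi (te i x) &
            tf i (psi x) = omap psi (tf i x)]].

Section Tensor.
Variables (n : nat) (C D : crystal_data n).
Implicit Type b : C * D.

Definition tens_wt b : weight n := (wt b.1 + wt b.2)%R.
Definition tens_eps i b : int :=
  Num.max (eps i b.1) (eps i b.2 - pairing (wt b.1) i)%R.
Definition tens_phi i b : int :=
  Num.max (phi i b.1 + pairing (wt b.2) i)%R (phi i b.2).
Definition tens_e i b : option (C * D) :=
  if (eps i b.2 <= phi i b.1)%R then omap (fun x => (x, b.2)) (te i b.1)
  else omap (fun y => (b.1, y)) (te i b.2).
Definition tens_f i b : option (C * D) :=
  if (eps i b.2 < phi i b.1)%R then omap (fun x => (x, b.2)) (tf i b.1)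
  else omap (fun y => (b.1, y)) (tf i b.2).

Definition tensor : crystal_data n :=
  CrystalData tens_wt tens_eps tens_phi tens_e tens_f.
End Tensor.

Definition trivial_crystal (n : nat) : crystal_data n :=
  @CrystalData n unit (fun=> 0%R) (fun _ _ => 0%R) (fun _ _ => 0%R)
    (fun _ _ => None) (fun _ _ => None).

(* x_1 (x) (x_2 (x) (... (x) (x_m (x) trivial))) on the sequence
   [:: x_1; ...; x_m]. *)
Section TensorSeq.
Variables (n : nat) (C : crystal_data n).

Fixpoint tpow (m : nat) : crystal_data n :=
  if m is m'.+1 then tensor C (tpow m') else trivial_crystal n.

Fixpoint to_tpow (s : seq C) : tpow (size s) :=
  if s is x :: s' return tpow (size s) then (x, to_tpow s') else tt.

Fixpoint of_tpow (m : nat) : tpow m -> seq C :=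
  if m is m'.+1 return tpow m -> seq C
  then fun b => b.1 :: of_tpow b.2 else fun=> [::].

Definition tensor_seq : crystal_data n :=
  @CrystalData n (seq C)
    (fun s => wt (to_tpow s))
    (fun i s => eps i (to_tpow s))
    (fun i s => phi i (to_tpow s))
    (fun i s => omap (@of_tpow _) (te i (to_tpow s)))
    (fun i s => omap (@of_tpow _) (tf i (to_tpow s))).
End TensorSeq.

(* The maximal number of applications of g with result different from 0, for
   an operator g all of whose strings have length at most 2. *)
Definition nb_app (T : Type) (g : T -> option T) (x : T) : int :=
  if g x is Some y then (if g y is Some _ then 2%R else 1%R) else 0%R.

(* * Letters, columns and tableaux *)

Inductive letter := Pos of nat | Zero | Bar of nat.

Definition letter_code (x : letter) : nat + option nat :=
  match x with Pos a => inl a | Zero => inr None | Bar a => inr (Some a) end.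
Definition letter_decode (c : nat + option nat) : letter :=
  match c with inl a => Pos a | inr None => Zero | inr (Some a) => Bar a end.
Lemma letter_codeK : cancel letter_code letter_decode.
Proof. by case. Qed.
HB.instance Definition _ := Countable.copy letter (can_type letter_codeK).

Definition is_pos (n : nat) (x : letter) : bool :=
  if x is Pos a then 1 <= a <= n else false.
Definition is_bar (n : nat) (x : letter) : bool :=
  if x is Bar a then 1 <= a <= n else false.
Definition in_J (n : nat) (x : letter) : bool :=
  [|| is_pos n x, x == Zero | is_bar n x].

(* 1 < 2 < ... < 0 < ... < bar 2 < bar 1 *)
Definition llt (x y : letter) : bool :=
  match x, y with
  | Pos a, Pos b => a < b
  | Pos _, _ => true
  | Zero, Bar _ => true
  | Bar a, Bar b => b < a
  | _, _ => false
  end.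
Definition lle (x y : letter) : bool := (x == y) || llt x y.

(* Columns are listed from bottom to top. *)
Definition col := seq letter.

(* Columns are listed from right to left; each comes with the number of empty
   levels below its bottom entry. *)
Definition skew := seq (nat * col).

(* Level i counted from the bottom and column j counted from the right, both
   starting at 1. *)
Definition filling := nat -> nat -> option letter.

Definition entry (T : skew) : filling := fun i j =>
  if j is j'.+1 then
    let c := nth (0, [::]) T j' in
    if c.1 < i then onth c.2 (i - c.1).-1 else None
  else None.

Definition levels (T : skew) : seq nat :=
  iota 1 (foldr maxn 0 [seq c.1 + size c.2 | c <- T]).

Definition row_at (T : skew) (i : nat) : seq letter :=
  pmap (entry T i) (iota 1 (size T)).

(* x is just above y in a semistandard column. *)
Definition above (x y : letter) : bool :=
  llt x y || (x == Zero) && (y == Zero).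

Definition col_ok (c : col) : bool := sorted (fun x y => above y x) c.
Definition row_ok (r : seq letter) : bool :=
  sorted (fun x y => lle y x) r && (count_mem Zero r <= 1).

Definition sst (T : skew) : bool :=
  all (fun c => col_ok c.2) T && all (fun i => row_ok (row_at T i)) (levels T).

(* Rows from top to bottom, each from right to left. *)
Definition cells (T : skew) : seq (nat * nat) :=
  [seq ij <- [seq (i, j) | i <- rev (levels T), j <- iota 1 (size T)]
     | entry T ij.1 ij.2].

Definition word (T : skew) : seq letter :=
  pmap (fun ij => entry T ij.1 ij.2) (cells T).

(* The tableau of the same shape as T with reading word w. *)
Definition refill (T : skew) (w : seq letter) : skew :=
  [seq (let c := nth (0, [::]) T j.-1 in
        (c.1, [seq nth Zero w (index (i, j) (cells T))
                 | i <- iota c.1.+1 (size c.2)]))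
     | j <- iota 1 (size T)].

Definition straight (T : seq col) : skew := [seq (0, c) | c <- T].

(* * The letter crystal *)

Definition letter_wt (n : nat) (x : letter) : weight n :=
  mkweight n (fun k => match x with
    | Pos a => (k == a)%:R *+ 2
    | Zero => 0
    | Bar a => - ((k == a)%:R *+ 2)
    end)%R.

Definition letter_f (n i : nat) (x : letter) : option letter :=
  match x with
  | Pos a => if a == i then Some (if i < n then Pos i.+1 else Zero) else None
  | Zero => if i == n then Some (Bar n) else None
  | Bar a => if (i < n) && (a == i.+1) then Some (Bar i) else None
  end.

Definition letter_e (n i : nat) (x : letter) : option letter :=
  match x with
  | Pos a => if (i < n) && (a == i.+1) then Some (Pos i) else None
  | Zero => if i == n then Some (Pos n) else None
  | Bar a => if a == i then Some (if i < n then Bar i.+1 else Zero) else None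
  end.

(* For i < n, restricted to the letters bar n, ..., bar 1, this is also the
   l-crystal bar n -> ... -> bar 1 used in the spinor model. *)
Definition letters (n : nat) : crystal_data n :=
  @CrystalData n letter (letter_wt n)
    (fun i => nb_app (letter_e n i)) (fun i => nb_app (letter_f n i))
    (letter_e n) (letter_f n).

Definition words (n : nat) : crystal_data n := tensor_seq (letters n).

(* * Partitions *)

Definition in_Pn (n : nat) (la : seq nat) : bool :=
  (size la == n) && sorted geq la.

Definition conj_part (la : seq nat) (j : nat) : nat := count (leq j) la.

(* * Kashiwara-Nakashima tableaux *)

Definition KN_b1 (T : skew) (j : nat) : Prop :=
  forall a i1 i2 : nat, 1 <= a -> i1 < i2 ->
    entry T i1 j = Some (Bar a) -> entry T i2 j = Some (Pos a) ->
    i1 + (size (nth (0, [::]) T j.-1).2 - i2 + 1) <= a.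

Definition KN_b2 (n : nat) (T : skew) (j : nat) : Prop :=
  forall a b p q r s : nat, 1 <= a -> a <= b -> b < n ->
    p <= q -> q < r -> r <= s ->
    [/\ entry T p j = Some (Bar a), entry T q j = Some (Bar b),
        entry T r j = Some (Pos b) & entry T s j.+1 = Some (Pos a)] \/
    [/\ entry T p j = Some (Bar a), entry T q j.+1 = Some (Bar b),
        entry T r j.+1 = Some (Pos b) & entry T s j.+1 = Some (Pos a)] ->
    (q - p) + (s - r) < b - a.

Definition KN_b3 (n : nat) (T : skew) (j : nat) : Prop :=
  forall a p q r s : nat, 1 <= a -> a < n ->
    p <= q -> q < r -> r = q.+1 -> r <= s ->
    let mid := [:: Some (Pos n); Some Zero; Some (Bar n)] in
    [/\ entry T p j = Some (Bar a), entry T s j.+1 = Some (Pos a),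
        entry T q j \in mid & entry T r j \in mid] \/
    [/\ entry T p j = Some (Bar a), entry T s j.+1 = Some (Pos a),
        entry T q j.+1 \in mid & entry T r j.+1 \in mid] ->
    (q - p) + (s - r) < n - a.

Definition KN_b4 (n : nat) (T : skew) (j : nat) : Prop :=
  forall p q : nat, p < q ->
    ~ (entry T p j \in [:: Some Zero; Some (Bar n)] /\
       entry T q j.+1 \in [:: Some (Pos n); Some Zero]).

(* Shape la^pi: the j-th column from the right has height la'_j, and the
   bottoms are aligned. *)
Definition in_KN (n : nat) (la : seq nat) (T : seq col) : Prop :=
  let S := straight T in
  [/\ [seq size c | c <- T] = [seq conj_part la j | j <- iota 1 (head 0 la)],
      all (all (in_J n)) T, sst S &
      forall j : nat, 1 <= j ->
        [/\ KN_b1 S j, KN_b2 n S j, KN_b3 n S j & KN_b4 n S j]].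

Definition in_KN_sp (n : nat) (c : col) : bool :=
  [&& size c == n, all (in_J n) c, Zero \notin c, col_ok c &
      all (fun a => ~~ ((Pos a \in c) && (Bar a \in c))) (iota 1 n)].

(* KN tableaux of shape mu + sigma_n, written as pairs (T_0, T) with T_0 the
   column of half width. *)
Definition in_KN_half (n : nat) (mu : seq nat) (X : col * seq col) : Prop :=
  let S := straight (X.1 :: X.2) in
  [/\ in_KN_sp n X.1, in_KN n mu X.2, sst S &
      [/\ KN_b2 n S 1, KN_b3 n S 1 & KN_b4 n S 1]].

(* T is read column by column, from right to left, each column from top to
   bottom.  Reading row by row (rows from top to bottom, each from right to
   left) does not make KN_la stable: for n = 2 and la = (2,2), the tableau with
   rows (2, bar 2) and (bar 2, bar 1) would be sent by e_1 to the tableau with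
   rows (2, bar 2) and (bar 2, bar 2), which is not semistandard. *)
Definition KN_word (T : seq col) : seq letter := flatten [seq rev c | c <- T].
Definition KN_refill (T : seq col) (w : seq letter) : seq col :=
  [seq rev c | c <- reshape (shape T) w].

Definition KN_crystal (n : nat) : crystal_data n :=
  @CrystalData n (seq col)
    (fun T => wt (KN_word T : words n))
    (fun i T => eps i (KN_word T : words n))
    (fun i T => phi i (KN_word T : words n))
    (fun i T => omap (KN_refill T) (te i (KN_word T : words n)))
    (fun i T => omap (KN_refill T) (tf i (KN_word T : words n))).

Definition sp_wt (n : nat) (c : col) : weight n :=
  mkweight n (fun k => (Pos k \in c)%:R - (Bar k \in c)%:R)%R.

Fixpoint bitseqs (m : nat) : seq bitseq :=
  if m is m'.+1 then [seq b :: s | b <- [:: true; false], s <- bitseqs m']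
  else [:: [::]].

(* The element of KN^sp containing k iff the (k-1)-st bit is true. *)
Definition sp_col (n : nat) (s : bitseq) : col :=
  [seq Bar k | k <- iota 1 n & ~~ nth false s k.-1] ++
  [seq Pos k | k <- rev (iota 1 n) & nth false s k.-1].

(* The element of KN^sp of weight w, if any. *)
Definition sp_of_wt (n : nat) (w : weight n) : option col :=
  ohead [seq c <- [seq sp_col n s | s <- bitseqs n] | sp_wt n c == w].

Definition sp_e (n i : nat) (c : col) : option col :=
  sp_of_wt (sp_wt n c + alpha n i)%R.
Definition sp_f (n i : nat) (c : col) : option col :=
  sp_of_wt (sp_wt n c - alpha n i)%R.

Definition KN_sp_crystal (n : nat) : crystal_data n :=
  @CrystalData n col (sp_wt n)
    (fun i => nb_app (sp_e n i)) (fun i => nb_app (sp_f n i))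
    (sp_e n) (sp_f n).

(* * Two-column tableaux *)

(* Left column L and right column R, the bottom of R being d levels above the
   bottom of L.  The shape is lambda(a,b,c) with a = d, c = size L - d and
   b = size R - c, provided d <= size L <= size R + d. *)
Definition two_col (d : nat) (L R : col) : skew := [:: (d, R); (0, L)].

(* frak r_T for T of shape lambda(a,b,c). *)
Definition slide_rank (a : nat) (L R : col) : nat :=
  let b := size R - (size L - a) in
  last 0 [seq k <- iota 0 (minn a b).+1 | sst (two_col (a - k) L R)].

(* The k for which the tableau of shape lambda(u-k,v-k,k) with columns U, V is
   semistandard with frak r = 0. *)
Definition overlap (U V : col) : nat :=
  head 0 [seq k <- iota 0 (minn (size U) (size V)).+1
    | sst (two_col (size U - k) U V) && (slide_rank (size U - k) U V == 0)].

Definition upd (T : filling) (i j : nat) (x : option letter) : filling :=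
  fun i' j' => if (i' == i) && (j' == j) then x else T i' j'.

(* Jeu de taquin into the outer empty cell (i,j): the larger of the entries
   above and to the left moves into the hole, the one above in case of a tie.
   The argument m bounds the number of moves. *)
Fixpoint jdt_outer (m : nat) (T : filling) (i j : nat) : filling :=
  if m is m'.+1 then
    let up x := jdt_outer m' (upd (upd T i j (Some x)) i.+1 j None) i.+1 j in
    let left y := jdt_outer m' (upd (upd T i j (Some y)) i j.+1 None) i j.+1 in
    match T i.+1 j, T i j.+1 with
    | Some x, Some y => if llt x y then left y else up x
    | Some x, None => up x
    | None, Some y => left y
    | None, None => T
    end
  else T.

(* Jeu de taquin into the inner empty cell (i,j): the smaller of the entries
   below and to the right moves into the hole, the one below in case of a
   tie. *)
Fixpoint jdt_inner (m : nat) (T : filling) (i j : nat) : filling :=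
  if m is m'.+1 then
    let down x := jdt_inner m' (upd (upd T i j (Some x)) i.-1 j None) i.-1 j in
    let right y := jdt_inner m' (upd (upd T i j (Some y)) i j.-1 None) i j.-1 in
    match T i.-1 j, T i j.-1 with
    | Some x, Some y => if llt y x then right y else down x
    | Some x, None => down x
    | None, Some y => right y
    | None, None => T
    end
  else T.

(* The columns (left, right) of a filling of levels 1..m. *)
Definition columns (m : nat) (T : filling) : col * col :=
  (pmap (T^~ 2) (iota 1 m), pmap (T^~ 1) (iota 1 m)).

Definition calE (X : col * col) : option (col * col) :=
  let: (U, V) := X in
  let a := size U - overlap U V in
  let m := size U + size V in
  if a == 0 then None
  else Some (columns m (jdt_outer m (entry (two_col a U V)) a 1)).

Definition calF (X : col * col) : option (col * col) :=
  let: (U, V) := X in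
  let a := size U - overlap U V in
  let b := size V - overlap U V in
  let m := size U + size V in
  if b == 0 then None
  else Some (columns m (jdt_inner m (entry (two_col a U V)) (size U).+1 2)).

Definition iter_opt (T : Type) (m : nat) (g : T -> option T) (x : T) :
    option T := iter m (obind g) (Some x).

(* * The spinor model *)

(* An element T of T(a) is recorded as (a, (T^L, T^R)). *)
Definition spinor : Type := nat * (col * col).

Definition in_T_sp (n : nat) (c : col) : bool := all (is_bar n) c && col_ok c.

Definition in_T_b (n a : nat) (T : spinor) : bool :=
  let: (a', (L, R)) := T in
  [&& a' == a, a < n, all (is_bar n) (L ++ R),
      a <= size L <= size R + a, sst (two_col a L R) &
      slide_rank a L R == 0].

(* m * omega_n + wt_l, for a list of letters bar k. *)
Definition spinor_wt (n m : nat) (s : seq letter) : weight n :=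
  mkweight n (fun k => m%:R - (count_mem (Bar k) s)%:R *+ 2)%R.

(* Adding or removing a box bar n on top of a column. *)
Definition box_f (n : nat) (c : col) : option col :=
  if col_ok (rcons c (Bar n)) then Some (rcons c (Bar n)) else None.
Definition box_e (n : nat) (c : col) : option col :=
  if last Zero c == Bar n then Some (take (size c).-1 c) else None.

Section SpinorCrystals.
Variable n : nat.

Definition col_word (c : col) : words n := word (straight [:: c]).
Definition col_refill (c : col) (w : seq letter) : col :=
  (head (0, [::]) (refill (straight [:: c]) w)).2.

Definition T_sp_crystal : crystal_data n :=
  @CrystalData n col (spinor_wt n 1)
    (fun i c => if i < n then eps i (col_word c) else nb_app (box_e n) c)
    (fun i c => if i < n then phi i (col_word c) else nb_app (box_f n) c)
    (fun i c => if i < n then omap (col_refill c) (te i (col_word c))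
                else box_e n c)
    (fun i c => if i < n then omap (col_refill c) (tf i (col_word c))
                else box_f n c).

Definition T_b_skew (T : spinor) : skew := two_col T.1 T.2.1 T.2.2.
Definition T_b_word (T : spinor) : words n := word (T_b_skew T).
Definition T_b_refill (T : spinor) (w : seq letter) : spinor :=
  let S := refill (T_b_skew T) w in
  (T.1, ((nth (0, [::]) S 1).2, (nth (0, [::]) S 0).2)).

(* T <-> T^R (x) T^L *)
Definition T_b_tens (T : spinor) : tensor T_sp_crystal T_sp_crystal :=
  (T.2.2, T.2.1).
Definition T_b_untens (a : nat) (X : col * col) : spinor := (a, (X.2, X.1)).

Definition T_b_crystal : crystal_data n :=
  @CrystalData n spinor
    (fun T => spinor_wt n 2 (T.2.1 ++ T.2.2))
    (fun i T => if i < n then eps i (T_b_word T) else eps i (T_b_tens T))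
    (fun i T => if i < n then phi i (T_b_word T) else phi i (T_b_tens T))
    (fun i T => if i < n then omap (T_b_refill T) (te i (T_b_word T))
                else omap (T_b_untens T.1) (te i (T_b_tens T)))
    (fun i T => if i < n then omap (T_b_refill T) (tf i (T_b_word T))
                else omap (T_b_untens T.1) (tf i (T_b_tens T))).
End SpinorCrystals.

(* The pair (^L T, ^R T); on T(a), calE^a T is never 0. *)
Definition outer_cols (T : spinor) : col * col :=
  odflt ([::], [::]) (iter_opt T.1 calE T.2).

(* T_2 < T_1, in terms of the parameter a1 and the columns T_1^L, ^L T_1. *)
Definition prec_cols (T2 : spinor) (a1 : nat) (L1 lL1 : col) : Prop :=
  let: (a2, (_, R2)) := T2 in
  [/\ size R2 + a1 <= size L1,
      forall i, i < size R2 -> i < size lL1 ->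
        lle (nth Zero R2 i) (nth Zero lL1 i) &
      forall i, i + (a2 - a1) < size (outer_cols T2).2 -> i < size L1 ->
        lle (nth Zero (outer_cols T2).2 (i + (a2 - a1))) (nth Zero L1 i)].

Definition prec (T2 T1 : spinor) : Prop :=
  prec_cols T2 T1.1 T1.2.1 (outer_cols T1).1.

Definition prec_sp (T2 : spinor) (T1 : col) : Prop := prec_cols T2 0 T1 T1.

(* The tuple (T_l, ..., T_1) is the sequence [:: T_1; ...; T_l]. *)
Definition in_T (n : nat) (la : seq nat) (Ts : seq spinor) : Prop :=
  let T i := nth (0, ([::], [::])) Ts i.-1 in
  [/\ size Ts = head 0 la,
      forall i, 1 <= i <= head 0 la -> in_T_b n (n - conj_part la i) (T i) &
      forall i, 1 <= i < head 0 la -> prec (T i.+1) (T i)].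

(* The tuple (T_l, ..., T_1, T_0) is the pair (T_0, [:: T_1; ...; T_l]). *)
Definition in_T_half (n : nat) (mu : seq nat) (X : col * seq spinor) : Prop :=
  [/\ in_T_sp n X.1, in_T n mu X.2 &
      if X.2 is T1 :: _ then prec_sp T1 X.1 else True].

(* * The maps Psi *)

Definition minus_part (n : nat) (c : col) : col := [seq x <- c | is_bar n x].

Definition plus_compl (n : nat) (c : col) : col :=
  [seq Bar k | k <- iota 1 n & Pos k \notin c].

Definition Psi_col (n a : nat) (c : col) : option (col * col) :=
  iter_opt (n - a) calF (minus_part n c, plus_compl n c).

(* The default value ([::], [::]), taken when calF^(n-a) gives 0, does not lie
   in T(n-a) if a < n. *)
Definition Psi (n : nat) (la : seq nat) (T : seq col) : seq spinor :=
  [seq (n - conj_part la j,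
        odflt ([::], [::]) (Psi_col n (conj_part la j) (nth [::] T j.-1)))
     | j <- iota 1 (head 0 la)].

Definition Psi_half (n : nat) (mu : seq nat) (X : col * seq col) :
    col * seq spinor := (minus_part n X.1, Psi n mu X.2).

(* Main.v *)
(* A Kashiwara-Nakashima column C is encoded by two sets of indices: U, those of
   its barred letters, and V, the complement of its positive letters.  Write
   cnt X k for the number of elements of X in 1..k.  Then (b-1) says that
   cnt U <= cnt V, and calF^d, d = n - ht(C), moves the first d unmatched
   elements of V to U: with
     nu k = min (d, min_(j >= k) (cnt V j - cnt U j)),
   the columns L, R of Psi(C) satisfy cnt L = cnt U + nu and cnt R = cnt V - nu.
   The operators of index i < n on C are those of V (x) U, and those of any index
   are those of R (x) L, so Psi commutes with them.

   For two adjacent columns C_2 C_1, the conditions on KN tableaux and the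
   relation T_2 < T_1 are both equivalent to
     cnt R_2 k <= cnt U_1 k  and  cnt V_2 k <= cnt L_1 k + (d_2 - d_1)
   for all k: a minimal violation is one of the configurations excluded by
   (b-2)-(b-4).  A column of half width behaves as a column with d = 0 and
   U = V = L.  The tensor product rule preserves these inequalities: an
   operator could break one only at an index where the rule selects the other
   column.  Hence the KN tableaux form a subcrystal of a tensor product of
   columns, and Psi carries its structure to the spinor model. *)
Require Import Defs.
From mathcomp Require Import all_boot all_order all_algebra.
From mathcomp Require Import zify.
Import Defs.

Set Implicit Arguments.
Unset Strict Implicit.
Unset Printing Implicit Defensive.

Import Order.TTheory GRing.Theory Num.Theory.

Local Open Scope nat_scope.

Lemma coord2_mk n c k : 1 <= k <= n -> coord2 (mkweight n c) k = c k.
Proof.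
move=> /andP[k1 kn]; rewrite /coord2; case: insubP => [j _ Ej|]; last by lia.
by rewrite mxE Ej prednK.
Qed.

Lemma coord2D n (w1 w2 : weight n) k :
  coord2 (w1 + w2)%R k = (coord2 w1 k + coord2 w2 k)%R.
Proof. by rewrite /coord2; case: insub => [j|]; rewrite ?mxE ?addr0. Qed.

Lemma coord2N n (w : weight n) k : coord2 (- w)%R k = (- coord2 w k)%R.
Proof. by rewrite /coord2; case: insub => [j|]; rewrite ?mxE ?oppr0. Qed.

Lemma weight_eq n (w1 w2 : weight n) :
  (forall k, 1 <= k <= n -> coord2 w1 k = coord2 w2 k) -> w1 = w2.
Proof.
move=> H; apply/rowP => j; move: (H j.+1 (ltn_ord j)).
rewrite /coord2 /=; case: insubP => [j' _ Ej|]; last by rewrite ltn_ord.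
by rewrite (val_inj Ej : j' = j).
Qed.

Lemma in_PD n (w1 w2 : weight n) : in_P w1 -> in_P w2 -> in_P (w1 + w2)%R.
Proof.
move=> H1 H2 k l Hk Hl; rewrite !coord2D.
by have := H1 _ _ Hk Hl; have := H2 _ _ Hk Hl; lia.
Qed.

Lemma in_P0 n : in_P (0%R : weight n).
Proof.
have E k : coord2 (0%R : weight n) k = 0%R.
  by rewrite /coord2; case: insub => [j|] //; rewrite mxE.
by move=> k l _ _; rewrite !E.
Qed.

Lemma pairing0 n i : pairing (0%R : weight n) i = 0%R.
Proof.
have E k : coord2 (0%R : weight n) k = 0%R.
  by rewrite /coord2; case: insub => [j|] //; rewrite mxE.
by rewrite /pairing !E; case: ifP.
Qed.

Lemma pairingD n (w1 w2 : weight n) i : in_P w1 -> in_P w2 -> 1 <= i ->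
  pairing (w1 + w2)%R i = (pairing w1 i + pairing w2 i)%R.
Proof.
move=> H1 H2 i1; rewrite /pairing; case: ifP => iln; last by rewrite coord2D.
have Hi : 1 <= i <= n by lia.
have Hj : 1 <= i.+1 <= n by lia.
rewrite !coord2D; have := H1 _ _ Hi Hj; have := H2 _ _ Hi Hj; lia.
Qed.

Lemma coord2_alpha n i k : 1 <= k <= n ->
  coord2 (alpha n i) k = (((k == i)%:R - ((i < n)%N && (k == i.+1))%:R) *+ 2)%R.
Proof. exact: coord2_mk. Qed.

Lemma in_P_alpha n i : in_P (alpha n i).
Proof. by move=> k l Hk Hl; rewrite !coord2_alpha //; lia. Qed.

Lemma in_PN n (w : weight n) : in_P w -> in_P (- w)%R.
Proof.
move=> H k l Hk Hl; rewrite !coord2N; have := H _ _ Hk Hl; lia.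
Qed.

Lemma pairingN n (w : weight n) i : in_P w -> 1 <= i ->
  pairing (- w)%R i = (- pairing w i)%R.
Proof.
move=> H i1; have := pairingD H (in_PN H) i1.
rewrite subrr pairing0; lia.
Qed.

Lemma pairing_alpha n i : 1 <= i <= n -> pairing (alpha n i) i = 2%R.
Proof.
move=> Hi; rewrite /pairing; case: ifP => iln.
  have Hj : 1 <= i.+1 <= n by lia.
  rewrite !coord2_alpha // iln !eqxx /=.
  have -> : (i == i.+1) = false by lia.
  by have -> : (i.+1 == i) = false by lia.
by rewrite coord2_alpha // iln eqxx.
Qed.

Definition regular n (C : crystal_data n) (B : C -> Prop) : Prop :=
  is_crystal B /\ forall x, B x -> forall i, 1 <= i <= n ->
    (0 <= eps i x)%R /\ (0 <= phi i x)%R.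

Lemma trivial_regular n : @regular n (trivial_crystal n) (fun=> True).
Proof.
split=> [x _|x _ i _] //=; split=> [|i _]; first exact: in_P0.
by split=> //=; rewrite pairing0.
Qed.

Lemma tensor_regular n (C D : crystal_data n) (B1 : C -> Prop) (B2 : D -> Prop) :
  regular B1 -> regular B2 ->
  @regular n (tensor C D) (fun b => B1 b.1 /\ B2 b.2).
Proof.
move=> [K1 P1] [K2 P2]; split=> [[x1 x2] /= [b1 b2]|[x1 x2] /= [b1 b2] i Hi]; last first.
  have [e1 _] := P1 _ b1 _ Hi; have [_ f2] := P2 _ b2 _ Hi.
  by rewrite /tens_eps /tens_phi /= !le_max e1 f2 orbT.
have [in1 A1] := K1 _ b1; have [in2 A2] := K2 _ b2.
split; first exact: in_PD.
move=> i Hi; have i1 : 1 <= i by case/andP: Hi.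
have [E1 T1 F1 N1 M1] := A1 i Hi; have [E2 T2 F2 N2 M2] := A2 i Hi.
have [e1 f1] := P1 _ b1 _ Hi; have [e2 f2] := P2 _ b2 _ Hi.
have pa := pairing_alpha Hi; have ia : in_P (alpha n i) by exact: in_P_alpha.
rewrite /tens_eps /tens_phi /tens_e /tens_f /tens_wt /=.
have pD1 := pairingD in1 ia i1; have pD2 := pairingD in2 ia i1.
have pN1 := pairingD in1 (in_PN ia : in_P _) i1; have pN2 := pairingD in2 (in_PN ia : in_P _) i1.
rewrite pairingN // in pN1 pN2.
split.
- by rewrite pairingD //; lia.
- move=> [y1 y2]; case: ifP => c.
    case E: (te i x1) => [z|] //= [<- <-] /=; have [bz wz ez fz tz] := T1 _ E.
    rewrite wz ez fz pD1 tz; split=> //; try lia; first by rewrite addrAC.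
    by have -> : (eps i x2 < phi i x1 + 1)%R by lia.
  case E: (te i x2) => [z|] //= [<- <-] /=; have [bz wz ez fz tz] := T2 _ E.
  rewrite wz ez fz pD2 tz; split=> //; try lia; first by rewrite addrA.
  by have -> : (eps i x2 - 1 < phi i x1)%R = false by lia.
- move=> [y1 y2]; case: ifP => c.
    case E: (tf i x1) => [z|] //= [<- <-] /=; have [bz wz ez fz tz] := F1 _ E.
    rewrite wz ez fz pN1 tz; split=> //; try lia; first by rewrite addrAC.
    by have -> : (eps i x2 <= phi i x1 - 1)%R by lia.
  case E: (tf i x2) => [z|] //= [<- <-] /=; have [bz wz ez fz tz] := F2 _ E.
  rewrite wz ez fz pN2 tz; split=> //; try lia; first by rewrite addrA.
  by have -> : (eps i x2 + 1 <= phi i x1)%R = false by lia.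
- case: ifP => c; [case E: te => [z|] //= _; have := N1 E|case E: te => [z|] //= _; have := N2 E]; lia.
- case: ifP => c; [case E: tf => [z|] //= _; have := M1 E|case E: tf => [z|] //= _; have := M2 E]; lia.
Qed.

Definition morph n (C D : crystal_data n) (psi : C -> D) (x : C) : Prop :=
  wt (psi x) = wt x /\ forall i : nat, 1 <= i <= n ->
    [/\ eps i (psi x) = eps i x, phi i (psi x) = phi i x,
        te i (psi x) = omap psi (te i x) & tf i (psi x) = omap psi (tf i x)].

Lemma transfer_crystal n (C D : crystal_data n) (B : C -> Prop) (B' : D -> Prop)
    (psi : C -> D) :
  is_crystal B -> (forall x, B x -> B' (psi x)) ->
  (forall z, B' z -> exists2 x, B x & psi x = z) ->
  (forall x, B x -> morph psi x) -> is_crystal B'.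
Proof.
move=> K inB sur mor z /sur[x bx <-].
have [inP A] := K x bx; have [Ew M] := mor x bx; rewrite Ew; split=> // i Hi.
have [E T F N O] := A i Hi; have [Ee Ef Et Es] := M i Hi.
rewrite Ee Ef Et Es; split=> //.
- move=> y; case Tx: (te i x) => [y'|] //= [<-]; have [b w e f t] := T _ Tx.
  have [w' M'] := mor y' b; have [e' f' _ t'] := M' i Hi.
  by rewrite w' e' f' t' t; split=> //; apply: inB.
- move=> y; case Tx: (tf i x) => [y'|] //= [<-]; have [b w e f t] := F _ Tx.
  have [w' M'] := mor y' b; have [e' f' t' _] := M' i Hi.
  by rewrite w' e' f' t' t; split=> //; apply: inB.
- by move=> H; apply: N; case: (te i x) H.
- by move=> H; apply: O; case: (tf i x) H.
Qed.

Lemma transfer_regular n (C D : crystal_data n) (B : C -> Prop) (B' : D -> Prop)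
    (psi : C -> D) :
  regular B -> (forall x, B x -> B' (psi x)) ->
  (forall z, B' z -> exists2 x, B x & psi x = z) ->
  (forall x, B x -> morph psi x) -> regular B'.
Proof.
move=> [K P] inB sur mor; split; first exact: transfer_crystal K inB sur mor.
move=> z /sur[x bx <-] i Hi; have [_ M] := mor x bx; have [-> -> _ _] := M i Hi.
exact: P.
Qed.

Lemma tensor_morph n (C D C' D' : crystal_data n) (f : C -> C') (g : D -> D') x y :
  morph f x -> morph g y ->
  @morph n (tensor C D) (tensor C' D') (fun b => (f b.1, g b.2)) (x, y).
Proof.
move=> [w1 M1] [w2 M2]; split=> [|i Hi]; first by rewrite /= /tens_wt /= w1 w2.
have [e1 f1 t1 s1] := M1 i Hi; have [e2 f2 t2 s2] := M2 i Hi.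
rewrite /= /tens_eps /tens_phi /tens_e /tens_f /= w1 w2 e1 e2 f1 f2 t1 t2 s1 s2.
by split=> //; case: ifP => _; case: (_ i _).
Qed.

Lemma of_to_tpow n (C : crystal_data n) (s : seq C) : of_tpow (to_tpow s) = s.
Proof. by elim: s => //= x s ->. Qed.

Section TensorSeq.
Variables (n : nat) (C : crystal_data n).
Local Notation TS := (tensor_seq C).

Lemma tseq_te_cons i (x : C) (s : TS) : te i (x :: s : TS) =
  if (eps i s <= phi i x)%R then omap (fun y => y :: s) (te i x)
  else omap (cons x) (te i s).
Proof.
rewrite /= /tens_e /=; case: ifP => _; first by case: te => //= y; rewrite of_to_tpow.
by case: te.
Qed.

Lemma tseq_tf_cons i (x : C) (s : TS) : tf i (x :: s : TS) =
  if (eps i s < phi i x)%R then omap (fun y => y :: s) (tf i x)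
  else omap (cons x) (tf i s).
Proof.
rewrite /= /tens_f /=; case: ifP => _; first by case: tf => //= y; rewrite of_to_tpow.
by case: tf.
Qed.

Lemma cons_morph (x : C) (s : TS) :
  @morph n (tensor C TS) TS (fun b => b.1 :: b.2) (x, s).
Proof.
split=> // i _; rewrite tseq_te_cons tseq_tf_cons /= /tens_e /tens_f /=.
by split=> //; case: ifP => _; case: (_ i _).
Qed.

Fixpoint all_in (T : Type) (B : T -> Prop) (s : seq T) : Prop :=
  if s is x :: s' then B x /\ all_in B s' else True.

Variable B : C -> Prop.
Hypothesis regB : regular B.

Lemma tseq_regular_size m :
  @regular n TS (fun s => size s = m /\ all_in B s).
Proof.
elim: m => [|m IH].
  apply: (@transfer_regular n (trivial_crystal n) TS (fun=> True) _ (fun=> [::])) => //.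
    exact: trivial_regular.
  by move=> [|x s] [] // _ _; exists tt.
apply: (@transfer_regular n (tensor C TS) TS _ _ (fun b => b.1 :: b.2) (tensor_regular regB IH)).
- by move=> [x s] /= [bx [<- bs]].
- by move=> [|x s] [] //= [sz] [bx bs]; exists (x, s).
- move=> [x s] _; exact: cons_morph.
Qed.

Lemma tseq_regular : @regular n TS (all_in B).
Proof.
split=> [s bs|s bs]; have [K P] := tseq_regular_size (size s); last exact: P.
have [inP A] := K s (conj (erefl _) bs); split=> // i Hi.
have [E T F N O] := A i Hi; split=> // y.
  by move/T => [] [].
by move/F => [] [].
Qed.

Lemma regular_te0 (D : crystal_data n) (B' : D -> Prop) : regular B' ->
  forall x i, B' x -> 1 <= i <= n -> (eps i x <= 0)%R -> te i x = None.
Proof.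
move=> [K P] x i bx Hi e0; case E: te => [y|] //; have [_ A] := K x bx.
have [_ T _ _ _] := A i Hi; have [by' _ ey _ _] := T _ E.
have [] := P y by' i Hi; lia.
Qed.

Lemma regular_tf0 (D : crystal_data n) (B' : D -> Prop) : regular B' ->
  forall x i, B' x -> 1 <= i <= n -> (phi i x <= 0)%R -> tf i x = None.
Proof.
move=> [K P] x i bx Hi e0; case E: tf => [y|] //; have [_ A] := K x bx.
have [_ _ T _ _] := A i Hi; have [by' _ _ ey _] := T _ E.
have [] := P y by' i Hi; lia.
Qed.

Lemma tseq_eps_cons i (x : C) (s : TS) : eps i (x :: s : TS) =
  Num.max (eps i x) (eps i s - pairing (wt x) i)%R.
Proof. by []. Qed.

Lemma tseq_phi_cons i (x : C) (s : TS) : phi i (x :: s : TS) =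
  Num.max (phi i x + pairing (wt s) i)%R (phi i s).
Proof. by []. Qed.

Lemma tseq_wt_cons (x : C) (s : TS) : wt (x :: s : TS) = (wt x + wt s)%R.
Proof. by []. Qed.

Lemma cat_morph (s1 s2 : TS) : all_in B s1 -> all_in B s2 ->
  @morph n (tensor TS TS) TS (fun b => b.1 ++ b.2) (s1, s2).
Proof.
move=> b1 b2; have [K P] := tseq_regular; have [in2 A2] := K s2 b2.
have [KB PB] := regB.
pose TE := (tseq_te_cons, tseq_tf_cons, tseq_eps_cons, tseq_phi_cons).
elim: s1 b1 => [_|x s1 IH [bx b1]].
  split=> [|i Hi]; first by rewrite /= /tens_wt /= add0r.
  have [E _ _ _ _] := A2 i Hi; have [e0 f0] := P s2 b2 i Hi.
  have e00 := regular_te0 tseq_regular b2 Hi; have f00 := regular_tf0 tseq_regular b2 Hi.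
  split.
  - by change (eps i s2 = Num.max 0 (eps i s2 - pairing (0 : weight n) i))%R; rewrite pairing0; lia.
  - by change (phi i s2 = Num.max (0 + pairing (wt s2) i) (phi i s2))%R; lia.
  - change (te i s2 = omap (fun b : TS * TS => b.1 ++ b.2)
     (if (eps i s2 <= 0)%R then None else omap (fun y => ([::], y)) (te i s2))).
    by case: ifP => [/e00 -> //|_]; case: (te i s2).
  change (tf i s2 = omap (fun b : TS * TS => b.1 ++ b.2)
     (if (eps i s2 < 0)%R then None else omap (fun y => ([::], y)) (tf i s2))).
  by case: ifP => [|_]; [lia|case: (tf i s2)].
have {IH} [w M] := IH b1; have [in1 A1] := K s1 b1; have [inx Ax] := KB x bx.
split=> [|i Hi]; first by move: w; rewrite /= /tens_wt /= -addrA => ->.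
have {M} [e f t s] := M i Hi.
have [E1 _ _ _ _] := A1 i Hi; have [e1 f1] := P s1 b1 i Hi.
have [E2 _ _ _ _] := A2 i Hi; have [e2 f2] := P s2 b2 i Hi.
have [Ex _ _ _ _] := Ax i Hi; have [ex fx] := PB x bx i Hi.
have i1 : 1 <= i by lia.
have pD := pairingD in1 in2 i1; have pDx := pairingD inx in1 i1.
change (eps i (s1 ++ s2 : TS) = Num.max (eps i (s1 : TS)) (eps i s2 - pairing (wt (s1 : TS)) i)%R) in e.
change (phi i (s1 ++ s2 : TS) = Num.max (phi i (s1 : TS) + pairing (wt s2) i)%R (phi i s2)) in f.
change (wt (s1 ++ s2 : TS) = (wt (s1 : TS) + wt s2)%R) in w.
change (te i (s1 ++ s2 : TS) = omap (fun b : TS * TS => b.1 ++ b.2)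
     (if (eps i s2 <= phi i (s1 : TS))%R then omap (fun y => (y, s2)) (te i (s1 : TS))
      else omap (fun y => (s1, y)) (te i s2))) in t.
change (tf i (s1 ++ s2 : TS) = omap (fun b : TS * TS => b.1 ++ b.2)
     (if (eps i s2 < phi i (s1 : TS))%R then omap (fun y => (y, s2)) (tf i (s1 : TS))
      else omap (fun y => (s1, y)) (tf i s2))) in s.
split.
- change (eps i (x :: (s1 ++ s2) : TS) =
    Num.max (eps i (x :: s1 : TS)) (eps i s2 - pairing (wt (x :: s1 : TS)) i)%R).
  by rewrite !TE e tseq_wt_cons pDx; lia.
- change (phi i (x :: (s1 ++ s2) : TS) =
    Num.max (phi i (x :: s1 : TS) + pairing (wt s2) i)%R (phi i s2)).
  by rewrite !TE f w pD; lia.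
- change (te i (x :: (s1 ++ s2) : TS) = omap (fun b : TS * TS => b.1 ++ b.2)
     (if (eps i s2 <= phi i (x :: s1 : TS))%R then omap (fun y => (y, s2)) (te i (x :: s1 : TS))
      else omap (fun y => (x :: s1, y)) (te i s2))).
  rewrite !TE e t.
  have -> : (Num.max (eps i (s1 : TS)) (eps i s2 - pairing (wt (s1 : TS)) i) <= phi i x)%R =
    (eps i (s1 : TS) <= phi i x)%R && (eps i s2 <= phi i x + pairing (wt (s1 : TS)) i)%R by lia.
  have -> : (eps i s2 <= Num.max (phi i x + pairing (wt (s1 : TS)) i) (phi i (s1 : TS)))%R =
    (eps i s2 <= phi i x + pairing (wt (s1 : TS)) i)%R || (eps i s2 <= phi i (s1 : TS))%R by lia.
  case: (lerP (eps i (s1 : TS)) (phi i x)) => c1; case: (lerP (eps i s2)) => c2; rewrite ?(andTb, andFb, orTb, orFb).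
  + by case: (te i x).
  + by case: ifP => c3; [lia|case: (te i s2)].
  + by case: ifP => c3; [case: (te i (s1 : TS))|lia].
  + by case: ifP => c3; [case: (te i (s1 : TS))|case: (te i s2)].
- change (tf i (x :: (s1 ++ s2) : TS) = omap (fun b : TS * TS => b.1 ++ b.2)
     (if (eps i s2 < phi i (x :: s1 : TS))%R then omap (fun y => (y, s2)) (tf i (x :: s1 : TS))
      else omap (fun y => (x :: s1, y)) (tf i s2))).
  rewrite !TE e s.
  have -> : (Num.max (eps i (s1 : TS)) (eps i s2 - pairing (wt (s1 : TS)) i) < phi i x)%R =
    (eps i (s1 : TS) < phi i x)%R && (eps i s2 < phi i x + pairing (wt (s1 : TS)) i)%R by lia.
  have -> : (eps i s2 < Num.max (phi i x + pairing (wt (s1 : TS)) i) (phi i (s1 : TS)))%R =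
    (eps i s2 < phi i x + pairing (wt (s1 : TS)) i)%R || (eps i s2 < phi i (s1 : TS))%R by lia.
  case: (ltrP (eps i (s1 : TS)) (phi i x)) => c1; case: (ltrP (eps i s2)) => c2; rewrite ?(andTb, andFb, orTb, orFb).
  + by case: (tf i x).
  + by case: ifP => c3; [lia|case: (tf i s2)].
  + by case: ifP => c3; [case: (tf i (s1 : TS))|lia].
  + by case: ifP => c3; [case: (tf i (s1 : TS))|case: (tf i s2)].
Qed.
End TensorSeq.

Lemma tseq_morph n (C D : crystal_data n) (f : C -> D) (s : seq C) :
  all_in (morph f) s -> @morph n (tensor_seq C) (tensor_seq D) (map f) s.
Proof.
elim: s => [_|x s IH [Mx /IH Ms]]; first by split.
have [w M] := tensor_morph Mx Ms; split=> // i Hi; have [e1 f1 t1 s1] := M i Hi.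
have [wx Mx'] := Mx; have [e2 f2 _ _] := Mx' i Hi.
have [ws Ms'] := Ms; have [e3 f3 _ _] := Ms' i Hi.
have [_ _ t4 s4] := Mx' i Hi; have [_ _ t5 s5] := Ms' i Hi.
split=> //.
  change (te i (f x :: map f s : tensor_seq D) = omap (map f) (te i (x :: s : tensor_seq C))).
  rewrite !tseq_te_cons e3 f2 t4 t5.
  by case: ifP => _; [case: (te i x)|case: (te i (s : tensor_seq C))].
change (tf i (f x :: map f s : tensor_seq D) = omap (map f) (tf i (x :: s : tensor_seq C))).
rewrite !tseq_tf_cons e3 f2 s4 s5.
by case: ifP => _; [case: (tf i x)|case: (tf i (s : tensor_seq C))].
Qed.

Lemma letter_fP n i x y : 1 <= i <= n -> in_J n x -> letter_f n i x = Some y ->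
  [/\ in_J n y, letter_e n i y = Some x & letter_wt n y = (letter_wt n x - alpha n i)%R].
Proof.
move=> Hi Jx H.
suff [Jy Ey W] : [/\ in_J n y, letter_e n i y = Some x &
   forall k, 1 <= k <= n -> coord2 (letter_wt n y) k =
    (coord2 (letter_wt n x) k - coord2 (alpha n i) k)%R].
  by split=> //; apply: weight_eq => k /W ->; rewrite coord2D coord2N.
case: x Jx H => [a||a] Jx /=.
- case: eqP => // ai [<-]; case: ifP => iln; split=> //=; rewrite ?iln ?eqxx ?ai //.
  + by rewrite /in_J /=; lia.
  + by move=> k Hk; rewrite !coord2_mk // iln; lia.
  + have -> : i = n by lia.
    by rewrite ?ltnn ?eqxx.
  + by move=> k Hk; rewrite !coord2_mk // iln; lia.
- case: eqP => // ai [<-]; rewrite ?ai; split=> //=; rewrite ?ltnn ?eqxx //.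
  + by rewrite /in_J /=; lia.
  + by move=> k Hk; rewrite !coord2_mk // ltnn; lia.
- case: ifP => // /andP[iln /eqP ai] [<-]; rewrite ai; split=> //=; rewrite ?iln ?eqxx //.
  + by move=> k Hk; rewrite !coord2_mk // iln; lia.
Qed.

Lemma letter_eP n i x y : 1 <= i <= n -> in_J n x -> letter_e n i x = Some y ->
  in_J n y /\ letter_f n i y = Some x.
Proof.
move=> Hi; case: x => [a||a] Jx /=.
- case: ifP => // /andP[iln /eqP ai] [<-] /=; rewrite eqxx iln ai; split=> //.
  by rewrite /in_J /=; lia.
- case: eqP => // ai [<-] /=; rewrite -ai ltnn eqxx; split=> //.
  by rewrite /in_J /=; lia.
- case: eqP => // ai [<-]; case: ifP => iln; (split; first by rewrite /in_J /=; lia).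
    by rewrite /= iln eqxx ai.
  have -> : i = n by lia.
  have <- : a = n by lia.
  by rewrite /= eqxx.
Qed.

Lemma letter_f3 n i x y z : letter_f n i x = Some y -> letter_f n i y = Some z ->
  letter_f n i z = None.
Proof.
case: x => [a||a] /=; case: ifP => // H [<-] /=.
- case: ifP => iln /=; first by have -> : (i.+1 == i) = false by lia.
  by case: eqP => // -> [<-] /=; rewrite ltnn.
- by move/eqP: H => ->; rewrite ltnn.
- have -> : (i == i.+1) = false by lia.
  by rewrite andbF.
Qed.

Lemma letter_e3 n i x y z : letter_e n i x = Some y -> letter_e n i y = Some z ->
  letter_e n i z = None.
Proof.
case: x => [a||a] /=; case: ifP => // H [<-] /=.
- have -> : (i == i.+1) = false by lia.
  by rewrite andbF.
- by move/eqP: H => ->; rewrite ltnn.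
- case: ifP => iln /=; first by have -> : (i.+1 == i) = false by lia.
  by case: eqP => // -> [<-] /=; rewrite ltnn.
Qed.

Lemma letters_regular n : 1 < n -> @regular n (letters n) (fun x => in_J n x).
Proof.
move=> n2; split=> [x Jx|x Jx i Hi]; last first.
  by rewrite /= /nb_app; split; do 2![case: (_ n i _) => //= ?].
split.
  move=> k l Hk Hl; rewrite !coord2_mk //; case: x Jx => [a||a] _; lia.
move=> i Hi.
have pE : pairing (letter_wt n x) i = match x with
   Pos a => if i < n then ((i == a)%:R - (i.+1 == a)%:R)%R else ((i == a)%:R *+ 2)%R
   | Zero => 0%R
   | Bar a => if i < n then ((i.+1 == a)%:R - (i == a)%:R)%R else (- ((i == a)%:R *+ 2))%R end.
  rewrite /pairing; case: ifP => iln; first have Hj : 1 <= i.+1 <= n by lia.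
    by rewrite !coord2_mk //; case: x {Jx} => [a||a]; lia.
  by rewrite !coord2_mk //; case: x {Jx} => [a||a].
have nbf z y : letter_f n i z = Some y ->
    nb_app (letter_f n i) y = (nb_app (letter_f n i) z - 1)%R.
  move=> E; rewrite /nb_app E; case E': (letter_f n i y) => [t|] //.
  by rewrite (letter_f3 E E').
have nbe z y : letter_e n i z = Some y ->
    nb_app (letter_e n i) y = (nb_app (letter_e n i) z - 1)%R.
  move=> E; rewrite /nb_app E; case E': (letter_e n i y) => [t|] //.
  by rewrite (letter_e3 E E').
split.
- rewrite pE /= /nb_app; case: x {Jx pE} => [a||a] /=.
  + case: (ltnP i n) => iln; last first.
      have -> : i = n by lia.
      by rewrite /= [n == a]eq_sym; case: (a == n) => //=; rewrite eqxx.
    rewrite /= [i == a]eq_sym [i.+1 == a]eq_sym.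
    case: (eqVneq a i) => [->|_] /=.
      have -> : (i == i.+1) = false by lia.
      by have -> : (i.+1 == i) = false by lia.
    by case: (eqVneq a i.+1) => //= _; rewrite iln; have -> : (i == i.+1) = false by lia.
  + case: (ltnP i n) => iln; first by have -> : (i == n) = false by lia.
    have -> : i = n by lia.
    by rewrite ?eqxx /= ?ltnn ?eqxx.
  + case: (ltnP i n) => iln; last first.
      have -> : i = n by lia.
      by rewrite /= [n == a]eq_sym; case: (a == n) => //=; rewrite eqxx.
    rewrite /= [i == a]eq_sym [i.+1 == a]eq_sym.
    case: (eqVneq a i) => [->|_] /=.
      have -> : (i == i.+1) = false by lia.
      by have -> : (i.+1 == i) = false by lia.
    by case: (eqVneq a i.+1) => //= _; rewrite iln; have -> : (i == i.+1) = false by lia.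
- move=> y E; have [Jy E'] := letter_eP Hi Jx E; have [_ _ W] := letter_fP Hi Jy E'.
  split=> //; [by rewrite /= W subrK|exact: nbe|by rewrite /= (nbf _ _ E') subrK].
- move=> y E; have [Jy E' W] := letter_fP Hi Jx E.
  split=> //; [by rewrite /= (nbe _ _ E') subrK|exact: nbf].
- by rewrite /= /nb_app => ->.
- by rewrite /= /nb_app => ->.
Qed.

Section KNTensor.
Variable n : nat.

Definition col_crystal : crystal_data n :=
  @CrystalData n col
    (fun c => wt (rev c : words n))
    (fun i c => eps i (rev c : words n))
    (fun i c => phi i (rev c : words n))
    (fun i c => omap rev (te i (rev c : words n)))
    (fun i c => omap rev (tf i (rev c : words n))).

Hypothesis n2 : 1 < n.

Definition J_word (w : seq letter) : Prop := all_in (fun x => in_J n x) w.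

Lemma J_wordP w : all (in_J n) w <-> J_word w.
Proof.
rewrite /J_word; elim: w => //= x w IH; split; first by case/andP => -> /IH.
by case=> -> /IH.
Qed.

Lemma words_regular : @regular n (words n) J_word.
Proof. exact: (tseq_regular (letters_regular n2)). Qed.

Lemma col_regular : @regular n col_crystal (fun c => all (in_J n) c).
Proof.
apply: (@transfer_regular n (words n) col_crystal J_word _ (@rev letter)
  words_regular) => [w /J_wordP|c Jc|w _].
- by rewrite all_rev.
- by exists (rev c); [apply/J_wordP; rewrite all_rev|rewrite revK].
by split=> [|i _]; rewrite /= ?revK.
Qed.

Lemma word_te_size i (w w' : words n) : te i w = Some w' -> size w' = size w.
Proof.
elim: w w' => [|x w IH] w' //; rewrite tseq_te_cons; case: ifP => _.
  by case: te => //= y [<-].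
by case E: te => [y|] //= [<-]; rewrite /= (IH _ E).
Qed.

Lemma word_tf_size i (w w' : words n) : tf i w = Some w' -> size w' = size w.
Proof.
elim: w w' => [|x w IH] w' //; rewrite tseq_tf_cons; case: ifP => _.
  by case: tf => //= y [<-].
by case E: tf => [y|] //= [<-]; rewrite /= (IH _ E).
Qed.

Lemma KN_refill_cons c T w1 w2 : size w1 = size c ->
  KN_refill (c :: T) (w1 ++ w2) = rev w1 :: KN_refill T w2.
Proof. by move=> E; rewrite /KN_refill /= take_size_cat // drop_size_cat. Qed.

Lemma KN_wordK T : KN_refill T (KN_word T) = T.
Proof.
elim: T => [|c T IH] //.
rewrite /KN_word [flatten _]/= -/(KN_word T) KN_refill_cons ?size_rev // IH revK //.
Qed.

Lemma KN_tensor T : all (all (in_J n)) T ->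
  @morph n (tensor_seq col_crystal) (KN_crystal n) id T.
Proof.
elim: T => [_|c T IH /= /andP[Jc JT]]; first by split.
have Jw : J_word (KN_word T).
  apply/J_wordP; rewrite /KN_word; elim: T JT {IH} => //= d T IH /andP[Jd JT].
  by rewrite all_cat all_rev Jd IH.
have Jr : J_word (rev c) by apply/J_wordP; rewrite all_rev.
have [w1 M1] := IH JT.
have [w2 M2] := cat_morph (letters_regular n2) Jr Jw.
have oid (o : option (seq col)) : omap id o = o by case: o.
split=> [|i Hi]; first exact: etrans w2 (congr1 (fun w => wt (rev c : words n) + w)%R w1).
have [e1 f1 t1 s1] := M1 i Hi; have [e2 f2 t2 s2] := M2 i Hi.
have {}e1 : eps i (KN_word T : words n) = eps i (T : tensor_seq col_crystal) by exact: e1.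
have {}f1 : phi i (KN_word T : words n) = phi i (T : tensor_seq col_crystal) by exact: f1.
have {}w1 : wt (KN_word T : words n) = wt (T : tensor_seq col_crystal) by exact: w1.
have {}t1 : omap (KN_refill T) (te i (KN_word T : words n)) =
   omap id (te i (T : tensor_seq col_crystal)) by exact: t1.
have {}s1 : omap (KN_refill T) (tf i (KN_word T : words n)) =
   omap id (tf i (T : tensor_seq col_crystal)) by exact: s1.
have te_cat : te i (rev c ++ KN_word T : words n) = omap (fun b : words n * words n => b.1 ++ b.2)
  (if (eps i (KN_word T : words n) <= phi i (rev c : words n))%R
   then omap (fun y => (y, KN_word T)) (te i (rev c : words n))
   else omap (fun y => (rev c : words n, y)) (te i (KN_word T : words n))) by exact: t2.
have tf_cat : tf i (rev c ++ KN_word T : words n) = omap (fun b : words n * words n => b.1 ++ b.2)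
  (if (eps i (KN_word T : words n) < phi i (rev c : words n))%R
   then omap (fun y => (y, KN_word T)) (tf i (rev c : words n))
   else omap (fun y => (rev c : words n, y)) (tf i (KN_word T : words n))) by exact: s2.
split.
- refine (etrans e2 _); change (Num.max (eps i (rev c : words n)) (eps i (KN_word T : words n) - pairing (wt (rev c : words n)) i) =
    Num.max (eps i (rev c : words n)) (eps i (T : tensor_seq col_crystal) - pairing (wt (rev c : words n)) i))%R.
  by rewrite e1.
- refine (etrans f2 _); change (Num.max (phi i (rev c : words n) + pairing (wt (KN_word T : words n)) i) (phi i (KN_word T : words n)) =
    Num.max (phi i (rev c : words n) + pairing (wt (T : tensor_seq col_crystal)) i) (phi i (T : tensor_seq col_crystal)))%R.
  by rewrite f1 w1.
- rewrite tseq_te_cons -e1.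
  change (omap (KN_refill (c :: T)) (te i (rev c ++ KN_word T : words n)) =
   omap id (if (eps i (KN_word T : words n) <= phi i (rev c : words n))%R
      then omap (fun y => y :: T) (omap rev (te i (rev c : words n)))
      else omap (cons c) (te i (T : tensor_seq col_crystal)))).
  rewrite te_cat; case: ifP => _.
    case E: (te i (rev c : words n)) => [w|] //=.
    by rewrite KN_refill_cons ?KN_wordK // (word_te_size E) size_rev.
  rewrite oid in t1; rewrite -t1.
  case E: (te i (KN_word T : words n)) => [w|] //=.
  by rewrite KN_refill_cons ?size_rev // revK.
- rewrite tseq_tf_cons -e1.
  change (omap (KN_refill (c :: T)) (tf i (rev c ++ KN_word T : words n)) =
   omap id (if (eps i (KN_word T : words n) < phi i (rev c : words n))%R
      then omap (fun y => y :: T) (omap rev (tf i (rev c : words n)))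
      else omap (cons c) (tf i (T : tensor_seq col_crystal)))).
  rewrite tf_cat; case: ifP => _.
    case E: (tf i (rev c : words n)) => [w|] //=.
    by rewrite KN_refill_cons ?KN_wordK // (word_tf_size E) size_rev.
  rewrite oid in s1; rewrite -s1.
  case E: (tf i (KN_word T : words n)) => [w|] //=.
  by rewrite KN_refill_cons ?size_rev // revK.
Qed.
End KNTensor.

Definition cnt (f : nat -> bool) (k : nat) : nat := count f (iota 1 k).

Lemma cnt0 f : cnt f 0 = 0. Proof. by []. Qed.

Lemma cntS f k : cnt f k.+1 = cnt f k + f k.+1.
Proof. by rewrite /cnt -[k.+1]addn1 iotaD count_cat /= addn0 add1n addn1. Qed.

Lemma cntP f k : 0 < k -> cnt f k = cnt f k.-1 + f k.
Proof. by case: k => // k _; rewrite cntS. Qed.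

Lemma cnt_mono f j k : j <= k -> cnt f j <= cnt f k.
Proof. by move=> /subnK <-; elim: (k - j) => // i IH; rewrite addSn cntS; lia. Qed.

Lemma cnt_lip f j k : j <= k -> cnt f k <= cnt f j + (k - j).
Proof.
move=> /subnK <-; rewrite addnK; elim: (k - j) => [|i IH]; first by rewrite add0n; lia.
by rewrite addSn cntS; case: (f _); lia.
Qed.

Lemma cnt_le f k : cnt f k <= k.
Proof. by have := cnt_lip f (leq0n k); rewrite cnt0; lia. Qed.

Lemma cnt_lt (f : nat -> bool) a k : a < k -> f k -> cnt f a < cnt f k.
Proof.
move=> ak fk; have := @cnt_mono f a k.-1; rewrite (@cntP f k) ?fk; lia.
Qed.

Lemma cnt_negb f k : cnt (fun j => ~~ f j) k + cnt f k = k.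
Proof. by elim: k => // k IH; rewrite !cntS; case: (f _) => /=; lia. Qed.

Lemma cnt_ex (f : nat -> bool) k j : j < cnt f k -> exists a, [/\ 1 <= a <= k, f a & cnt f a = j.+1].
Proof.
elim: k => [|k IH]; first by rewrite cnt0.
rewrite cntS; case: (ltnP j (cnt f k)) => [/IH [a [H1 H2 H3]] _|Hj].
  by exists a; split=> //; lia.
case E: (f k.+1) => H; last by lia.
by exists k.+1; split=> //; rewrite ?cntS ?E; lia.
Qed.

Definition idx (n : nat) (f : nat -> bool) : seq nat := [seq k <- iota 1 n | f k].

Lemma idxS n f : idx n.+1 f = idx n f ++ (if f n.+1 then [:: n.+1] else [::]).
Proof.
have E : iota 1 n.+1 = iota 1 n ++ [:: n.+1] by rewrite -{1}[n.+1]addn1 iotaD add1n.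
by rewrite /idx E filter_cat.
Qed.

Lemma size_idx n f : size (idx n f) = cnt f n.
Proof. by rewrite size_filter. Qed.

Lemma mem_idx n (f : nat -> bool) k : (k \in idx n f) = (1 <= k <= n) && f k.
Proof. by rewrite mem_filter mem_iota andbC; congr (_ && _); lia. Qed.

Lemma idx_uniq n f : uniq (idx n f).
Proof. exact/filter_uniq/iota_uniq. Qed.

Lemma idx_sorted n f : sorted ltn (idx n f).
Proof. by apply: sorted_filter; [exact: ltn_trans|exact: iota_ltn_sorted]. Qed.

Lemma eq_idx n (f g : nat -> bool) : (forall k, 1 <= k <= n -> f k = g k) -> idx n f = idx n g.
Proof. by move=> H; apply: eq_in_filter => k; rewrite mem_iota => Hk; apply: H; lia. Qed.

Lemma cnt_inj n (f g : nat -> bool) : (forall k, k <= n -> cnt f k = cnt g k) ->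
  forall k, 1 <= k <= n -> f k = g k.
Proof.
move=> H k Hk; have := H k; have := H k.-1; rewrite (@cntP f k) ?(@cntP g k); try lia.
Qed.

Lemma onth_idx n (f : nat -> bool) j y :
  onth (idx n f) j = Some y <-> [/\ 1 <= y <= n, f y & cnt f y = j.+1].
Proof.
elim: n => [|n IH]; first by split=> [|[]]; [case: j|lia].
rewrite idxS; split.
  rewrite onth_cat; case: ltnP => [_ /IH [H1 H2 H3]|].
    by split=> //; lia.
  rewrite size_idx => H; case E: (f n.+1) => /=; last by case: (j - _).
  case E': (j - cnt f n) => [|i] //=; last by case: i {E'}.
  by case=> <-; rewrite cntS E; split=> //; lia.
move=> [H1 H2 H3]; rewrite onth_cat size_idx; case: (leqP y n) => yn.
  have -> : j < cnt f n by have := cnt_mono f yn; lia.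
  by apply/IH; split=> //; lia.
have Ey : y = n.+1 by lia.
subst y; move: H3; rewrite cntS H2 => H3.
have -> : (j < cnt f n) = false by lia.
by have -> : j - cnt f n = 0 by lia.
Qed.

Definition bars (n : nat) (f : nat -> bool) : col := map Bar (idx n f).

Lemma size_bars n f : size (bars n f) = cnt f n.
Proof. by rewrite size_map size_idx. Qed.

Lemma eq_bars n (f g : nat -> bool) : (forall k, 1 <= k <= n -> f k = g k) -> bars n f = bars n g.
Proof. by move=> H; rewrite /bars (eq_idx H). Qed.

Lemma mem_bars n (f : nat -> bool) x :
  (x \in bars n f) = (if x is Bar k then (1 <= k <= n) && f k else false).
Proof.
have inj : injective Bar by move=> a b [].
case: x => [k||k]; last by rewrite mem_map // mem_idx.
  by apply/negbTE/mapP; case.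
by apply/negbTE/mapP; case.
Qed.

Lemma onth_map' (T1 T2 : Type) (g : T1 -> T2) s j :
  onth (map g s) j = omap g (onth s j).
Proof. by elim: s j => [|x s IH] [|j] //=. Qed.

Lemma onth_bars n (f : nat -> bool) j x : onth (bars n f) j = Some x <->
  (if x is Bar y then [/\ 1 <= y <= n, f y & cnt f y = j.+1] else False).
Proof.
rewrite /bars onth_map'; case E: (onth (idx n f) j) => [y|] /=.
  have /onth_idx H := E; split=> [[<-] //|]; case: x => // z /onth_idx.
  by rewrite E => [[->]].
by split=> //; case: x => // z /onth_idx; rewrite E.
Qed.

(* The KN column with the letters k such that p k, m zeros, and the letters
   bar k such that u k. *)
Definition kncol (n : nat) (p : nat -> bool) (m : nat) (u : nat -> bool) : col :=
  bars n u ++ nseq m Zero ++ rev (map Pos (idx n p)).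

Lemma size_kncol n p m u : size (kncol n p m u) = cnt u n + m + cnt p n.
Proof. by rewrite !size_cat size_bars size_nseq size_rev size_map size_idx addnA. Qed.

Lemma onth_nseq' (T : Type) m (x : T) j : onth (nseq m x) j = if j < m then Some x else None.
Proof. by elim: m j => [|m IH] [|j] //=. Qed.

Lemma onth_rev' (T : Type) (s : seq T) j : onth (rev s) j =
  if j < size s then onth s (size s - j.+1) else None.
Proof.
case: ltnP => H; last by apply: onth_default; rewrite size_rev.
case: s H => // x0 s0; set s := x0 :: s0 => H.
have E i : i < size s -> onth s i = Some (nth x0 s i).
  by move=> Hi; rewrite onthE (nth_map x0).
have -> : onth (rev s) j = Some (nth x0 (rev s) j).
  by rewrite onthE (nth_map x0) // size_rev.
by rewrite nth_rev // E //; lia.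
Qed.

Lemma onth_kncol n (p : nat -> bool) m (u : nat -> bool) j x : onth (kncol n p m u) j = Some x <->
  match x with
  | Bar y => [/\ 1 <= y <= n, u y & cnt u y = j.+1]
  | Zero => cnt u n <= j < cnt u n + m
  | Pos y => [/\ 1 <= y <= n, p y & j + cnt p y = cnt u n + m + cnt p n]
  end.
Proof.
rewrite /kncol !onth_cat size_bars size_nseq.
case: ltnP => H1.
  case: x => [y||y]; rewrite onth_bars.
  - by split=> // [[H2 H3 H4]]; have := @cnt_mono p y n; lia.
  - by split=> //; lia.
  - by [].
have nobar y : 1 <= y <= n -> cnt u y = j.+1 -> False.
  by move=> H2 H3; have := @cnt_mono u y n; lia.
case: ltnP => H2.
  rewrite onth_nseq' H2; split=> [[<-]|]; first by lia.
  case: x => // y [H3 H4 H5]; last by case: (nobar _ H3 H5).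
  have := @cnt_mono p y n; have := @cntP p y; rewrite H4; lia.
rewrite onth_rev' size_map size_idx onth_map'.
case: ltnP => H3; last first.
  split=> //; case: x => [y||y] //.
  - by move=> [H4 H5 H6]; have := @cntP p y; rewrite H5; lia.
  - lia.
  - by move=> [H4 H5 H6]; case: (nobar _ H4 H6).
case E: onth => [y|] /=.
  have /onth_idx [H4 H5 H6] := E; split=> [[<-]|].
    by split=> //; lia.
  case: x => [z||z]; [|lia|by move=> [H7 H8 H9]; case: (nobar _ H7 H9)].
  move=> [H7 H8 H9]; congr (Some (Pos _)).
  suff : onth (idx n p) (cnt p n - (j - cnt u n - m).+1) = Some z by rewrite E => [[]].
  by apply/onth_idx; split=> //; have := @cnt_mono p z n; have := @cntP p z; rewrite H8; lia.
split=> //; case: x => [z||z]; [|lia|by move=> [H7 H8 H9]; case: (nobar _ H7 H9)].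
move=> [H7 H8 H9]; suff : onth (idx n p) (cnt p n - (j - cnt u n - m).+1) = Some z by rewrite E.
by apply/onth_idx; split=> //; have := @cnt_mono p z n; have := @cntP p z; rewrite H8; lia.
Qed.

Lemma mem_kncol n (p : nat -> bool) m (u : nat -> bool) x : (x \in kncol n p m u) =
  match x with
  | Bar y => (1 <= y <= n) && u y
  | Zero => 0 < m
  | Pos y => (1 <= y <= n) && p y
  end.
Proof.
rewrite /kncol !mem_cat mem_bars mem_rev mem_nseq.
have injP : injective Pos by move=> a b [].
case: x => [y||y]; rewrite /= ?andbF ?orbF //.
- by rewrite mem_map // mem_idx.
- have -> : (Zero \in map Pos (idx n p)) = false by apply/negbTE/mapP; case.
  by rewrite andbT orbF.
have -> : (Bar y \in map Pos (idx n p)) = false by apply/negbTE/mapP; case.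
by rewrite !orbF.
Qed.

Lemma above_trans : transitive (fun x y => above y x).
Proof.
move=> y x z; rewrite /above => /orP[] H1 /orP[] H2.
- by apply/orP; left; case: x y z H1 H2 => [a||a] [b||b] [c||c] //=; lia.
- by move: H1; case/andP: H2 => /eqP-> /eqP->; rewrite /= => ->.
- by case/andP: H1 H2 => /eqP-> /eqP-> ->.
- by case/andP: H1 => _ /eqP->; case/andP: H2 => /eqP-> _.
Qed.

Lemma above_anti : antisymmetric (fun x y => above y x).
Proof.
move=> [a||a] [b||b] //=; rewrite /above /= ?orbF ?andbF ?orbF; lia.
Qed.

Lemma aboveE x y : above x y =
  match x, y with
  | Pos a, Pos b => a < b
  | Pos _, _ => true
  | Zero, Bar _ | Zero, Zero => true
  | Bar a, Bar b => b < a
  | _, _ => false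
  end.
Proof. by case: x => [a||a]; case: y => [b||b] //=; rewrite /above /= ?orbF // andbF orbF. Qed.

Lemma col_ok_kncol n p m u : col_ok (kncol n p m u).
Proof.
rewrite /col_ok sorted_pairwise; last exact: above_trans.
rewrite /kncol !pairwise_cat; apply/and4P; split.
- apply/allrelP => x y; rewrite mem_bars mem_cat => Hx /orP[].
    by rewrite mem_nseq => /andP[_ /eqP->]; case: x Hx.
  by rewrite mem_rev => /mapP[b _ ->]; case: x Hx.
- rewrite /bars pairwise_map -sorted_pairwise; last first.
    by move=> y x z; rewrite /= !aboveE; lia.
  by apply: sub_sorted (idx_sorted n u) => x y; rewrite /= aboveE.
- apply/allrelP => x y; rewrite mem_nseq mem_rev => /andP[_ /eqP->] /mapP[b _ ->].
  by rewrite aboveE.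
apply/andP; split.
  by elim: m => //= m IH; rewrite IH andbT; apply/allP => x; rewrite mem_nseq => /andP[_ /eqP->].
rewrite -sorted_pairwise; last exact: above_trans.
rewrite rev_sorted sorted_map; apply: sub_sorted (idx_sorted n p) => x y.
by rewrite /= aboveE.
Qed.

Lemma col_ok_count c x : col_ok c -> x != Zero -> count_mem x c = (x \in c).
Proof.
rewrite /col_ok sorted_pairwise; last exact: above_trans.
move=> + x0; elim: c => [|y c IH] //= /andP[/allP H /IH E].
rewrite inE eq_sym; case: eqVneq => [Exy|_] /=; last by rewrite E.
suff /negbTE N : y \notin c by rewrite E Exy N.
apply/negP => /H; rewrite aboveE; case: (y) Exy x0 => [a||a]; rewrite ?ltnn //.
by move=> ->.
Qed.

Lemma kncol_canon n c : col_ok c -> all (in_J n) c ->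
  c = kncol n (fun k => Pos k \in c) (count_mem Zero c) (fun k => Bar k \in c).
Proof.
move=> ok /allP Jc; set d := kncol _ _ _ _.
apply: (sorted_eq above_trans above_anti ok (col_ok_kncol _ _ _ _)).
apply/allP => x _ /=; apply/eqP; case: (eqVneq x Zero) => [->|x0].
  rewrite /d /kncol !count_cat count_nseq /= mul1n.
  have -> : count_mem Zero (bars n (fun k => Bar k \in c)) = 0.
    by apply/count_memPn; rewrite mem_bars.
  have -> : count_mem Zero (rev (map Pos (idx n (fun k => Pos k \in c)))) = 0.
    by apply/count_memPn; rewrite mem_rev; apply/negP => /mapP[].
  by rewrite addn0.
have -> : count_mem x d = (x \in d) by apply: col_ok_count => //; exact: col_ok_kncol.
rewrite col_ok_count // mem_kncol; congr nat_of_bool.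
case: x x0 => [k||k] // _.
  case E: (Pos k \in c); rewrite ?andbF // andbT; have := Jc _ E.
  by rewrite /in_J /= orbF => /esym.
case E: (Bar k \in c); rewrite ?andbF // andbT; have := Jc _ E.
by rewrite /in_J /= => /esym.
Qed.

Lemma bars_canon n c : col_ok c -> all (is_bar n) c -> c = bars n (fun k => Bar k \in c).
Proof.
move=> ok /allP bc; rewrite {1}(@kncol_canon n c) //; last first.
  by apply/allP => x /bc; rewrite /in_J => ->; rewrite !orbT.
rewrite /kncol (count_memPn _) //=; last by apply/negP => /bc.
have -> : idx n (fun k => Pos k \in c) = [::].
  rewrite (@eq_idx n _ xpred0); first exact: filter_pred0.
  by move=> k _; apply/negP => /bc.
by rewrite /= cats0.
Qed.

Lemma kncol_bars n u : kncol n xpred0 0 u = bars n u.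
Proof. by rewrite /kncol /= /idx filter_pred0 cats0. Qed.

Lemma col_ok_bars n u : col_ok (bars n u).
Proof. by rewrite -kncol_bars col_ok_kncol. Qed.

Lemma all_bars n u : all (is_bar n) (bars n u).
Proof. by apply/allP => x; rewrite mem_bars; case: x => //= k /andP[]. Qed.

Lemma all_kncol n p m u : all (in_J n) (kncol n p m u).
Proof.
apply/allP => x; rewrite mem_kncol /in_J; case: x => [k||k] //= => /andP[-> _] //.
Qed.

Lemma entry_two_col d L R i j : entry (two_col d L R) i j =
  match j with
  | 1 => if d < i then onth R (i - d).-1 else None
  | 2 => if 0 < i then onth L i.-1 else None
  | _ => None
  end.
Proof.
case: j => [|[|[|j]]] //=; first by rewrite subn0.
have E : nth (0, [::] : col) [::] j = (0, [::]) by case: j.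
by rewrite /entry /= E /=; case: ifP => // _; case: (_.-1).
Qed.

Lemma onth_size (T : Type) (s : seq T) j x : onth s j = Some x -> j < size s.
Proof. by elim: s j => [|y s IH] [|j] //= /IH. Qed.

Lemma onth_some (T : Type) (s : seq T) j : j < size s -> exists x, onth s j = Some x.
Proof. by elim: s j => [|y s IH] [|j] //=; [exists y|move/IH]. Qed.

Lemma sst_two_colP d n (L R : nat -> bool) :
  sst (two_col d (bars n L) (bars n R)) <->
  (forall i a b, onth (bars n R) i = Some (Bar a) ->
     onth (bars n L) (i + d) = Some (Bar b) -> a <= b).
Proof.
rewrite /sst [all _ (two_col _ _ _)]/= !col_ok_bars /=.
have rowE i : row_at (two_col d (bars n L) (bars n R)) i =
   pmap id [:: (if d < i then onth (bars n R) (i - d).-1 else None);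
               (if 0 < i then onth (bars n L) i.-1 else None)].
  have T := entry_two_col d (bars n L) (bars n R) i.
  by rewrite -(T 1) -(T 2).
split=> [/allP H i a b Ra Lb|H].
  have Hi : (i + d).+1 \in levels (two_col d (bars n L) (bars n R)).
    rewrite mem_iota /=; have := onth_size Lb; lia.
  have := H _ Hi; rewrite rowE ifT; last by lia.
  have -> : ((i + d).+1 - d).-1 = i by lia.
  rewrite Ra [pmap _ _]/= Lb /= /row_ok /= /lle /=.
  case: eqP => [[->] //|_] /=; lia.
apply/allP => i Hi; rewrite rowE.
case: ltnP => di; last first.
  by case: ifP => // _; case E: onth => [x|] //=; rewrite /row_ok /=; case: x E => // /onth_bars.
rewrite ifT; last by lia.
case E: (onth (bars n R)) => [x|]; case E': (onth (bars n L)) => [y|] //=.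
- case: x E => [a||a] E; try by move/onth_bars: E.
  case: y E' => [b||b] E'; try by move/onth_bars: E'.
  rewrite /row_ok /= andbT /lle /=.
  have := H (i - d).-1 a b E; have -> : (i - d).-1 + d = i.-1 by lia.
  by move/(_ E'); rewrite leq_eqVlt => /orP[/eqP->|->]; rewrite ?eqxx // !orbT.
- by case: x E => // /onth_bars.
- by case: y E' => // /onth_bars.
Qed.

Lemma sst_two_col d n (L R : nat -> bool) : cnt L n <= cnt R n + d ->
  sst (two_col d (bars n L) (bars n R)) <-> (forall k, k <= n -> cnt L k <= cnt R k + d).
Proof.
move=> sz; split=> [/sst_two_colP H k kn|H].
  rewrite leqNgt; apply/negP => Hk.
  have [b [b1 Lb cb]] : exists a, [/\ 1 <= a <= k, L a & cnt L a = (cnt R k + d).+1] by apply: cnt_ex.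
  have [] : exists a, [/\ 1 <= a <= n, R a & cnt R a = (cnt R k).+1].
    by apply: cnt_ex; have := cnt_mono L kn; lia.
  move=> a [a1 Ra ca].
  have : a <= b.
    by apply: (H (cnt R k)); apply/onth_bars; split=> //; lia.
  by have := @cnt_mono R b k; have := @cnt_mono R a b; lia.
apply/sst_two_colP => i a b /onth_bars[a1 Ra ca] /onth_bars[b1 Lb cb].
rewrite leqNgt; apply/negP => ba.
have := H b; have := @cnt_lt R b a ba Ra; lia.
Qed.

Lemma last_sorted y s x : path leq y s -> x \in y :: s -> x <= last y s.
Proof.
elim: s y x => [|z s IH] y x /=; first by rewrite inE => _ /eqP->.
move=> /andP[yz ps]; rewrite inE => /orP[/eqP->|]; last exact: IH.
by apply: leq_trans yz _; apply: IH => //; exact: mem_head.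
Qed.

Lemma slide_rank0 a n (L R : nat -> bool) :
  a <= cnt L n <= cnt R n + a -> (forall k, k <= n -> cnt L k <= cnt R k + a) ->
  (slide_rank a (bars n L) (bars n R) == 0) <->
  (exists2 k, k <= n & cnt L k = cnt R k + a).
Proof.
move=> sz H; rewrite /slide_rank !size_bars; set b := cnt R n - _; set s := filter _ _.
have Hb : b = cnt R n + a - cnt L n by rewrite /b; lia.
split=> [/eqP l0|[k kn Ek]].
  case: (posnP a) => [->|a0]; first by exists 0.
  case: (posnP b) => [b0|b0]; first by exists n => //; lia.
  have N1 : 1 \notin s.
    apply/negP => H1; suff : 1 <= last 0 s by lia.
    have ss : sorted leq s by apply: sorted_filter; [exact: leq_trans|exact: iota_sorted].
    case: (s) H1 ss => // x t H1 ss /=; exact: last_sorted.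
  have : ~ (forall k, k <= n -> cnt L k <= cnt R k + (a - 1)).
    move=> H2; case/negP: N1; rewrite mem_filter mem_iota; apply/andP; split; last by lia.
    by apply/sst_two_col => //; lia.
  move=> Hn; case: (boolP [exists k : 'I_n.+1, cnt L k == cnt R k + a]).
    by case/existsP => k /eqP Ek; exists k => //; case: k {Ek}.
  rewrite negb_exists => /forallP H2; case: Hn => k kn.
  by have /= := H2 (Ordinal (kn : k < n.+1)); have := H k kn; lia.
have all0 x : x \in s -> x = 0.
  rewrite mem_filter mem_iota => /andP[Sx Hx]; apply/eqP; rewrite -leqn0 leqNgt; apply/negP => x0.
  have sz' : cnt L n <= cnt R n + (a - x) by lia.
  by have /(_ k kn) := (sst_two_col sz').1 Sx; lia.
apply/eqP; case: s all0 => //= x t H2; apply: H2; exact: mem_last.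
Qed.

Lemma head_all_eq (s : seq nat) x : x \in s -> (forall y, y \in s -> y = x) -> head 0 s = x.
Proof. by case: s => // y s _ H; apply: H; rewrite inE eqxx. Qed.

Lemma overlapE n (U V : nat -> bool) M :
  (forall k, k <= n -> cnt U k <= cnt V k + M) ->
  (exists2 k, k <= n & cnt U k = cnt V k + M) ->
  overlap (bars n U) (bars n V) = cnt U n - M.
Proof.
move=> H ex; have [k0 k0n Ek0] := ex; rewrite /overlap !size_bars.
have MU : M <= cnt U n by have := cnt_mono U k0n; lia.
have UV := H n (leqnn n).
apply: head_all_eq.
  rewrite mem_filter mem_iota; apply/andP; split; last by lia.
  have -> : cnt U n - (cnt U n - M) = M by lia.
  apply/andP; split; first exact/sst_two_col.
  by apply/slide_rank0 => //; lia.
move=> k; rewrite mem_filter mem_iota => /andP[/andP[s1 s2] Hk].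
have sz : cnt U n <= cnt V n + (cnt U n - k) by lia.
have H1 := (sst_two_col sz).1 s1.
have [|k1 k1n Ek1] := (slide_rank0 _ H1).1 s2; first by lia.
have := H1 k0 k0n; have := H k1 k1n; lia.
Qed.

Definition idx_from (n y : nat) (f : nat -> bool) : seq nat :=
  [seq k <- iota y.+1 (n - y) | f k].

Lemma idx_split n y (f : nat -> bool) : 1 <= y <= n ->
  idx n f = idx y.-1 f ++ (if f y then [:: y] else [::]) ++ idx_from n y f.
Proof.
move=> Hy; rewrite /idx /idx_from.
have -> : iota 1 n = iota 1 y.-1 ++ [:: y] ++ iota y.+1 (n - y).
  have {1}-> : n = y.-1 + (n - y).+1 by lia.
  by rewrite iotaD /=; have -> : 1 + y.-1 = y by lia.
by rewrite !filter_cat.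
Qed.

Lemma eq_idx_from n y (f g : nat -> bool) :
  (forall k, y < k <= n -> f k = g k) -> idx_from n y f = idx_from n y g.
Proof. by move=> H; apply: eq_in_filter => k; rewrite mem_iota => Hk; apply: H; lia. Qed.

Definition fset1 (f : nat -> bool) y b : nat -> bool := fun k => if k == y then b else f k.

Lemma idx_fset1 n y (f : nat -> bool) b : 1 <= y <= n ->
  idx n (fset1 f y b) = idx y.-1 f ++ (if b then [:: y] else [::]) ++ idx_from n y f.
Proof.
move=> Hy; rewrite (idx_split _ Hy) /fset1 eqxx; congr (_ ++ _ ++ _).
  by apply: eq_idx => k Hk; case: eqP => //; lia.
by apply: eq_idx_from => k Hk; case: eqP => //; lia.
Qed.

Lemma bars_ins n y (f : nat -> bool) : 1 <= y <= n -> ~~ f y ->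
  take (cnt f y) (bars n f) ++ Bar y :: drop (cnt f y) (bars n f) = bars n (fset1 f y true).
Proof.
move=> Hy /negbTE Nf; rewrite /bars idx_fset1 // (idx_split _ Hy) Nf cat0s !map_cat /=.
have E : size (map Bar (idx y.-1 f)) = cnt f y.
  by rewrite size_map size_idx (@cntP f y) ?Nf ?addn0 //; lia.
by rewrite take_size_cat // drop_size_cat.
Qed.

Lemma bars_del n y (f : nat -> bool) : 1 <= y <= n -> f y ->
  take (cnt f y).-1 (bars n f) ++ drop (cnt f y) (bars n f) = bars n (fset1 f y false).
Proof.
move=> Hy Nf; rewrite /bars idx_fset1 // (idx_split _ Hy) Nf !map_cat /=.
have E : (cnt f y) = (size (map Bar (idx y.-1 f))).+1.
  by rewrite size_map size_idx (@cntP f y) ?Nf ?addn1 //; lia.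
rewrite E /= take_size_cat // -cat1s catA drop_size_cat //.
by rewrite size_cat /= addn1.
Qed.

Lemma cnt_fset1 (f : nat -> bool) y b k : 1 <= y ->
  cnt (fset1 f y b) k + (y <= k) * f y = cnt f k + (y <= k) * b.
Proof.
move=> y1; elim: k => [|k IH]; first by rewrite cnt0 leqn0; have -> : (y == 0) = false by lia.
rewrite !cntS {2}/fset1; case: eqP => [E|ne].
  by subst y; rewrite ltnn in IH; rewrite leqnn; lia.
have -> : (y <= k.+1) = (y <= k) by lia.
lia.
Qed.

Section Jdt.
Variable m : nat.
Implicit Type T : filling.

Lemma updE T i j x i' j' : upd T i j x i' j' = if (i' == i) && (j' == j) then x else T i' j'.
Proof. by []. Qed.

Ltac upds := rewrite ?updE; repeat (case: eqVneq => ?; rewrite ?andbT ?andbF //=);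
  try subst; try done; try (exfalso; lia).

Lemma eq_pmap_in (A : eqType) (B : Type) (f g : A -> option B) s :
  {in s, f =1 g} -> pmap f s = pmap g s.
Proof.
elim: s => //= x s IH H; rewrite H ?inE ?eqxx // IH //.
by move=> y Hy; apply: H; rewrite inE Hy orbT.
Qed.

Definition seg T (j lo len : nat) : seq letter := pmap (T^~ j) (iota lo len).

Lemma eq_seg T T' j lo len : (forall i, lo <= i < lo + len -> T i j = T' i j) ->
  seg T j lo len = seg T' j lo len.
Proof. by move=> H; apply: eq_pmap_in => i; rewrite mem_iota => /H. Qed.

Lemma seg_split T j i : 1 <= i <= m ->
  seg T j 1 m = seg T j 1 i.-1 ++ seg T j i 1 ++ seg T j i.+1 (m - i).
Proof.
move=> Hi; rewrite /seg -!pmap_cat; congr pmap.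
have {1}-> : m = i.-1 + (m - i).+1 by lia.
by rewrite iotaD /=; have -> : 1 + i.-1 = i by lia.
Qed.

Lemma seg_move_up T j i x : 1 <= i -> i < m -> T i j = None -> T i.+1 j = Some x ->
  seg (upd (upd T i j (Some x)) i.+1 j None) j 1 m = seg T j 1 m.
Proof.
move=> i1 im Ti Tx; rewrite !(@seg_split _ _ i) ?i1 ?(ltnW im) //.
congr (_ ++ _).
  by apply: eq_seg => k Hk; upds.
rewrite /seg; have -> : m - i = (m - i.+1).+1 by lia.
rewrite /= !updE !eqxx /= Ti Tx; have -> : (i == i.+1) = false by lia.
congr (_ :: _); apply: eq_pmap_in => k; rewrite mem_iota => Hk; upds.
Qed.

Lemma seg_other T j j' i x lo len : j' != j -> seg (upd T i j x) j' lo len = seg T j' lo len.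
Proof. by move=> jj; apply: eq_seg => k _; rewrite updE (negbTE jj) andbF. Qed.

Lemma columnsE T : columns m T = (seg T 2 1 m, seg T 1 1 m).
Proof. by []. Qed.

Lemma jdt_outer_col2 k T i : 1 <= i -> T i 2 = None -> (forall i', T i' 3 = None) ->
  (forall i', m < i' -> T i' 2 = None) ->
  columns m (jdt_outer k T i 2) = columns m T.
Proof.
elim: k T i => [|k IH] T i i1 Ti T3 Tm //=.
rewrite T3; case Tx: (T i.+1 2) => [x|] //.
have im : i < m by rewrite ltnNge; apply/negP => mi; rewrite Tm in Tx; first done; lia.
rewrite IH //; first 1 last.
- by rewrite updE !eqxx.
- by move=> i'; rewrite !updE !andbF.
- by move=> i' mi; rewrite !updE; case: eqP => //= _; case: eqP => [|_]; [lia|exact: Tm].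
by rewrite !columnsE seg_move_up // !seg_other.
Qed.

Lemma jdt_inner_col1 k T i : i <= m -> T i 1 = None -> (forall i', T i' 0 = None) ->
  (T 0 1 = None) ->
  columns m (jdt_inner k T i 1) = columns m T.
Proof.
elim: k T i => [|k IH] T i im Ti T3 T0 //=.
rewrite T3; case Tx: (T i.-1 1) => [x|] //.
have i1 : 1 < i by case: (i) Tx => [|[|i']] //=; rewrite T0.
rewrite IH //; first 1 last.
- lia.
- by rewrite updE !eqxx.
- by move=> i'; rewrite !updE !andbF.
- rewrite !updE T0; have -> : (0 == i) = false by lia.
  by case: ifP.
rewrite !columnsE; congr pair; first by rewrite !seg_other.
have := @seg_move_up (upd (upd T i 1 (Some x)) i.-1 1 None) 1 i.-1 x.
rewrite !updE prednK ?eqxx; last by lia.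
have -> : (i == i.-1) = false by lia.
move=> /(_ ltac:(lia) ltac:(lia) erefl erefl) <-.
apply: eq_seg => k' Hk; rewrite !updE !eqxx !andbT.
by upds.
Qed.

(* The hole moves up in the right column to level h, then the entry y of the
   left column enters it. *)
Lemma jdt_outerE T0 h y :
  1 <= h <= m -> T0 h 2 = Some y -> (forall i, T0 i 3 = None) ->
  (forall i, m < i -> T0 i 2 = None) ->
  (forall x, T0 h.+1 1 = Some x -> llt x y) ->
  forall t k T i, i + t = h -> t < k -> 1 <= i ->
  (forall i', i <= i' < h -> exists x y', [/\ T0 i'.+1 1 = Some x, T0 i' 2 = Some y' & ~~ llt x y']) ->
  T i 1 = None -> (forall i', i < i' -> T i' 1 = T0 i' 1) ->
  (forall i' j, 1 < j -> T i' j = T0 i' j) ->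
  columns m (jdt_outer k T i 1) =
  (seg T0 2 1 h.-1 ++ seg T0 2 h.+1 (m - h),
   seg T 1 1 i.-1 ++ seg T0 1 i.+1 t ++ y :: seg T0 1 h.+1 (m - h)).
Proof.
move=> Hh Ty T3 Tm Tx; elim=> [|t IH] [|k] T i it tk i1 up Ti T1 T2 //=.
  rewrite addn0 in it; subst h; rewrite (T2 i 2) // Ty T1 //.
  set T' := upd (upd T i 1 (Some y)) i 2 None.
  have -> : match T0 i.+1 1 with
    | Some x => if llt x y then jdt_outer k T' i 2
       else jdt_outer k (upd (upd T i 1 (Some x)) i.+1 1 None) i.+1 1
    | None => jdt_outer k T' i 2 end = jdt_outer k T' i 2.
    by case E: (T0 i.+1 1) => [x|] //; rewrite (Tx _ E).
  rewrite jdt_outer_col2 //; first 1 last.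
  - by rewrite /T' updE !eqxx.
  - by move=> i'; rewrite /T' !updE !andbF T2.
  - by move=> i' mi; rewrite /T' !updE; case: eqP => //= _; rewrite ?andbF T2 // Tm.
  rewrite columnsE !(@seg_split _ _ i) //; congr pair.
    congr (_ ++ _).
      by apply: eq_seg => k' Hk; rewrite -T2 // /T'; upds.
    rewrite /seg /= /T' !updE !eqxx /=.
    by apply: eq_pmap_in => k'; rewrite mem_iota => Hk; rewrite -T2 // /T'; upds.
  congr (_ ++ _).
    by apply: eq_seg => k' Hk; rewrite /T'; upds.
  rewrite /seg /= /T' !updE !eqxx /= ?andbF /=; congr (_ :: _).
  by apply: eq_pmap_in => k'; rewrite mem_iota => Hk; rewrite -T1; [rewrite /T'; upds|lia].
have [x [y' [Ex Ey' /negbTE nl]]] := up i ltac:(lia).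
rewrite T1 // Ex (T2 i 2) // Ey' nl IH; first 1 last.
- lia.
- lia.
- lia.
- by move=> i' Hi'; apply: up; lia.
- by rewrite updE !eqxx.
- by move=> i' Hi'; rewrite -T1; [upds|lia].
- move=> i' j j1; rewrite !updE; have -> : (j == 1) = false by lia.
  by rewrite !andbF T2.
have -> : seg T0 1 i.+1 t.+1 = x :: seg T0 1 i.+2 t by rewrite /seg /= Ex.
congr pair; rewrite cat_cons -[RHS]cat_rcons; congr (_ ++ _).
have -> : i.+1.-1 = i.-1 + 1 by lia.
rewrite /seg iotaD pmap_cat -cats1; congr (_ ++ _).
  by apply: eq_pmap_in => k'; rewrite mem_iota => Hk; upds.
rewrite /=; have -> : 1 + i.-1 = i by lia.
by rewrite !updE !eqxx /=; have -> : (i == i.+1) = false by lia.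
Qed.

Lemma jdt_innerE T0 h y :
  1 <= h -> T0 h 1 = Some y -> (forall i, T0 i 0 = None) -> T0 0 1 = None ->
  (forall x, T0 h.-1 2 = Some x -> llt y x) ->
  forall t k T i, i = h + t -> t < k -> i <= m ->
  (forall i', h < i' <= i -> exists2 x, T0 i'.-1 2 = Some x &
     forall y', T0 i' 1 = Some y' -> ~~ llt y' x) ->
  T i 2 = None -> (forall i', i' < i -> T i' 2 = T0 i' 2) ->
  (forall i' j, j < 2 -> T i' j = T0 i' j) ->
  columns m (jdt_inner k T i 2) =
  (seg T0 2 1 h.-1 ++ y :: seg T0 2 h t ++ seg T 2 i.+1 (m - i),
   seg T0 1 1 h.-1 ++ seg T0 1 h.+1 (m - h)).
Proof.
move=> h1 Ty T3 T00 Tx; elim=> [|t IH] [|k] T i it tk im up Ti T2 T1 //=.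
  rewrite addn0 in it; subst i; rewrite (T1 h 1) // Ty T2; last by lia.
  set T' := upd (upd T h 2 (Some y)) h 1 None.
  have -> : match T0 h.-1 2 with
    | Some x => if llt y x then jdt_inner k T' h 1
       else jdt_inner k (upd (upd T h 2 (Some x)) h.-1 2 None) h.-1 2
    | None => jdt_inner k T' h 1 end = jdt_inner k T' h 1.
    by case E: (T0 h.-1 2) => [x|] //; rewrite (Tx _ E).
  rewrite jdt_inner_col1 //; first 1 last.
  - by rewrite /T' updE !eqxx.
  - by move=> i'; rewrite /T' !updE !andbF T1.
  - by rewrite /T' !updE T1 // T00; case: ifP => // _; case: ifP => // /andP[_].
  rewrite columnsE !(@seg_split _ _ h) ?h1 //; congr pair.
    congr (_ ++ _).
      by apply: eq_seg => k' Hk; rewrite -T2; [rewrite /T'; upds|lia].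
    rewrite {1}/seg /= /T' !updE !eqxx /= ?andbF /=; congr (_ :: _).
    by apply: eq_seg => k' Hk; rewrite /T'; upds.
  congr (_ ++ _).
    by apply: eq_seg => k' Hk; rewrite -T1 // /T'; upds.
  rewrite {1}/seg /= /T' !updE !eqxx /=.
  by apply: eq_seg => k' Hk; rewrite -T1 // /T'; upds.
have [x Ex Ey] := up i ltac:(lia).
rewrite (T2 i.-1) ?Ex; last by lia.
set T' := upd (upd T i 2 (Some x)) i.-1 2 None.
have -> : match T i 1 with
    | Some y0 => if llt y0 x then jdt_inner k (upd (upd T i 2 (Some y0)) i 1 None) i 1
       else jdt_inner k T' i.-1 2
    | None => jdt_inner k T' i.-1 2 end = jdt_inner k T' i.-1 2.
  by rewrite T1 //; case E: (T0 i 1) => [y'|] //; rewrite (negbTE (Ey _ E)).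
rewrite IH; first 1 last.
- lia.
- lia.
- lia.
- by move=> i' Hi'; apply: up; lia.
- by rewrite /T' updE !eqxx.
- by move=> i' Hi'; rewrite -T2; [rewrite /T'; upds|lia].
- by move=> i' j j1; rewrite -T1 // /T'; upds.
congr pair; congr (_ ++ _ :: _).
rewrite -[t.+1]addn1 /seg iotaD pmap_cat -catA; congr (_ ++ _).
have -> : h + t = i.-1 by lia.
rewrite /= Ex /=; have -> : m - i.-1 = (m - i).+1 by lia.
rewrite /= prednK; last by lia.
have -> : T' i 2 = Some x.
  by rewrite /T' !updE !eqxx; have -> : (i == i.-1) = false by lia.
rewrite /=.
by congr (_ :: _); apply: eq_seg => k' Hk; rewrite /T'; upds.
Qed.
End Jdt.

Lemma pmap_onth (T : Type) (s : seq T) a len :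
  pmap (onth s) (iota a len) = take len (drop a s).
Proof.
elim: len a => [|len IH] a; first by rewrite take0.
rewrite /= IH; case: (ltnP a (size s)) => H; last first.
  by rewrite onth_default // !drop_oversize //; lia.
have [x Ex] := onth_some H; rewrite Ex /= -cat1s.
have -> : drop a s = x :: drop a.+1 s.
  by clear IH; elim: s a {H} Ex => [|y s IHs] [|a] //=; [case=> ->; rewrite drop0|move/IHs].
by [].
Qed.

Lemma seg_onth T j c lo len s : c <= lo ->
  (forall i, lo <= i < lo + len -> T i j = onth s (i - c)) ->
  seg T j lo len = take len (drop (lo - c) s).
Proof.
move=> cl H; rewrite -pmap_onth /seg.
have -> : iota (lo - c) len = map (fun i => i - c) (iota lo len).
  apply: (@eq_from_nth _ 0) => [|i]; rewrite ?size_map !size_iota // => Hi.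
  by rewrite (nth_map 0) ?size_iota // !nth_iota //; lia.
have : {in iota lo len, forall i, T i j = onth s (i - c)}.
  by move=> i; rewrite mem_iota => /H.
elim: (iota lo len) => //= i t IH Hi.
rewrite Hi ?mem_head // IH // => k Hk; apply: Hi; by rewrite inE Hk orbT.
Qed.

Lemma seg_none T j lo len : (forall i, lo <= i < lo + len -> T i j = None) ->
  seg T j lo len = [::].
Proof.
move=> H; have : {in iota lo len, forall i, T i j = None}.
  by move=> i; rewrite mem_iota => /H.
rewrite /seg; elim: (iota lo len) => //= i t IH Hi.
rewrite Hi ?mem_head // IH // => k Hk; apply: Hi; by rewrite inE Hk orbT.
Qed.

Lemma calE_spec n (U V : nat -> bool) y M : 1 <= y <= n ->
  cnt U y = cnt V y + M -> (forall k, k <= n -> cnt U k <= cnt V k + M) ->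
  (forall k, k < y -> cnt U k < cnt V k + M) ->
  calE (bars n U, bars n V) = Some (bars n (fset1 U y false), bars n (fset1 V y true)).
Proof.
move=> Hy Ey H Hlt.
have Ly := Hlt y.-1 ltac:(lia); have Uy := @cntP U y ltac:(lia); have Vy := @cntP V y ltac:(lia).
have [{}Uy {}Vy] : U y /\ ~~ V y by move: Uy Vy; case: (U y); case: (V y) => //=; lia.
have ex : exists2 k, k <= n & cnt U k = cnt V k + M by exists y => //; lia.
have cU : cnt U y = cnt U y.-1 + 1 by rewrite (@cntP U y) ?Uy; lia.
have cV : cnt V y = cnt V y.-1 by rewrite (@cntP V y) ?(negbTE Vy); lia.
have Uyn := @cnt_mono U y n ltac:(lia); have Vyn := @cnt_mono V y n ltac:(lia).
have Hn := H n (leqnn n).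
rewrite /calE (overlapE H ex) !size_bars.
have -> : cnt U n - (cnt U n - M) = M by lia.
have M0 : 0 < M by have := Hlt 0; rewrite !cnt0; lia.
rewrite ifF; last by lia.
set m := cnt U n + cnt V n; set T0 := entry _; set h := cnt U y.
have T0E i j := entry_two_col M (bars n U) (bars n V) i j.
have Oy : onth (bars n U) h.-1 = Some (Bar y) by apply/onth_bars; split=> //; lia.
congr Some; rewrite (@jdt_outerE m T0 h (Bar y) _ _ _ _ _ (h - M)) //; first 1 last.
- by rewrite /h /m; lia.
- by rewrite /T0 (T0E _ 2) Oy; case: ifP => //; rewrite /h; lia.
- by move=> i; rewrite /T0 (T0E _ 3).
- move=> i mi; rewrite /T0 (T0E _ 2); case: ifP => // _; apply: onth_default.
  by rewrite size_bars; lia.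
- move=> x; rewrite /T0 (T0E _ 1); case: ifP => // _ /onth_bars; case: x => // b [b1 Vb cb] /=.
  by rewrite ltnNge; apply/negP => by'; have := @cnt_mono V b y by'; lia.
- by rewrite /h; lia.
- by rewrite /m; lia.
- move=> i' Hi'.
  have [b [b1 Ub cb]] : exists a, [/\ 1 <= a <= n, U a & cnt U a = (i'.-1).+1].
    by apply: cnt_ex; lia.
  have bY : b < y by rewrite ltnNge; apply/negP => yb; have := @cnt_mono U y b yb; lia.
  have Vb := Hlt b bY.
  have [a [a1 Va ca]] : exists a, [/\ 1 <= a <= b, V a & cnt V a = (i' - M).+1].
    by apply: cnt_ex; lia.
  exists (Bar a), (Bar b); split.
  + rewrite /T0 (T0E _ 1) ifT; last by lia.
    by apply/onth_bars; split=> //; lia.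
  + rewrite /T0 (T0E _ 2) ifT; last by lia.
    by apply/onth_bars; split=> //; lia.
  + by rewrite /= -leqNgt; lia.
- by rewrite /T0 (T0E _ 1) ltnn.
congr pair.
  rewrite -bars_del // (@seg_onth _ _ 1 _ _ (bars n U)) //; last first.
    by move=> i Hi; rewrite /T0 (T0E _ 2) subn1 ifT //; lia.
  rewrite (@seg_onth _ _ 1 _ _ (bars n U)) //; last first.
    by move=> i Hi; rewrite /T0 (T0E _ 2) subn1 ifT //; lia.
  rewrite subnn drop0 subn1 /= (@take_oversize _ (m - h)) //.
  by rewrite size_drop size_bars /m /h; lia.
rewrite -bars_ins // seg_none; last first.
  by move=> i Hi; rewrite /T0 (T0E _ 1) ifF //; lia.
rewrite cat0s (@seg_onth _ _ M.+1 _ _ (bars n V)) //; last first.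
  by move=> i Hi; rewrite /T0 (T0E _ 1) ifT; [congr onth; lia|lia].
rewrite (@seg_onth _ _ M.+1 _ _ (bars n V)); first 1 last.
- by rewrite /h; lia.
- by move=> i Hi; rewrite /T0 (T0E _ 1) ifT; [congr onth; lia|lia].
rewrite subnn drop0 subSS (@take_oversize _ (m - h)); last first.
  by rewrite size_drop size_bars /m /h; lia.
by have -> : h - M = cnt V y by rewrite /h; lia.
Qed.

Lemma calF_spec n (U V : nat -> bool) y M : 1 <= y <= n ->
  cnt U y.-1 = cnt V y.-1 + M -> (forall k, k <= n -> cnt U k <= cnt V k + M) ->
  (forall k, y <= k <= n -> cnt U k < cnt V k + M) ->
  calF (bars n U, bars n V) = Some (bars n (fset1 U y true), bars n (fset1 V y false)).
Proof.
move=> Hy Ey H Hlt.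
have Ly := Hlt y ltac:(lia); have Uy := @cntP U y ltac:(lia); have Vy := @cntP V y ltac:(lia).
have [{}Uy {}Vy] : ~~ U y /\ V y by move: Uy Vy; case: (U y); case: (V y) => //=; lia.
have ex : exists2 k, k <= n & cnt U k = cnt V k + M by exists y.-1 => //; lia.
have cV : cnt V y = cnt V y.-1 + 1 by rewrite (@cntP V y) ?Vy; lia.
have cU : cnt U y = cnt U y.-1 by rewrite (@cntP U y) ?(negbTE Uy); lia.
have Uyn := @cnt_mono U y n ltac:(lia); have Vyn := @cnt_mono V y n ltac:(lia).
have Hn := Hlt n ltac:(lia).
rewrite /calF (overlapE H ex) !size_bars.
have -> : cnt U n - (cnt U n - M) = M by lia.
rewrite ifF; last by lia.
set m := cnt U n + cnt V n; set T0 := entry _; set h := (cnt U y).+1.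
have T0E i j := entry_two_col M (bars n U) (bars n V) i j.
congr Some; rewrite (@jdt_innerE m T0 h (Bar y) _ _ _ _ _ ((cnt U n).+1 - h)) //; first 1 last.
- rewrite /T0 (T0E _ 1) ifT; last by rewrite /h; lia.
  by apply/onth_bars; split=> //; rewrite /h; lia.
- move=> x; rewrite /T0 (T0E _ 2); case: ifP => // h0 /onth_bars; case: x => // b [b1 Ub cb] /=.
  rewrite /h in h0 cb; have bU : b != y by apply: contraTneq Ub => ->.
  by rewrite ltn_neqAle bU /= leqNgt; apply/negP => by'; have := @cnt_lt U y b by' Ub; lia.
- by rewrite /h; lia.
- by rewrite /m /h; lia.
- by rewrite /m; lia.
- move=> i' Hi'.
  have [b [b1 Ub cb]] : exists a, [/\ 1 <= a <= n, U a & cnt U a = (i'.-2).+1].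
    by apply: cnt_ex; lia.
  exists (Bar b).
    rewrite /T0 (T0E _ 2) ifT; last by lia.
    by apply/onth_bars; split=> //; lia.
  move=> y'; rewrite /T0 (T0E _ 1); case: ifP => // _ /onth_bars; case: y' => // a [a1 Va ca] /=.
  rewrite -leqNgt leqNgt; apply/negP => ba.
  have ya : y < a by rewrite ltnNge; apply/negP => ay; have := @cnt_mono V a y ay; lia.
  have := Hlt a.-1; have := @cnt_mono U b a.-1; have := @cntP V a; rewrite Va; lia.
- by rewrite /T0 (T0E _ 2) /= onth_default // size_bars.
congr pair.
  rewrite -bars_ins // (@seg_onth _ _ 1 _ _ (bars n U)) //; last first.
    by move=> i Hi; rewrite /T0 (T0E _ 2) subn1 ifT //; lia.
  rewrite (@seg_onth _ _ 1 _ _ (bars n U)) //; last first.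
    by move=> i Hi; rewrite /T0 (T0E _ 2) subn1 ifT //; lia.
  rewrite (@seg_none _ _ (cnt U n).+2) ?cats0; last first.
    move=> i Hi; rewrite /T0 (T0E _ 2); case: ifP => // _; apply: onth_default.
    by rewrite size_bars; lia.
  rewrite subnn drop0 subn1 /= (@take_oversize _ (_ - _)) //.
  by rewrite size_drop size_bars /m /h; lia.
have -> : h.-1 = M + (h.-1 - M) by rewrite /h; lia.
rewrite -bars_del // {1}/seg iotaD pmap_cat -!/(seg _ _ _ _) seg_none; last first.
  by move=> i Hi; rewrite /T0 (T0E _ 1) ifF //; lia.
rewrite cat0s (@seg_onth _ _ M.+1 _ _ (bars n V)) //; last first.
  by move=> i Hi; rewrite /T0 (T0E _ 1) ifT; [congr onth; lia|lia].
rewrite (@seg_onth _ _ M.+1 _ _ (bars n V)); first 1 last.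
- by rewrite /h; lia.
- by move=> i Hi; rewrite /T0 (T0E _ 1) ifT; [congr onth; lia|lia].
rewrite add1n subnn drop0 subSS (@take_oversize _ (m - h)); last first.
  by rewrite size_drop size_bars /m /h; lia.
have -> : h - M = cnt V y by rewrite /h; lia.
by have -> : h.-1 - M = (cnt V y).-1 by rewrite /h; lia.
Qed.

Section Nu.
Variables (n d : nat) (U V : nat -> bool).

(* The number of the first d unmatched letters of V lying in 1..k. *)
Definition nu (k : nat) : nat :=
  foldr minn d [seq cnt V j - cnt U j | j <- iota k (n.+1 - k)].

Lemma nuS k : k <= n -> nu k = minn (cnt V k - cnt U k) (nu k.+1).
Proof. by move=> kn; rewrite /nu subSS subSn. Qed.

Lemma nu_end : nu n.+1 = d. Proof. by rewrite /nu subnn. Qed.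

(* The bits of the columns of calF^d (bars n U, bars n V). *)
Definition lbit k := cnt U k + nu k != cnt U k.-1 + nu k.-1.
Definition rbit k := cnt V k - nu k != cnt V k.-1 - nu k.-1.

Hypothesis UV : forall k, k <= n -> cnt U k <= cnt V k.

Lemma nu0 : nu 0 = 0. Proof. by rewrite nuS // !cnt0; lia. Qed.

Lemma cnt_lbit k : k <= n -> cnt lbit k = cnt U k + nu k.
Proof.
elim: k => [_|k IH kn]; first by rewrite nu0 !cnt0.
rewrite cntS IH; last by lia.
have N1 := nuS (ltnW kn); have N2 := nuS kn; have := UV kn; have := UV (ltnW kn).
have := cntS U k; have := cntS V k; rewrite /lbit.
by case: (U k.+1); case: (V k.+1) => /=; case: eqP => /=; lia.
Qed.

Lemma cnt_rbit k : k <= n -> cnt rbit k = cnt V k - nu k.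
Proof.
elim: k => [_|k IH kn]; first by rewrite nu0 !cnt0.
rewrite cntS IH; last by lia.
have N1 := nuS (ltnW kn); have N2 := nuS kn; have := UV kn; have := UV (ltnW kn).
have := cntS U k; have := cntS V k; rewrite /rbit.
by case: (U k.+1); case: (V k.+1) => /=; case: eqP => /=; lia.
Qed.

Lemma nu_le k : k <= n -> nu k <= cnt V k - cnt U k.
Proof. by move=> kn; rewrite nuS //; lia. Qed.

Lemma nu_mono k : k <= n -> nu k <= nu k.+1.
Proof. by move=> kn; rewrite (nuS kn); lia. Qed.

Lemma nu_led k : k <= n.+1 -> nu k <= d.
Proof.
move=> /subnK; move: (n.+1 - k) => i; elim: i k => [|i IH] k Ek.
  by rewrite add0n in Ek; rewrite Ek nu_end.
have kn : k <= n by lia.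
by apply: leq_trans (nu_mono kn) (IH _ _); lia.
Qed.

Lemma nu_n : d <= cnt V n - cnt U n -> nu n = d.
Proof. by move=> H; rewrite nuS // nu_end; lia. Qed.
End Nu.

Lemma last_eq n d (U V : nat -> bool) : cnt U n + d <= cnt V n ->
  exists k, [/\ k <= n, cnt V k = cnt U k + d &
    forall j, k < j <= n -> cnt U j + d < cnt V j].
Proof.
elim: n => [|n IH] H; first by exists 0; split=> //; [move: H; rewrite !cnt0; lia|lia].
case: (eqVneq (cnt V n.+1) (cnt U n.+1 + d)) => [E|ne].
  by exists n.+1; split=> //; lia.
have [|k [kn Ek Hk]] := IH.
  by move: H ne; rewrite !cntS; case: (U _); case: (V _) => /=; lia.
exists k; split=> //; first by lia.
move=> j Hj; case: (eqVneq j n.+1) => [->|jn]; first by lia.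
by apply: Hk; lia.
Qed.

Lemma first_eq n d (U V : nat -> bool) :
  (exists2 k, k <= n & cnt U k = cnt V k + d) ->
  (forall k, k <= n -> cnt U k <= cnt V k + d) ->
  exists y, [/\ y <= n, cnt U y = cnt V y + d & forall k, k < y -> cnt U k < cnt V k + d].
Proof.
move=> [k0 k0n E0] H.
have ex : exists k, (cnt U k == cnt V k + d) by exists k0; apply/eqP.
case: (ex_minnP ex) => y /eqP Ey my; exists y; split=> //.
  by apply: leq_trans (my k0 _) k0n; apply/eqP.
move=> k ky; have := my k; have := my k0; rewrite E0 eqxx => /(_ isT) y0.
have := H k; case: eqP => [_ _ /(_ isT)|]; lia.
Qed.

Lemma nu_succ n d (U V : nat -> bool) kap : kap < n -> cnt V kap = cnt U kap + d ->
  (forall j, kap < j <= n -> cnt U j + d < cnt V j) ->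
  forall k, k <= n.+1 ->
  (kap <= k -> nu n d U V k = d) /\ nu n d.+1 U V k = nu n d U V k + (kap < k).
Proof.
move=> kn Ek Hk k /subnK; move: (n.+1 - k) => i; elim: i k => [|i IH] k Ei.
  rewrite add0n in Ei; subst k; rewrite !nu_end; split=> //; lia.
have kn' : k <= n by lia.
have [IH1 IH2] := IH k.+1 ltac:(lia); rewrite !(nuS _ _ _ kn') IH2.
case: (ltngtP kap k) => H.
- by have := Hk k ltac:(lia); have := IH1 ltac:(lia); lia.
- by split=> //; lia.
- by subst k; have := IH1 ltac:(lia); lia.
Qed.

Definition Fcols n d U V := (bars n (lbit n d U V), bars n (rbit n d U V)).

Lemma Fcols0 n U V : (forall k, k <= n -> cnt U k <= cnt V k) ->
  Fcols n 0 U V = (bars n U, bars n V).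
Proof.
move=> UV; have N k : k <= n -> nu n 0 U V k = 0 by move=> kn; have := @nu_led n 0 U V k; lia.
congr pair; apply: eq_bars; apply: cnt_inj => k kn.
  by rewrite cnt_lbit // N ?addn0.
by rewrite cnt_rbit // N ?subn0.
Qed.

Lemma calF_step n d U V : (forall k, k <= n -> cnt U k <= cnt V k) ->
  cnt U n + d < cnt V n ->
  calF (Fcols n d U V) = Some (Fcols n d.+1 U V) /\
  calE (Fcols n d.+1 U V) = Some (Fcols n d U V).
Proof.
move=> UV Hd; have [kap [kn Ek Hk]] := last_eq (ltnW Hd).
have {kn} kn : kap < n by rewrite ltn_neqAle kn andbT; apply: contraTneq Hd => <-; lia.
have NS := nu_succ kn Ek Hk.
have cL := @cnt_lbit n d U V UV; have cR := @cnt_rbit n d U V UV.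
have cL' := @cnt_lbit n d.+1 U V UV; have cR' := @cnt_rbit n d.+1 U V UV.
have le1 k : k <= n -> nu n d U V k <= cnt V k - cnt U k by exact: nu_le.
have le2 k : k <= n -> nu n d U V k <= d by move=> h; apply: nu_led; lia.
have [N1 N2] := NS kap ltac:(lia); have [M1 M2] := NS kap.+1 ltac:(lia).
have Vk := cntS V kap; have Uk := cntS U kap; have Sk := Hk kap.+1 ltac:(lia).
have [Vt Uf] : V kap.+1 = true /\ U kap.+1 = false.
  by move: Vk Uk; case: (V _); case: (U _) => /=; lia.
have Ly : lbit n d U V kap.+1 = false.
  by have := cntS (lbit n d U V) kap; rewrite !cL; [case: (lbit _ _ _ _ _); lia|lia|lia].
have Ry : rbit n d U V kap.+1 = true.
  have := cntS (rbit n d U V) kap; have := UV kap.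
  by rewrite !cR; [case: (rbit _ _ _ _ _); lia|lia|lia].
have E1 : calF (Fcols n d U V) = Some (Fcols n d.+1 U V).
  rewrite /Fcols (@calF_spec n _ _ kap.+1 d); first 1 last.
  - by lia.
  - by rewrite /= cL ?cR; [have := UV kap; lia|lia|lia].
  - by move=> k kn'; rewrite cL // cR //; have := le1 k; have := le2 k; have := UV k; lia.
  - move=> k Hk'; have kn' : k <= n by lia.
    rewrite cL // cR //; have := Hk k; have [] := NS k ltac:(lia); have := UV k; lia.
  congr (Some (_, _)); apply: eq_bars; apply: cnt_inj => k kn'.
    have := @cnt_fset1 (lbit n d U V) kap.+1 true k isT; rewrite Ly cL // cL' //.
    by have [] := NS k ltac:(lia); lia.
  have := @cnt_fset1 (rbit n d U V) kap.+1 false k isT; rewrite Ry cR // cR' //.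
  by have [] := NS k ltac:(lia); have := le1 k kn'; have := UV k kn'; have := Hk k; lia.
split=> //; rewrite /Fcols (@calE_spec n _ _ kap.+1 d.+1); first 1 last.
- by lia.
- by rewrite cL' ?cR'; [have := UV kap.+1; lia|lia|lia].
- move=> k kn'; rewrite cL' // cR' //; have := @nu_le n d.+1 U V k kn'.
  by have := @nu_led n d.+1 U V k; have := UV k; lia.
- move=> k Hk'; rewrite cL' ?cR'; try lia.
  have := le1 k; have := le2 k; have := UV k; have [] := NS k ltac:(lia); lia.
have Ly' : lbit n d.+1 U V kap.+1 = true.
  by have := cntS (lbit n d.+1 U V) kap; rewrite !cL'; [case: (lbit _ _ _ _ _); lia|lia|lia].
have Ry' : rbit n d.+1 U V kap.+1 = false.
  have := cntS (rbit n d.+1 U V) kap; have := UV kap.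
  by rewrite !cR'; [case: (rbit _ _ _ _ _); lia|lia|lia].
congr (Some (_, _)); apply: eq_bars; apply: cnt_inj => k kn'.
  have := @cnt_fset1 (lbit n d.+1 U V) kap.+1 false k isT; rewrite Ly' cL // cL' //.
  by have [] := NS k ltac:(lia); lia.
have := @cnt_fset1 (rbit n d.+1 U V) kap.+1 true k isT; rewrite Ry' cR // cR' //.
by have [] := NS k ltac:(lia); have := le1 k kn'; have := UV k kn'; have := Hk k; lia.
Qed.

Lemma iter_calF n d U V : (forall k, k <= n -> cnt U k <= cnt V k) ->
  cnt U n + d <= cnt V n ->
  iter_opt d calF (bars n U, bars n V) = Some (Fcols n d U V).
Proof.
move=> UV; elim: d => [|d IH] Hd; first by rewrite Fcols0.
rewrite /iter_opt iterS -/(iter_opt _ _ _) IH; last by lia.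
by have [] := @calF_step n d U V UV; first lia.
Qed.

Lemma iter_calE n d U V : (forall k, k <= n -> cnt U k <= cnt V k) ->
  cnt U n + d <= cnt V n ->
  iter_opt d calE (Fcols n d U V) = Some (bars n U, bars n V).
Proof.
move=> UV; elim: d => [|d IH] Hd; first by rewrite Fcols0.
rewrite /iter_opt iterSr.
have [|_ E] := @calF_step n d U V UV; first lia.
by rewrite [obind _ _]E; apply: IH; lia.
Qed.

Lemma bars_fset1K n f y b : f y = ~~ b ->
  bars n (fset1 (fset1 f y b) y (~~ b)) = bars n f.
Proof. by move=> E; apply: eq_bars => k _; rewrite /fset1; case: eqP => [->|]. Qed.

Lemma Fcols_surj n d (L R : nat -> bool) :
  (forall k, k <= n -> cnt L k <= cnt R k + d) ->
  (exists2 k, k <= n & cnt L k = cnt R k + d) ->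
  exists U V, [/\ forall k, k <= n -> cnt U k <= cnt V k,
    cnt U n + d = cnt L n, cnt V n = cnt R n + d &
    iter_opt d calF (bars n U, bars n V) = Some (bars n L, bars n R)].
Proof.
elim: d L R => [|d IH] L R H ex.
  by exists L, R; split=> //; [move=> k /H; rewrite addn0|rewrite addn0|rewrite addn0].
have [y [yn Ey Hy]] := first_eq ex H.
have y0 : 0 < y by case: (y) Ey => //; rewrite !cnt0; lia.
have Hy1 := Hy y.-1 ltac:(lia); have cLy := @cntP L y y0; have cRy := @cntP R y y0.
have [Ly Ry] : L y = true /\ R y = false.
  by move: cLy cRy; case: (L y); case: (R y) => /=; lia.
rewrite Ly Ry /= in cLy cRy.
pose L' := fset1 L y false; pose R' := fset1 R y true.
have cL' k := @cnt_fset1 L y false k y0; have cR' k := @cnt_fset1 R y true k y0.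
have H' k : k <= n -> cnt L' k <= cnt R' k + d.
  move=> kn; have := cL' k; have := cR' k; rewrite Ly Ry -/L' -/R'.
  by have := H k kn; have := Hy k; case: (leqP y k) => /=; lia.
have cL1 := cL' y.-1; have cR1 := cR' y.-1; rewrite Ly Ry -/L' -/R' in cL1 cR1.
have ex' : cnt L' y.-1 = cnt R' y.-1 + d.
  move: cL1 cR1; have -> : (y <= y.-1) = false by lia.
  lia.
have [|U [V [UV sU sV it]]] := IH L' R' H'; first by exists y.-1 => //; lia.
have Ln := cL' n; have Rn := cR' n; rewrite Ly Ry -/L' -/R' yn in Ln Rn.
exists U, V; split=> //; try lia.
rewrite /iter_opt iterS -/(iter_opt _ _ _) it.
change (calF (bars n L', bars n R') = Some (bars n L, bars n R)).
rewrite (@calF_spec n _ _ y d) //; first 1 last.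
- by lia.
- move=> k Hk; have := cL' k; have := cR' k; rewrite Ly Ry -/L' -/R'.
  have -> : (y <= k) by lia.
  by have := H k; lia.
by rewrite (@bars_fset1K n L y false) // (@bars_fset1K n R y true).
Qed.

(* Signature rule: a letter x is recorded as (eps_i x, phi_i x). *)
Fixpoint seps (l : seq (nat * nat)) : nat :=
  if l is x :: l' then maxn x.1 (seps l' + x.1 - x.2) else 0.
Fixpoint sphi (l : seq (nat * nat)) : nat :=
  if l is x :: l' then maxn (x.2 + sphi l' - seps l') (sphi l') else 0.

Definition napp (g : letter -> option letter) (x : letter) : nat :=
  if g x is Some y then (if g y is Some _ then 2 else 1) else 0.

Lemma nb_appE g x : nb_app g x = (napp g x)%:R%R.
Proof. by rewrite /nb_app /napp; case: (g x) => // y; case: (g y). Qed.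

Section Signature.
Variables (n i : nat).
Hypothesis n2 : 1 < n.
Hypothesis Hi : 1 <= i <= n.

Definition sg (x : letter) : nat * nat :=
  locked (napp (letter_e n i) x, napp (letter_f n i) x).

Lemma sgE x : sg x = (napp (letter_e n i) x, napp (letter_f n i) x).
Proof. by rewrite /sg -lock. Qed.

Lemma sgP (x : letters n) : eps i x = (sg x).1%:R%R /\ phi i x = (sg x).2%:R%R.
Proof. by rewrite sgE /= !nb_appE. Qed.

Lemma words_sg (w : words n) : J_word n w ->
  eps i w = (seps (map sg w))%:R%R /\ phi i w = (sphi (map sg w))%:R%R.
Proof.
elim: w => [|x w IH] //= [Jx Jw]; have [E1 E2] := IH Jw; have [e1 f1] := sgP x.
change (Num.max (eps i (x : letters n)) (eps i (w : words n) - pairing (wt (x : letters n)) i)%R =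
   (maxn (sg x).1 (seps (map sg w) + (sg x).1 - (sg x).2))%:R%R /\
   Num.max (phi i (x : letters n) + pairing (wt (w : words n)) i)%R (phi i (w : words n)) =
   (maxn ((sg x).2 + sphi (map sg w) - seps (map sg w)) (sphi (map sg w)))%:R%R).
have [K _] := letters_regular n2; have [_ A] := K x Jx; have [Ex _ _ _ _] := A i Hi.
have [Kw _] := words_regular n2; have [_ Aw] := Kw w Jw; have [Ew _ _ _ _] := Aw i Hi.
move: Ex Ew; rewrite e1 f1 E1 E2; case: (sg x) => a b; rewrite /fst /snd; lia.
Qed.

Section Cells.
Variables (A : eqType) (e : A -> letter).
Local Notation sge := (map (fun c : A => sg (e c))).

Fixpoint ftgt (s : seq A) : option A :=
  if s is c :: s' then
    if seps (sge s') < (sg (e c)).2 then Some c else ftgt s'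
  else None.

Fixpoint etgt (s : seq A) : option A :=
  if s is c :: s' then
    if seps (sge s') <= (sg (e c)).2 then (if 0 < (sg (e c)).1 then Some c else None)
    else etgt s'
  else None.

Definition upd1 (c : A) (x : letter) : A -> letter := fun c' => if c' == c then x else e c'.

Lemma map_upd1_notin s c x : c \notin s -> map (upd1 c x) s = map e s.
Proof.
move=> cs; apply/eq_in_map => c' c's; rewrite /upd1; case: eqP => // E.
by rewrite E (negbTE cs) in c's.
Qed.

Lemma ftgt_in s c : ftgt s = Some c -> c \in s.
Proof.
elim: s => //= a s IH; case: ifP => _; first by case=> ->; exact: mem_head.
by move=> /IH; rewrite inE orbC => ->.
Qed.

Lemma etgt_in s c : etgt s = Some c -> c \in s.
Proof.
elim: s => //= a s IH; case: ifP => _; last by move=> /IH; rewrite inE orbC => ->.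
by case: ifP => // _ [->]; exact: mem_head.
Qed.

Lemma tf_cells s : uniq s -> J_word n (map e s) ->
  tf i (map e s : words n) =
  omap (fun c => map (upd1 c (odflt Zero (letter_f n i (e c)))) s) (ftgt s).
Proof.
elim: s => [|c s IH] //= /andP[cs us] [Jc Js].
change (tf i (e c :: map e s : words n) =
  omap (fun c0 => upd1 c0 (odflt Zero (letter_f n i (e c0))) c ::
        map (upd1 c0 (odflt Zero (letter_f n i (e c0)))) s)
    (if seps (sge s) < (sg (e c)).2 then Some c else ftgt s)).
rewrite tseq_tf_cons IH //; have [-> _] := words_sg Js; have [_ ->] := sgP (e c).
rewrite -map_comp -/(sge s) ltr_nat; case: ifP => H.
  rewrite /= map_upd1_notin // /upd1 eqxx.
  by move: H; rewrite sgE /= /napp; case: (letter_f n i (e c)).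
case E: (ftgt s) => [c'|] //=; congr (Some (_ :: _)); rewrite /upd1.
by case: eqP => // Ec; rewrite Ec (ftgt_in E) in cs.
Qed.

Lemma te_cells s : uniq s -> J_word n (map e s) ->
  te i (map e s : words n) =
  omap (fun c => map (upd1 c (odflt Zero (letter_e n i (e c)))) s) (etgt s).
Proof.
elim: s => [|c s IH] //= /andP[cs us] [Jc Js].
change (te i (e c :: map e s : words n) =
  omap (fun c0 => upd1 c0 (odflt Zero (letter_e n i (e c0))) c ::
        map (upd1 c0 (odflt Zero (letter_e n i (e c0)))) s)
    (if seps (sge s) <= (sg (e c)).2 then if 0 < (sg (e c)).1 then Some c else None
     else etgt s)).
rewrite tseq_te_cons IH //; have [-> _] := words_sg Js; have [_ ->] := sgP (e c).
rewrite -map_comp -/(sge s) ler_nat; case: ifP => H.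
  rewrite sgE /= /napp; case E: (letter_e n i (e c)) => [y|] //=.
  rewrite ifT /=; last by case: (letter_e n i y).
  by rewrite map_upd1_notin // /upd1 eqxx E.
case E: (etgt s) => [c'|] //=; congr (Some (_ :: _)); rewrite /upd1.
by case: eqP => // Ec; rewrite Ec (etgt_in E) in cs.
Qed.

Definition relv (c : A) : bool := sg (e c) != (0, 0).

Lemma relvN c : relv c = false -> sg (e c) = (0, 0).
Proof. by move/negbFE/eqP. Qed.

Lemma seps_filter s : seps (sge (filter relv s)) = seps (sge s).
Proof.
elim: s => //= c s IH; case E: (relv c) => /=; first by rewrite IH.
by rewrite (relvN E) IH /= max0n addn0 subn0.
Qed.

Lemma sphi_filter s : sphi (sge (filter relv s)) = sphi (sge s).
Proof.
clear Hi n2; elim: s => //= c s IH; case E: (relv c) => /=; first by rewrite IH seps_filter.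
by rewrite (relvN E) IH /= add0n; lia.
Qed.

Lemma ftgt_filter s : ftgt (filter relv s) = ftgt s.
Proof.
elim: s => //= c s IH; case E: (relv c) => /=; first by rewrite seps_filter IH.
by rewrite (relvN E) IH /= ?ltn0.
Qed.

Lemma etgt0 s : seps (sge s) = 0 -> etgt s = None.
Proof.
clear Hi n2; elim: s => //= c s IH H; case: ifP => H1; last by lia.
by rewrite ifF //; lia.
Qed.

Lemma etgt_filter s : etgt (filter relv s) = etgt s.
Proof.
elim: s => //= c s IH; case E: (relv c) => /=; first by rewrite seps_filter IH.
by rewrite (relvN E) IH /= leqn0; case: eqP => // /etgt0.
Qed.
End Cells.

Lemma J_word_map (A : eqType) (e : A -> letter) s :
  (forall c, c \in s -> in_J n (e c)) -> J_word n (map e s).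
Proof.
elim: s => //= c s IH H; split; first by apply: H; exact: mem_head.
by apply: IH => c' Hc; apply: H; rewrite inE Hc orbT.
Qed.

Lemma sg_bar a : i < n -> sg (Bar a) = (nat_of_bool (a == i), nat_of_bool (a == i.+1)).
Proof.
move=> iln; have ji : (i.+1 == i) = false by lia.
have ij : (i == i.+1) = false by lia.
rewrite sgE /napp /= iln /=; congr pair.
  by case: (eqVneq a i) => //= _; rewrite ?ji ?ij ?andbF.
by case: (eqVneq a i.+1) => //= _; rewrite ?ji ?ij ?andbF.
Qed.

Lemma sg_pos a : i < n -> sg (Pos a) = (nat_of_bool (a == i.+1), nat_of_bool (a == i)).
Proof.
move=> iln; have ji : (i.+1 == i) = false by lia.
have ij : (i == i.+1) = false by lia.
rewrite sgE /napp /= iln /=; congr pair.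
  by case: (eqVneq a i.+1) => //= _; rewrite ?ji ?ij ?andbF.
by case: (eqVneq a i) => //= _; rewrite ?ji ?ij ?andbF.
Qed.

Lemma sg_zero : i < n -> sg Zero = (0, 0).
Proof.
move=> iln; have ij : (i == n) = false by lia.
by rewrite sgE /napp /= ij.
Qed.
End Signature.

Lemma idx_split2 n i (f : nat -> bool) : 1 <= i < n ->
  idx n f = idx i.-1 f ++ (if f i then [:: i] else [::]) ++
    (if f i.+1 then [:: i.+1] else [::]) ++ idx_from n i.+1 f.
Proof.
move=> Hi; rewrite (@idx_split n i); last by lia.
congr (_ ++ (_ ++ _)); rewrite /idx_from.
have -> : n - i = (n - i.+1).+1 by lia.
by rewrite /=; case: ifP.
Qed.

(* phi_i and eps_i of the column bars n f, and the effect on f of f_i (b = true)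
   or e_i (b = false). *)
Definition gphi n i (f : nat -> bool) : bool := ~~ f i && ((i < n) ==> f i.+1).
Definition geps n i (f : nat -> bool) : bool := f i && ((i < n) ==> ~~ f i.+1).
Definition gset i (b : bool) (f : nat -> bool) : nat -> bool :=
  fun k => if k == i then b else if k == i.+1 then ~~ b else f k.

Lemma idx_gset n i b (f : nat -> bool) : 1 <= i < n -> f i = ~~ b -> f i.+1 = b ->
  idx n (gset i b f) =
  [seq (if k == (if b then i.+1 else i) then (if b then i else i.+1) else k) | k <- idx n f].
Proof.
move=> Hi fi fj; rewrite !(idx_split2 _ Hi) !map_cat fi fj.
have -> : gset i b f i = b by rewrite /gset eqxx.
have -> : gset i b f i.+1 = ~~ b.
  by rewrite /gset eqxx; have -> : (i.+1 == i) = false by lia.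
have -> : idx i.-1 (gset i b f) = idx i.-1 f.
  by apply: eq_idx => k Hk; rewrite /gset; do 2![case: eqP => [|_]; first by lia].
have -> : idx_from n i.+1 (gset i b f) = idx_from n i.+1 f.
  by apply: eq_idx_from => k Hk; rewrite /gset; do 2![case: eqP => [|_]; first by lia].
congr (_ ++ _).
  rewrite -[LHS]map_id; apply/eq_in_map => k; rewrite mem_idx => Hk.
  by case: b {fi fj}; case: eqP => //; lia.
rewrite !catA; congr (_ ++ _); first by case: b {fi fj}; rewrite /= eqxx.
rewrite -[LHS]map_id; apply/eq_in_map => k; rewrite mem_filter mem_iota => Hk.
by case: b {fi fj}; case: eqP => //; lia.
Qed.

Section BarWords.
Variables (n i : nat).
Hypothesis n2 : 1 < n.
Hypothesis Hi : 1 <= i < n.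

Let Hi' : 1 <= i <= n. Proof. by lia. Qed.

Lemma filter_bar f : filter (relv n i Bar) (idx n f) =
  (if f i then [:: i] else [::]) ++ (if f i.+1 then [:: i.+1] else [::]).
Proof.
have iln : i < n by lia.
rewrite (idx_split2 _ Hi) !filter_cat.
have -> : filter (relv n i Bar) (idx i.-1 f) = [::].
  apply/eqP; rewrite -(negbK (_ == _)) -has_filter; apply/hasPn => k; rewrite mem_idx => Hk.
  by rewrite /relv sg_bar // negbK; apply/eqP; do 2![case: eqP => [|_]; first by lia].
have -> : filter (relv n i Bar) (idx_from n i.+1 f) = [::].
  apply/eqP; rewrite -(negbK (_ == _)) -has_filter; apply/hasPn => k.
  rewrite mem_filter mem_iota => Hk.
  by rewrite /relv sg_bar // negbK; apply/eqP; do 2![case: eqP => [|_]; first by lia].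
rewrite cats0 /=; congr (_ ++ _); case: ifP => //= _; rewrite /relv sg_bar //.
  by rewrite eqxx.
have -> : (i.+1 == i) = false by lia.
by rewrite eqxx.
Qed.

Lemma filter_pos f : filter (relv n i Pos) (idx n f) =
  (if f i then [:: i] else [::]) ++ (if f i.+1 then [:: i.+1] else [::]).
Proof.
have iln : i < n by lia.
rewrite -filter_bar; apply: eq_filter => k; rewrite /relv sg_bar // sg_pos //.
by case: (k == i); case: (k == i.+1).
Qed.

Lemma bar_word f : let w : words n := rev (bars n f) in
  [/\ eps i w = (geps n i f)%:R%R, phi i w = (gphi n i f)%:R%R,
      te i w = (if geps n i f then Some (rev (bars n (gset i false f))) else None) &
      tf i w = (if gphi n i f then Some (rev (bars n (gset i true f))) else None)].
Proof.
have iln : i < n by lia.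
set s := rev (idx n f); have us : uniq s by rewrite rev_uniq idx_uniq.
have Jw : J_word n (map Bar s).
  apply: J_word_map => k; rewrite mem_rev mem_idx /in_J /= => /andP[-> _] //.
cbv zeta; rewrite /bars -map_rev -/s.
have [-> ->] := words_sg n2 Hi' Jw; rewrite te_cells // tf_cells //.
rewrite -!map_comp -(seps_filter n i Bar) -(sphi_filter n i Bar).
rewrite -(etgt_filter n i Bar) -(ftgt_filter n i Bar) /s filter_rev filter_bar.
rewrite /geps /gphi iln /=.
have ji : (i.+1 == i) = false by lia.
have ij : (i == i.+1) = false by lia.
have S1 : sg n i (Bar i) = (1, 0) by rewrite sg_bar // eqxx ij.
have S2 : sg n i (Bar i.+1) = (0, 1) by rewrite sg_bar // eqxx ji.
case fi: (f i); case fj: (f i.+1); rewrite /= ?S1 ?S2 /= ?S1 ?S2 //=; split=> //.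
- congr Some; rewrite map_rev idx_gset ?fi ?fj // -map_comp; congr rev.
  by apply: eq_map => k; rewrite /upd1 /= eqxx iln /=; case: eqP.
- congr Some; rewrite map_rev idx_gset ?fi ?fj // -map_comp; congr rev.
  by apply: eq_map => k; rewrite /upd1 /= eqxx iln /=; case: eqP.
Qed.

Lemma pos_word f : let w : words n := map Pos (idx n (fun k => ~~ f k)) in
  [/\ eps i w = (geps n i f)%:R%R, phi i w = (gphi n i f)%:R%R,
      te i w = (if geps n i f
        then Some (map Pos (idx n (fun k => ~~ gset i false f k))) else None) &
      tf i w = (if gphi n i f
        then Some (map Pos (idx n (fun k => ~~ gset i true f k))) else None)].
Proof.
have iln : i < n by lia.
set g := fun k => ~~ f k; set s := idx n g; have us : uniq s by rewrite idx_uniq.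
have Jw : J_word n (map Pos s).
  apply: J_word_map => k; rewrite mem_idx /in_J /= => /andP[-> _] //.
have gE b : idx n (fun k => ~~ gset i b f k) = idx n (gset i (~~ b) g).
  by apply: eq_idx => k _; rewrite /gset /g; case: ifP => // _; case: ifP.
cbv zeta; rewrite !gE.
have [-> ->] := words_sg n2 Hi' Jw; rewrite te_cells // tf_cells //.
rewrite -!map_comp -(seps_filter n i Pos) -(sphi_filter n i Pos).
rewrite -(etgt_filter n i Pos) -(ftgt_filter n i Pos) /s filter_pos.
rewrite /geps /gphi iln /=.
have ji : (i.+1 == i) = false by lia.
have ij : (i == i.+1) = false by lia.
have S1 : sg n i (Pos i) = (0, 1) by rewrite sg_pos // eqxx ij.
have S2 : sg n i (Pos i.+1) = (1, 0) by rewrite sg_pos // eqxx ji.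
rewrite /g; case fi: (f i); case fj: (f i.+1); rewrite /= ?S1 ?S2 /= ?S1 ?S2 //=; split=> //.
- congr Some; rewrite idx_gset ?fi ?fj // -map_comp.
  by apply: eq_map => k; rewrite /upd1 /= eqxx iln /=; case: eqP.
- congr Some; rewrite idx_gset ?fi ?fj // -map_comp.
  by apply: eq_map => k; rewrite /upd1 /= eqxx iln /=; case: eqP.
Qed.
End BarWords.

Section Pairs.
Variables (n i : nat).
Implicit Types X Y : nat -> bool.

(* On bars n X (x) bars n Y: the operator f_i or e_i changes the given factor. *)
Definition f_left X Y : bool := gphi n i X && ~~ geps n i Y.
Definition f_right X Y : bool := gphi n i Y && ~~ gphi n i X.
Definition e_left X Y : bool := geps n i X && ~~ geps n i Y.
Definition e_right X Y : bool := geps n i Y && ~~ gphi n i X.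
Definition bphi X Y : nat := gphi n i Y + f_left X Y.
Definition beps X Y : nat := geps n i X + e_right X Y.

Lemma gphi_geps X : gphi n i X -> geps n i X = false.
Proof. by rewrite /gphi /geps => /andP[/negbTE->]. Qed.

Lemma gphi_gepsN X : ~~ (gphi n i X && geps n i X).
Proof. by apply/negP => /andP[/gphi_geps->]. Qed.

Lemma tens_bits X Y (ex fx ey fy px py : int) :
  ex = (geps n i X)%:R%R -> fx = (gphi n i X)%:R%R ->
  ey = (geps n i Y)%:R%R -> fy = (gphi n i Y)%:R%R ->
  fx = (ex + px)%R -> fy = (ey + py)%R ->
  [/\ Num.max ex (ey - px)%R = (beps X Y)%:R%R,
      Num.max (fx + py)%R fy = (bphi X Y)%:R%R,
      (ey <= fx)%R = ~~ geps n i Y || gphi n i X &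
      (ey < fx)%R = gphi n i X && ~~ geps n i Y].
Proof.
move=> -> -> -> ->; have := gphi_gepsN X; have := gphi_gepsN Y.
rewrite /beps /bphi /f_left /e_right.
by case: (gphi n i X); case: (geps n i X); case: (gphi n i Y); case: (geps n i Y) => //= _ _ H1 H2;
  split=> //; lia.
Qed.

Lemma tens_te_bits (A B C : Type) X Y (g1 : A -> C) (g2 : B -> C) a b :
  (if ~~ geps n i Y || gphi n i X then omap g1 (if geps n i X then Some a else None)
   else omap g2 (if geps n i Y then Some b else None)) =
  (if e_left X Y then Some (g1 a) else if e_right X Y then Some (g2 b) else None).
Proof.
rewrite /e_left /e_right; have := gphi_gepsN X.
by case: (gphi n i X); case: (geps n i X); case: (geps n i Y).
Qed.

Lemma tens_tf_bits (A B C : Type) X Y (g1 : A -> C) (g2 : B -> C) a b :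
  (if gphi n i X && ~~ geps n i Y then omap g1 (if gphi n i X then Some a else None)
   else omap g2 (if gphi n i Y then Some b else None)) =
  (if f_left X Y then Some (g1 a) else if f_right X Y then Some (g2 b) else None).
Proof.
rewrite /f_left /f_right; have := gphi_gepsN Y.
by case: (gphi n i X); case: (gphi n i Y); case: (geps n i Y).
Qed.
End Pairs.

Section ColumnOps.
Variable n : nat.
Hypothesis n2 : 1 < n.

Lemma words_cat i (w1 w2 : words n) : J_word n w1 -> J_word n w2 -> 1 <= i <= n ->
  [/\ eps i (w1 ++ w2 : words n) = Num.max (eps i w1) (eps i w2 - pairing (wt w1) i)%R,
      phi i (w1 ++ w2 : words n) = Num.max (phi i w1 + pairing (wt w2) i)%R (phi i w2),
      te i (w1 ++ w2 : words n) =
        (if (eps i w2 <= phi i w1)%R then omap (fun y : words n => y ++ w2) (te i w1)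
         else omap (cat w1) (te i w2)) &
      tf i (w1 ++ w2 : words n) =
        (if (eps i w2 < phi i w1)%R then omap (fun y : words n => y ++ w2) (tf i w1)
         else omap (cat w1) (tf i w2))].
Proof.
move=> J1 J2 Hi; have [_ M] := cat_morph (letters_regular n2) J1 J2.
have [e f t s] := M i Hi; split; [exact: e|exact: f| |].
  apply: (etrans t); change (omap (fun b : words n * words n => b.1 ++ b.2)
    (if (eps i w2 <= phi i w1)%R then omap (fun y => (y, w2)) (te i w1)
     else omap (fun y => (w1, y)) (te i w2)) = if (eps i w2 <= phi i w1)%R
     then omap (fun y : words n => y ++ w2) (te i w1) else omap (cat w1) (te i w2)).
  by case: ifP => _; [case: (te i w1)|case: (te i w2)].
apply: (etrans s); change (omap (fun b : words n * words n => b.1 ++ b.2)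
    (if (eps i w2 < phi i w1)%R then omap (fun y => (y, w2)) (tf i w1)
     else omap (fun y => (w1, y)) (tf i w2)) = if (eps i w2 < phi i w1)%R
     then omap (fun y : words n => y ++ w2) (tf i w1) else omap (cat w1) (tf i w2)).
by case: ifP => _; [case: (tf i w1)|case: (tf i w2)].
Qed.

Lemma words_phi (w : words n) i : J_word n w -> 1 <= i <= n ->
  phi i w = (eps i w + pairing (wt w) i)%R.
Proof.
by move=> Jw Hi; have [K _] := words_regular n2; have [_ A] := K w Jw; have [] := A i Hi.
Qed.

Lemma J_zeros m : J_word n (nseq m Zero).
Proof. by apply/J_wordP; apply/allP => x; rewrite mem_nseq => /andP[_ /eqP->]. Qed.

Lemma J_poss p : J_word n (map Pos (idx n p)).
Proof.
apply/J_wordP; apply/allP => x /mapP[k + ->]; rewrite mem_idx /in_J /=.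
by case/andP => ->.
Qed.

Lemma J_rbars u : J_word n (rev (bars n u)).
Proof.
apply/J_wordP; rewrite all_rev; apply/allP => x; rewrite mem_bars /in_J.
by case: x => // k /andP[/= -> _].
Qed.

Lemma J_cat w1 w2 : J_word n w1 -> J_word n w2 -> J_word n (w1 ++ w2).
Proof. by move=> /J_wordP J1 /J_wordP J2; apply/J_wordP; rewrite all_cat J1. Qed.

Lemma rev_kncol p m u :
  rev (kncol n p m u) = map Pos (idx n p) ++ (nseq m Zero ++ rev (bars n u)).
Proof. by rewrite /kncol !rev_cat revK rev_nseq catA. Qed.

Lemma rev_knword p m u :
  rev (map Pos (idx n p) ++ (nseq m Zero ++ rev (bars n u))) = kncol n p m u.
Proof. by rewrite -rev_kncol revK. Qed.

Lemma zeros_lt i m : 1 <= i < n -> let w : words n := nseq m Zero in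
  [/\ eps i w = 0%R, phi i w = 0%R, te i w = None & tf i w = None].
Proof.
move=> Hi w; have Hi' : 1 <= i <= n by lia.
have iln : i < n by lia.
have Jz := J_zeros m; have [E F] := words_sg n2 Hi' Jz.
have [e0 f0] : eps i w = 0%R /\ phi i w = 0%R.
  rewrite E F map_nseq sg_zero //; elim: (m) => [|k [IH1 IH2]] //=.
  by split; lia.
split=> //.
  by apply: (regular_te0 (words_regular n2) Jz Hi'); rewrite e0.
by apply: (regular_tf0 (words_regular n2) Jz Hi'); rewrite f0.
Qed.

Lemma kn_op_lt i m V U : 1 <= i < n ->
  let c : col_crystal n := kncol n (fun k => ~~ V k) m U in
  [/\ eps i c = (beps n i V U)%:R%R, phi i c = (bphi n i V U)%:R%R,
      te i c = (if e_left n i V U then Some (kncol n (fun k => ~~ gset i false V k) m U)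
        else if e_right n i V U then Some (kncol n (fun k => ~~ V k) m (gset i false U)) else None) &
      tf i c = (if f_left n i V U then Some (kncol n (fun k => ~~ gset i true V k) m U)
        else if f_right n i V U then Some (kncol n (fun k => ~~ V k) m (gset i true U)) else None)].
Proof.
move=> Hi c; have Hi' : 1 <= i <= n by lia.
set Pw : words n := map Pos (idx n (fun k => ~~ V k)).
set Zw : words n := nseq m Zero; set Bw : words n := rev (bars n U).
have JP : J_word n Pw by exact: J_poss.
have JZ : J_word n Zw by exact: J_zeros.
have JB : J_word n Bw by exact: J_rbars.
have JZB : J_word n (Zw ++ Bw) by exact: J_cat.
have [z1 z2 z3 z4] := zeros_lt m Hi; rewrite -/Zw in z1 z2 z3 z4.
have [b1 b2 b3 b4] := bar_word n2 Hi U; rewrite -/Bw in b1 b2 b3 b4.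
have [p1 p2 p3 p4] := pos_word n2 Hi V; rewrite -/Pw in p1 p2 p3 p4.
have [c1 c2 c3 c4] := words_cat JZ JB Hi'.
have wZ := words_phi JZ Hi'; have wB := words_phi JB Hi'; have wP := words_phi JP Hi'.
have wZB := words_phi JZB Hi'.
have pZ : pairing (wt Zw) i = 0%R by lia.
have {}c1 : eps i (Zw ++ Bw : words n) = (geps n i U)%:R%R.
  by rewrite c1 z1 pZ b1; lia.
have {}c2 : phi i (Zw ++ Bw : words n) = (gphi n i U)%:R%R.
  by rewrite c2 z2; move: wB; rewrite b1 b2; lia.
have {}c3 : te i (Zw ++ Bw : words n) =
   if geps n i U then Some (Zw ++ rev (bars n (gset i false U))) else None.
  by rewrite c3 z3 z2 b1 b3; case: (geps n i U).
have {}c4 : tf i (Zw ++ Bw : words n) =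
   if gphi n i U then Some (Zw ++ rev (bars n (gset i true U))) else None.
  by rewrite c4 z4 z2 b1 b4; case: (gphi n i U); case: (geps n i U).
have [d1 d2 d3 d4] := words_cat JP JZB Hi'.
have [t1 t2 t3 t4] := tens_bits p1 p2 c1 c2 wP wZB.
change [/\ eps i (rev c : words n) = (beps n i V U)%:R%R,
  phi i (rev c : words n) = (bphi n i V U)%:R%R,
  omap rev (te i (rev c : words n)) = (if e_left n i V U then Some (kncol n (fun k => ~~ gset i false V k) m U)
        else if e_right n i V U then Some (kncol n (fun k => ~~ V k) m (gset i false U)) else None) &
  omap rev (tf i (rev c : words n)) = (if f_left n i V U then Some (kncol n (fun k => ~~ gset i true V k) m U)
        else if f_right n i V U then Some (kncol n (fun k => ~~ V k) m (gset i true U)) else None)].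
rewrite /c rev_kncol d1 d2 d3 d4 t1 t2 t3 t4 p3 p4 c3 c4 tens_te_bits tens_tf_bits.
split=> //.
  by case: ifP => _ /=; [rewrite rev_knword|case: ifP => _ //=; rewrite rev_knword].
by case: ifP => _ /=; [rewrite rev_knword|case: ifP => _ //=; rewrite rev_knword].
Qed.

Let Hn : 1 <= n <= n. Proof. by rewrite leqnn andbT; lia. Qed.

Lemma sg_bar_n a : sg n n (Bar a) = (2 * (a == n), 0).
Proof.
rewrite sgE /napp /= ltnn /=; congr pair.
by case: eqP => //= _; rewrite eqxx.
Qed.

Lemma sg_pos_n a : sg n n (Pos a) = (0, 2 * (a == n)).
Proof.
rewrite sgE /napp /= ltnn /=; congr pair.
by case: eqP => //= _; rewrite eqxx.
Qed.

Lemma sg_zero_n : sg n n Zero = (1, 1).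
Proof. by rewrite sgE /napp /= !eqxx /= ltnn. Qed.

Lemma idx_last f : idx n f = idx n.-1 f ++ (if f n then [:: n] else [::]).
Proof. by case: (n) n2 => // n' _; rewrite idxS. Qed.

Lemma filter_n (L : nat -> letter) f : (forall a, relv n n L a = (a == n)) ->
  filter (relv n n L) (idx n f) = (if f n then [:: n] else [::]).
Proof.
move=> H; rewrite idx_last filter_cat.
have -> : filter (relv n n L) (idx n.-1 f) = [::].
  apply/eqP; rewrite -(negbK (_ == _)) -has_filter; apply/hasPn => k; rewrite mem_idx => Hk.
  by rewrite H; apply/negP => /eqP; lia.
by case: ifP => //= _; rewrite H eqxx.
Qed.

Lemma idx_fset1_n f b : idx n (fset1 f n b) = idx n.-1 f ++ (if b then [:: n] else [::]).
Proof.
rewrite idx_last /fset1 eqxx; congr (_ ++ _).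
by apply: eq_idx => k Hk; case: eqP => //; lia.
Qed.

Lemma bar_word_n f : let w : words n := rev (bars n f) in
  [/\ eps n w = (2 * f n)%:R%R, phi n w = 0%R,
      te n w = (if f n then Some (Zero :: rev (bars n (fset1 f n false))) else None) &
      tf n w = None].
Proof.
set s := rev (idx n f); have us : uniq s by rewrite rev_uniq idx_uniq.
have Jw : J_word n (map Bar s) by have := J_rbars f; rewrite /bars -map_rev.
cbv zeta; rewrite /bars -map_rev -/s.
have [-> ->] := words_sg n2 Hn Jw; rewrite te_cells // tf_cells //.
rewrite -!map_comp -(seps_filter n n Bar) -(sphi_filter n n Bar).
have R a : relv n n Bar a = (a == n).
  by rewrite /relv sg_bar_n; case: (a == n).
rewrite -(etgt_filter n n Bar) -(ftgt_filter n n Bar) /s filter_rev filter_n //.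
case fn: (f n); rewrite /= ?sg_bar_n ?eqxx /= ?sg_bar_n ?eqxx //=; split=> //.
congr Some; rewrite ltnn idx_last fn idx_fset1_n cats0 rev_cat /= map_rev.
rewrite /upd1 eqxx; congr (_ :: _).
congr rev; apply/eq_in_map => k; rewrite mem_idx => Hk.
by case: eqP => //; lia.
Qed.

Lemma pos_word_n f : let w : words n := map Pos (idx n f) in
  [/\ eps n w = 0%R, phi n w = (2 * f n)%:R%R,
      te n w = None &
      tf n w = (if f n then Some (map Pos (idx n (fset1 f n false)) ++ [:: Zero]) else None)].
Proof.
set s := idx n f; have us : uniq s by rewrite idx_uniq.
have Jw : J_word n (map Pos s) by exact: J_poss.
cbv zeta; rewrite -/s.
have [-> ->] := words_sg n2 Hn Jw; rewrite te_cells // tf_cells //.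
rewrite -!map_comp -(seps_filter n n Pos) -(sphi_filter n n Pos).
have R a : relv n n Pos a = (a == n).
  by rewrite /relv sg_pos_n; case: (a == n).
rewrite -(etgt_filter n n Pos) -(ftgt_filter n n Pos) /s filter_n //.
case fn: (f n); rewrite /= ?sg_pos_n ?eqxx /= ?sg_pos_n ?eqxx //=; split=> //.
congr Some; rewrite ltnn idx_last fn idx_fset1_n cats0 map_cat /=.
rewrite /upd1 eqxx; congr (_ ++ _).
by apply/eq_in_map => k; rewrite mem_idx => Hk; case: eqP => //; lia.
Qed.

Lemma zeros_n m : let w : words n := nseq m Zero in
  [/\ eps n w = (0 < m)%:R%R, phi n w = (0 < m)%:R%R,
      te n w = (if 0 < m then Some (Pos n :: nseq m.-1 Zero) else None) &
      tf n w = (if 0 < m then Some (nseq m.-1 Zero ++ [:: Bar n]) else None)].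
Proof.
cbv zeta; have E k : eps n (nseq k Zero : words n) = (0 < k)%:R%R /\
   phi n (nseq k Zero : words n) = (0 < k)%:R%R.
  have [-> ->] := words_sg n2 Hn (J_zeros k); rewrite map_nseq sg_zero_n.
  have H : seps (nseq k (1, 1)) = (0 < k) /\ sphi (nseq k (1, 1)) = (0 < k).
    by elim: k => //= k [-> ->]; case: (0 < k).
  by case: H => -> ->.
have [E1 E2] := E m; split=> //.
  case: m {E1 E2} => // m; change (te n (Zero :: nseq m Zero : words n) =
    Some (Pos n :: nseq m Zero)).
  rewrite tseq_te_cons (E m).1 ifT /= ?eqxx //.
  by rewrite /nb_app /= eqxx /= ltnn; case: (0 < m).
elim: m {E1 E2} => // m IH; change (tf n (Zero :: nseq m Zero : words n) =
  Some (nseq m Zero ++ [:: Bar n])).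
rewrite tseq_tf_cons (E m).1 IH.
have -> : phi n (Zero : letters n) = 1%R by rewrite /= /nb_app /= eqxx /= ltnn.
by case: m {IH} => [|m] /=; rewrite ?eqxx.
Qed.

Lemma kn_op_n p m u :
  let c : col_crystal n := kncol n p m u in
  let t := [&& ~~ p n, ~~ u n & 0 < m] in
  [/\ eps n c = (2 * (u n && ~~ p n) + t)%:R%R, phi n c = (2 * (p n && ~~ u n) + t)%:R%R,
      te n c = (if u n && ~~ p n then Some (kncol n p m.+1 (fset1 u n false))
        else if t then Some (kncol n (fset1 p n true) m.-1 u) else None) &
      tf n c = (if p n && ~~ u n then Some (kncol n (fset1 p n false) m.+1 u)
        else if t then Some (kncol n p m.-1 (fset1 u n true)) else None)].
Proof.
move=> c t; set Pw : words n := map Pos (idx n p).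
set Zw : words n := nseq m Zero; set Bw : words n := rev (bars n u).
have JP : J_word n Pw by exact: J_poss.
have JZ : J_word n Zw by exact: J_zeros.
have JB : J_word n Bw by exact: J_rbars.
have JZB : J_word n (Zw ++ Bw) by exact: J_cat.
have [z1 z2 z3 z4] := zeros_n m; rewrite -/Zw in z1 z2 z3 z4.
have [b1 b2 b3 b4] := bar_word_n u; rewrite -/Bw in b1 b2 b3 b4.
have [p1 p2 p3 p4] := pos_word_n p; rewrite -/Pw in p1 p2 p3 p4.
have [c1 c2 c3 c4] := words_cat JZ JB Hn.
have [d1 d2 d3 d4] := words_cat JP JZB Hn.
have wZ := words_phi JZ Hn; have wB := words_phi JB Hn; have wP := words_phi JP Hn.
have wZB := words_phi JZB Hn.
change [/\ eps n (rev c : words n) = (2 * (u n && ~~ p n) + t)%:R%R,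
  phi n (rev c : words n) = (2 * (p n && ~~ u n) + t)%:R%R,
  omap rev (te n (rev c : words n)) = (if u n && ~~ p n then Some (kncol n p m.+1 (fset1 u n false))
        else if t then Some (kncol n (fset1 p n true) m.-1 u) else None) &
  omap rev (tf n (rev c : words n)) = (if p n && ~~ u n then Some (kncol n (fset1 p n false) m.+1 u)
        else if t then Some (kncol n p m.-1 (fset1 u n true)) else None)].
rewrite /c rev_kncol d1 d2 d3 d4.
have pZ : pairing (wt Zw) n = 0%R by lia.
rewrite c1 c2 pZ b1 b2 z1 z2 in wZB; rewrite c1 c2 c3 c4 pZ b1 b2 z1 z2 p1 p2 p3 p4 z3 z4 b3 b4.
rewrite p1 p2 in wP; rewrite b1 b2 in wB; move: wP wB wZB.
move: (pairing _ _) (pairing _ _) (pairing _ _) => x1 x2 x3 wP wB wZB.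
have bars1 : u n = false -> rev (bars n (fset1 u n true)) = Bar n :: rev (bars n u).
  by move=> un; rewrite /bars idx_fset1_n idx_last un cats0 map_cat rev_cat.
have nz (B : seq letter) : nseq m Zero ++ Zero :: B = nseq m.+1 Zero ++ B.
  by elim: (m) => //= k ->.
have idx1 : p n = false -> map Pos (idx n (fset1 p n true)) = map Pos (idx n p) ++ [:: Pos n].
  by move=> pn; rewrite idx_fset1_n idx_last pn cats0 map_cat.
rewrite /t; case pn: (p n) p4 wP => p4 wP; case un: (u n) wB wZB => wB wZB; case: (posnP m) => m0;
  rewrite /= ?m0 /= in wP wB wZB *; split; try lia; rewrite -?rev_kncol //.
all: congr Some; rewrite -[RHS]revK rev_kncol; congr rev.
- by rewrite -catA /Zw m0.
- by rewrite -catA.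
- by rewrite /Zw m0.
- by rewrite nz.
- by rewrite idx1 // -catA.
- by rewrite bars1 // -catA.
Qed.
End ColumnOps.

Section Cells.
Variable T : skew.
Let ent (c : nat * nat) : option letter := entry T c.1 c.2.
Definition cell_letter (c : nat * nat) : letter := odflt Zero (ent c).

Definition cell_lt (c c' : nat * nat) : bool :=
  (c'.1 < c.1) || (c.1 == c'.1) && (c.2 < c'.2).

Lemma cell_lt_trans : transitive cell_lt.
Proof. by move=> [a1 a2] [b1 b2] [c1 c2]; rewrite /cell_lt /=; lia. Qed.

Lemma cell_lt_irr : irreflexive cell_lt.
Proof. by move=> [a1 a2]; rewrite /cell_lt /=; lia. Qed.

Lemma grid_sorted (N m : nat) :
  sorted cell_lt [seq (i, j) | i <- rev (iota 1 N), j <- iota 1 m].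
Proof.
rewrite sorted_pairwise; last exact: cell_lt_trans.
elim: N => [|N IH] //.
have -> : rev (iota 1 N.+1) = N.+1 :: rev (iota 1 N).
  by rewrite -{1}[N.+1]addn1 iotaD rev_cat add1n.
rewrite /= pairwise_cat IH andbT; apply/andP; split.
  apply/allrelP => x y /mapP[j _ ->] /allpairsP[[a b] /= [+ _ ->]].
  by rewrite mem_rev mem_iota /cell_lt /=; lia.
rewrite pairwise_map -sorted_pairwise; last by move=> a b c; rewrite /cell_lt /=; lia.
by apply: (sub_sorted _ (iota_ltn_sorted 1 m)) => a b /=; rewrite /cell_lt /=; lia.
Qed.

Lemma cells_sorted : sorted cell_lt (cells T).
Proof. by apply: sorted_filter; [exact: cell_lt_trans|exact: grid_sorted]. Qed.

Lemma cells_uniq : uniq (cells T).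
Proof. exact: sorted_uniq cell_lt_trans cell_lt_irr _ cells_sorted. Qed.

Lemma level_bound j c : nth (0, [::]) T j = c -> j < size T ->
  c.1 + size c.2 <= foldr maxn 0 [seq c.1 + size c.2 | c <- T].
Proof.
elim: T j => [|c0 T' IH] [|j] //= H jT; first by rewrite H; lia.
by have := IH j H jT; lia.
Qed.

Lemma entry_some i j x : entry T i j = Some x -> 
  [/\ 1 <= j <= size T, (nth (0, [::]) T j.-1).1 < i &
      i <= (nth (0, [::]) T j.-1).1 + size (nth (0, [::]) T j.-1).2].
Proof.
rewrite /entry; case: j => // j; case: ifP => // H E; have Hs := onth_size E.
split=> //=; last by lia.
by rewrite ltnNge; apply/negP => jT; move: Hs; rewrite nth_default.
Qed.

Lemma mem_cells c : (c \in cells T) = isSome (ent c).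
Proof.
rewrite mem_filter; case: c => i j; rewrite /ent /=; case E: (entry T i j) => [x|] //=.
have [H1 H2 H3] := entry_some E; apply/allpairsP; exists (i, j); split=> //=.
  rewrite mem_rev mem_iota; have := @level_bound j.-1 _ erefl; lia.
by rewrite mem_iota; lia.
Qed.

Lemma word_cells : word T = map cell_letter (cells T).
Proof.
rewrite /word; have : all (fun c => c \in cells T) (cells T) by apply/allP.
elim: {2 3 4}(cells T) => //= c s IH /andP[+ /IH ->].
by rewrite mem_cells /cell_letter /ent; case: entry.
Qed.

Lemma refill_cells (g : nat * nat -> letter) : refill T (map g (cells T)) =
  [seq (let c := nth (0, [::]) T j.-1 in
        (c.1, [seq g (i, j) | i <- iota c.1.+1 (size c.2)])) | j <- iota 1 (size T)].
Proof.
apply/eq_in_map => j; rewrite mem_iota => Hj /=; congr (_, _).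
apply/eq_in_map => i; rewrite mem_iota => Hi.
have Hin : (i, j) \in cells T.
  rewrite mem_cells /ent /entry; case: j Hj Hi => // j Hj /= Hi.
  have -> : (nth (0, [::]) T j).1 < i by lia.
  have [|x ->] := @onth_some _ (nth (0, [::]) T j).2 (i - (nth (0, [::]) T j).1).-1 => //.
  by lia.
by rewrite (nth_map (0, 0)) ?index_mem // nth_index.
Qed.
End Cells.

Lemma cells_col (c : col) : cells (straight [:: c]) = [seq (i, 1) | i <- rev (iota 1 (size c))].
Proof.
apply: (irr_sorted_eq cell_lt_trans cell_lt_irr (cells_sorted _)).
  rewrite sorted_map; have : sorted gtn (rev (iota 1 (size c))).
    by rewrite rev_sorted; exact: iota_ltn_sorted.
  by apply: sub_sorted => a b /=; rewrite /cell_lt /=; lia.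
move=> [i j]; rewrite mem_cells /=; apply/idP/mapP => [|[k + [-> ->]]].
  case E: entry => [x|] // _; have [/= H1 H2 H3] := entry_some E.
  have Ej : j = 1 by lia.
  by exists i; rewrite ?Ej // mem_rev mem_iota; move: H2 H3; rewrite Ej /=; lia.
rewrite mem_rev mem_iota /entry /= => Hk; rewrite ifT; last by lia.
by have [|x ->] := @onth_some _ c (k - 0).-1; first lia.
Qed.

Lemma col_wordE n (c : col) : col_word n c = rev c.
Proof.
rewrite /col_word word_cells cells_col -map_comp map_rev; congr rev.
apply: (@eq_from_nth _ Zero); rewrite size_map size_iota // => i Hi.
rewrite (nth_map 0) ?size_iota // nth_iota // /cell_letter /= /entry /=.
by rewrite onthE (nth_map Zero).
Qed.

Lemma col_refillE (c : col) w : size w = size c -> col_refill c w = rev w.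
Proof.
move=> sz; rewrite /col_refill /refill /= cells_col.
apply: (@eq_from_nth _ Zero); rewrite size_map size_iota ?size_rev // => i Hi.
rewrite (nth_map 0) ?size_iota // nth_iota // nth_rev ?sz //.
congr nth; have inj : injective (fun i : nat => (i, 1)) by move=> a b [].
have E : nth 0 (rev (iota 1 (size c))) (size c - i.+1) = 1 + i.
  by rewrite nth_rev ?size_iota ?nth_iota; lia.
by rewrite index_map // -E index_uniq ?rev_uniq ?iota_uniq // size_rev size_iota; lia.
Qed.

Section Tsp.
Variable n : nat.
Hypothesis n2 : 1 < n.

Lemma bars_gset_n b f : bars n (gset n b f) = bars n (fset1 f n b).
Proof.
by apply: eq_bars => k Hk; rewrite /gset /fset1; case: eqP => // _; case: eqP => //; lia.
Qed.

Lemma size_bars_gset i b f : 1 <= i < n -> f i = ~~ b -> f i.+1 = b ->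
  size (bars n (gset i b f)) = size (bars n f).
Proof. by move=> Hi f1 f2; rewrite /bars (idx_gset Hi f1 f2) !size_map. Qed.

Lemma Tsp_op i f : 1 <= i <= n -> let c : T_sp_crystal n := bars n f in
  [/\ eps i c = (geps n i f)%:R%R, phi i c = (gphi n i f)%:R%R,
      te i c = (if geps n i f then Some (bars n (gset i false f)) else None) &
      tf i c = (if gphi n i f then Some (bars n (gset i true f)) else None)].
Proof.
move=> Hi; cbv zeta; rewrite /=; case: (ltnP i n) => iln.
  have Hi' : 1 <= i < n by lia.
  have [E1 E2 E3 E4] := bar_word n2 Hi' f; rewrite -col_wordE in E1 E2 E3 E4.
  split; [exact: E1|exact: E2| |].
    rewrite [X in omap _ X]E3; case: ifP => //= /andP[fi fj]; rewrite iln /= in fj.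
    by rewrite col_refillE ?revK // size_rev size_bars_gset // ?fi // (negbTE fj).
  rewrite [X in omap _ X]E4; case: ifP => //= /andP[fi fj]; rewrite iln /= in fj.
  by rewrite col_refillE ?revK // size_rev size_bars_gset // ?(negbTE fi) // fj.
have Ei : i = n by lia.
subst i; rewrite /geps /gphi ltnn /= !andbT.
have okE : forall g, col_ok (rcons (bars n g) (Bar n)) = ~~ g n.
  move=> g; case gn: (g n) => /=.
    apply/negP; rewrite /col_ok sorted_pairwise; last exact: above_trans.
    rewrite -cats1 pairwise_cat => /andP[/allrelP H _].
    have /H : Bar n \in bars n g by rewrite mem_bars gn; lia.
    by move/(_ (Bar n) (mem_head _ _)); rewrite aboveE ltnn.
  have -> : rcons (bars n g) (Bar n) = bars n (fset1 g n true).
    by rewrite /bars idx_fset1_n // idx_last // gn cats0 map_cat cats1.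
  by rewrite col_ok_bars.
have lastE : forall g, (last Zero (bars n g) == Bar n) = g n.
  move=> g; rewrite /bars idx_last // map_cat last_cat; case gn: (g n) => //=; first by rewrite eqxx.
  apply/negP => /eqP E; have : Bar n \in Zero :: map Bar (idx n.-1 g) by rewrite -E mem_last.
  by rewrite inE => /orP[] // /mapP[k + [Ek]]; rewrite mem_idx -Ek; lia.
have beE g : box_e n (bars n g) = if g n then Some (bars n (fset1 g n false)) else None.
  rewrite /box_e lastE; case gn: (g n) => //; congr Some.
  rewrite /bars idx_fset1_n // idx_last // gn cats0 map_cat /=.
  by rewrite size_cat addn1 take_size_cat.
have bfE g : box_f n (bars n g) = if ~~ g n then Some (bars n (fset1 g n true)) else None.
  rewrite /box_f okE; case gn: (g n) => //=; congr Some.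
  by rewrite /bars idx_fset1_n // idx_last // gn cats0 map_cat cats1.
rewrite /nb_app !beE !bfE !bars_gset_n; split=> //.
  by case: (f n) => //; rewrite beE /fset1 eqxx.
by case: (f n) => //=; rewrite bfE /fset1 eqxx.
Qed.
End Tsp.

Section Tb.
Variables (n a : nat) (L R : nat -> bool).
Hypothesis n2 : 1 < n.
Hypothesis LR : forall k, k <= n -> cnt L k <= cnt R k + a.
Let T : spinor := (a, (bars n L, bars n R)).
Let S := T_b_skew T.

Lemma entry_S i j x : entry S i j = Some x <-> exists2 k,
  1 <= k <= n & x = Bar k /\
   ((j = 1) /\ R k /\ i = a + cnt R k \/ (j = 2) /\ L k /\ i = cnt L k).
Proof.
rewrite /S /T_b_skew /= entry_two_col; split.
  case: j => [|[|[|j]]] //; case: ifP => // H /onth_bars; case: x => // k [Hk fk ck].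
    by exists k => //; split=> //; left; split=> //; split=> //; lia.
  by exists k => //; split=> //; right; split=> //; split=> //; lia.
case=> k Hk [-> [[-> [fk ->]]|[-> [fk ->]]]].
  have ck := @cntP R k; rewrite fk in ck.
  rewrite ifT; last by lia.
  by apply/onth_bars; split=> //; lia.
have ck := @cntP L k; rewrite fk in ck.
rewrite ifT; last by lia.
by apply/onth_bars; split=> //; lia.
Qed.

Definition rcell k : nat * nat := (a + cnt R k, 1).
Definition lcell k : nat * nat := (cnt L k, 2).

Lemma rcellE k : 1 <= k <= n -> R k -> cell_letter S (rcell k) = Bar k.
Proof.
move=> Hk fk; rewrite /cell_letter; have -> // : entry S (rcell k).1 (rcell k).2 = Some (Bar k).
by apply/entry_S; exists k => //; split=> //; left.
Qed.

Lemma lcellE k : 1 <= k <= n -> L k -> cell_letter S (lcell k) = Bar k.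
Proof.
move=> Hk fk; rewrite /cell_letter; have -> // : entry S (lcell k).1 (lcell k).2 = Some (Bar k).
by apply/entry_S; exists k => //; split=> //; right.
Qed.

Lemma J_Tb : J_word n (map (cell_letter S) (cells S)).
Proof.
apply: J_word_map => c; rewrite mem_cells /cell_letter.
case E: entry => [x|] // _; have /entry_S [k Hk [-> _]] := E.
by rewrite /in_J /= Hk.
Qed.

Lemma iota_shift d m : iota d.+1 m = map (addn d) (iota 1 m).
Proof. by rewrite -(addn1 d) iotaDl. Qed.

Lemma map_iota_cnt (f : nat -> bool) (g : nat -> letter) :
  [seq g i | i <- iota 1 (cnt f n)] = [seq g (cnt f k) | k <- idx n f].
Proof.
have -> : iota 1 (cnt f n) = map (cnt f) (idx n f).
  apply: (@eq_from_nth _ 0); rewrite ?size_map ?size_idx ?size_iota // => i Hi.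
  rewrite nth_iota // (nth_map 0) ?size_idx //.
  have : onth (idx n f) i = Some (nth 0 (idx n f) i) by rewrite onthE (nth_map 0) ?size_idx.
  by case/onth_idx => _ _ ->.
by rewrite -map_comp.
Qed.

Lemma T_b_refillE g : T_b_refill T (map g (cells S)) =
  (a, ([seq g (lcell k) | k <- idx n L], [seq g (rcell k) | k <- idx n R])).
Proof.
rewrite /T_b_refill -/S refill_cells /= !size_bars; congr (_, (_, _)).
  by rewrite (map_iota_cnt L (fun i => g (i, 2))).
rewrite iota_shift -map_comp (map_iota_cnt R (fun i => g (a + i, 1))) //.
Qed.

Section Lt.
Variable i : nat.
Hypothesis Hi : 1 <= i < n.

Let E : seq (nat * nat) :=
  (if R i.+1 then [:: rcell i.+1] else [::]) ++ (if R i then [:: rcell i] else [::]) ++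
  (if L i.+1 then [:: lcell i.+1] else [::]) ++ (if L i then [:: lcell i] else [::]).
Let E4 : seq (nat * nat) := [:: rcell i.+1; lcell i.+1; rcell i; lcell i].

Let relc := relv n i (cell_letter S).

Lemma mem_relc c : (c \in filter relc (cells S)) = (c \in E).
Proof.
have iln : i < n by lia.
have Hi' : 1 <= i <= n by lia.
rewrite mem_filter mem_cells /relc /relv; apply/andP/idP.
  move=> [+ +]; rewrite /cell_letter; case Ee: entry => [x|] //=.
  have /entry_S [k Hk [-> H]] := Ee; rewrite sg_bar // => Hr _.
  have {Hr} Hk' : k = i \/ k = i.+1.
    case: (eqVneq k i) Hr => [|_]; first by left.
    by case: (eqVneq k i.+1) => // Ek _; right.
  case: c H {Ee} => c1 c2 /= H.
  case: H => [[-> [fk ->]]|[-> [fk ->]]]; rewrite /E !mem_cat /rcell /lcell;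
    by case: Hk' fk => -> ->; rewrite ?inE ?eqxx ?orbT.
have H (F : nat -> bool) (cl : nat -> nat * nat) k : (k = i \/ k = i.+1) ->
   (1 <= k <= n -> F k -> cell_letter S (cl k) = Bar k) ->
   (1 <= k <= n -> F k -> exists x, entry S (cl k).1 (cl k).2 = Some x) ->
   c \in (if F k then [:: cl k] else [::]) ->
   sg n i (cell_letter S c) != (0, 0) /\ isSome (entry S c.1 c.2).
  move=> Hk H1 H2; case: ifP => // fk; rewrite inE => /eqP ->.
  have Hk1 : 1 <= k <= n by lia.
  rewrite H1 // sg_bar //; have [x ->] := H2 Hk1 fk; split=> //.
  by rewrite xpair_eqE; case: Hk => ->; rewrite eqxx ?andbF.
have rs k : 1 <= k <= n -> R k -> exists x, entry S (rcell k).1 (rcell k).2 = Some x.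
  by move=> Hk fk; exists (Bar k); apply/entry_S; exists k => //; split=> //; left.
have ls k : 1 <= k <= n -> L k -> exists x, entry S (lcell k).1 (lcell k).2 = Some x.
  by move=> Hk fk; exists (Bar k); apply/entry_S; exists k => //; split=> //; right.
rewrite /E !mem_cat => /or4P[].
- by apply: H; [right|exact: rcellE|exact: rs].
- by apply: H; [left|exact: rcellE|exact: rs].
- by apply: H; [right|exact: lcellE|exact: ls].
- by apply: H; [left|exact: lcellE|exact: ls].
Qed.

Lemma filter_relc : filter relc (cells S) = E \/
  [/\ filter relc (cells S) = E4, R i.+1, R i, L i.+1 & L i].
Proof.
have srt : sorted cell_lt (filter relc (cells S)).
  by apply: sorted_filter (cells_sorted _); exact: cell_lt_trans.
have H0 := LR (_ : i.-1 <= n); have H1 := LR (_ : i <= n); have H2 := LR (_ : i.+1 <= n).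
have {}H0 := H0 ltac:(lia); have {}H1 := H1 ltac:(lia); have {}H2 := H2 ltac:(lia).
have cR1 := @cntP R i ltac:(lia); have cL1 := @cntP L i ltac:(lia).
have cR2 := cntS R i; have cL2 := cntS L i.
case: (boolP (sorted cell_lt E)) => sE.
  by left; apply: (irr_sorted_eq cell_lt_trans cell_lt_irr srt sE); exact: mem_relc.
have [r1 r0 l1 l0] : [/\ R i.+1, R i, L i.+1 & L i].
  apply/and4P; apply: contraR sE; rewrite /E /rcell /lcell.
  by case: (R i.+1) cR2 => cR2; case: (R i) cR1 => cR1; case: (L i.+1) cL2 => cL2;
    case: (L i) cL1 => cL1 H; rewrite /= /cell_lt /= in cR1 cR2 cL1 cL2 H *; lia.
right; split=> //; apply: (irr_sorted_eq cell_lt_trans cell_lt_irr srt).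
  move: sE; rewrite /E /E4 r1 r0 l1 l0 /rcell /lcell /= /cell_lt /= => sE.
  by move: cR1 cR2 cL1 cL2; rewrite r1 r0 l1 l0 /=; lia.
move=> c; rewrite mem_relc /E /E4 r1 r0 l1 l0 /= !inE.
by do 4![case: (c == _)].
Qed.

Lemma Tb_word_lt :
  [/\ eps i (T_b_word n T) = (beps n i R L)%:R%R, phi i (T_b_word n T) = (bphi n i R L)%:R%R,
      omap (T_b_refill T) (te i (T_b_word n T)) = (if e_left n i R L then Some (a, (bars n L, bars n (gset i false R)))
        else if e_right n i R L then Some (a, (bars n (gset i false L), bars n R)) else None) &
      omap (T_b_refill T) (tf i (T_b_word n T)) =
        (if f_left n i R L then Some (a, (bars n L, bars n (gset i true R)))
        else if f_right n i R L then Some (a, (bars n (gset i true L), bars n R)) else None)].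
Proof.
have iln : i < n by lia.
have Hi' : 1 <= i <= n by lia.
have Hj : 1 <= i.+1 <= n by lia.
have wE : T_b_word n T = map (cell_letter S) (cells S) by exact: word_cells.
rewrite wE.
have [E1 E2] := words_sg n2 Hi' J_Tb.
have E3 := te_cells n2 Hi' (cells_uniq S) J_Tb; have E4' := tf_cells n2 Hi' (cells_uniq S) J_Tb.
rewrite -map_comp -(seps_filter n i (cell_letter S)) in E1.
rewrite -map_comp -(sphi_filter n i (cell_letter S)) in E2.
rewrite -(etgt_filter n i (cell_letter S)) in E3.
rewrite -(ftgt_filter n i (cell_letter S)) in E4'.
have ji : (i.+1 == i) = false by lia.
have ij : (i == i.+1) = false by lia.
have S1 : sg n i (Bar i) = (1, 0) by rewrite sg_bar // eqxx ij.
have S2 : sg n i (Bar i.+1) = (0, 1) by rewrite sg_bar // eqxx ji.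
have updR b x : R i = ~~ b -> R i.+1 = b -> x = Bar (if b then i else i.+1) ->
   T_b_refill T (map (upd1 (cell_letter S) (rcell (if b then i.+1 else i)) x) (cells S)) =
   (a, (bars n L, bars n (gset i b R))).
  move=> r0 r1 ->; rewrite T_b_refillE; congr (_, (_, _)).
    apply/eq_in_map => k; rewrite mem_idx => /andP[Hk fk].
    by rewrite /upd1 /lcell /rcell xpair_eqE andbF -/(lcell k) lcellE.
  rewrite /bars (idx_gset Hi r0 r1) -map_comp; apply/eq_in_map => k.
  rewrite mem_idx => /andP[Hk fk]; rewrite /upd1 /rcell xpair_eqE eqn_add2l andbT /=.
  set y := if b then i.+1 else i.
  have Ry : R y by rewrite /y; case: (b) r0 r1.
  have -> : (cnt R k == cnt R y) = (k == y).
    case: (ltngtP k y) => H; try by rewrite H eqxx.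
      by have := cnt_lt H Ry; case: eqP => //; lia.
    by have := cnt_lt H fk; case: eqP => //; lia.
  by case: (k == y) => //; rewrite -/(rcell k) rcellE.
have updL b x : L i = ~~ b -> L i.+1 = b -> x = Bar (if b then i else i.+1) ->
   T_b_refill T (map (upd1 (cell_letter S) (lcell (if b then i.+1 else i)) x) (cells S)) =
   (a, (bars n (gset i b L), bars n R)).
  move=> r0 r1 ->; rewrite T_b_refillE; congr (_, (_, _)); last first.
    apply/eq_in_map => k; rewrite mem_idx => /andP[Hk fk].
    by rewrite /upd1 /lcell /rcell xpair_eqE andbF -/(rcell k) rcellE.
  rewrite /bars (idx_gset Hi r0 r1) -map_comp; apply/eq_in_map => k.
  rewrite mem_idx => /andP[Hk fk]; rewrite /upd1 /lcell xpair_eqE andbT /=.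
  set y := if b then i.+1 else i.
  have Ly : L y by rewrite /y; case: (b) r0 r1.
  have -> : (cnt L k == cnt L y) = (k == y).
    case: (ltngtP k y) => H; try by rewrite H eqxx.
      by have := cnt_lt H Ly; case: eqP => //; lia.
    by have := cnt_lt H fk; case: eqP => //; lia.
  by case: (k == y) => //; rewrite -/(lcell k) lcellE.
have fB : letter_f n i (Bar i.+1) = Some (Bar i) by rewrite /= iln eqxx.
have eB : letter_e n i (Bar i) = Some (Bar i.+1) by rewrite /= iln eqxx.
have cl1 : R i -> cell_letter S (rcell i) = Bar i by exact: rcellE.
have cl2 : R i.+1 -> cell_letter S (rcell i.+1) = Bar i.+1 by exact: rcellE.
have cl3 : L i -> cell_letter S (lcell i) = Bar i by exact: lcellE.
have cl4 : L i.+1 -> cell_letter S (lcell i.+1) = Bar i.+1 by exact: lcellE.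
have [uR1 uR0] := (updR true, updR false).
have [uL1 uL0] := (updL true, updL false).
rewrite E1 E2 E3 E4' /beps /bphi /e_left /e_right /f_left /f_right /geps /gphi iln /=.
case: filter_relc => [->|[-> r1 r0 l1 l0]]; last first.
  rewrite /E4 r1 r0 l1 l0 /= cl1 // cl2 // cl3 // cl4 //.
  by rewrite ?S1 ?S2 /= ?S1 ?S2 /= ?S1 ?S2.
rewrite /E.
case r1: (R i.+1) cl2 uR1 uR0 => cl2 uR1 uR0; case r0: (R i) cl1 uR1 uR0 => cl1 uR1 uR0;
case l1: (L i.+1) cl4 uL1 uL0 => cl4 uL1 uL0; case l0: (L i) cl3 uL1 uL0 => cl3 uL1 uL0;
 rewrite /= ?(cl1 isT) ?(cl2 isT) ?(cl3 isT) ?(cl4 isT) ?S1 ?S2 /=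
   ?(cl1 isT) ?(cl2 isT) ?(cl3 isT) ?(cl4 isT) ?S1 ?S2 /=
   ?(cl1 isT) ?(cl2 isT) ?(cl3 isT) ?(cl4 isT) ?S1 ?S2 /=
   ?(cl1 isT) ?(cl2 isT) ?(cl3 isT) ?(cl4 isT) ?S1 ?S2 /=;
 split=> //; try (rewrite ?(cl1 isT) ?(cl2 isT) ?(cl3 isT) ?(cl4 isT) ?fB ?eB /=).
all: rewrite ?iln ?eqxx /=; congr Some.
all: first [exact: uR1 | exact: uR0 | exact: uL1 | exact: uL0].
Qed.

Lemma Tb_op_lt : let c : T_b_crystal n := T in
  [/\ eps i c = (beps n i R L)%:R%R, phi i c = (bphi n i R L)%:R%R,
      te i c = (if e_left n i R L then Some (a, (bars n L, bars n (gset i false R)))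
        else if e_right n i R L then Some (a, (bars n (gset i false L), bars n R)) else None) &
      tf i c = (if f_left n i R L then Some (a, (bars n L, bars n (gset i true R)))
        else if f_right n i R L then Some (a, (bars n (gset i true L), bars n R)) else None)].
Proof.
have [w1 w2 w3 w4] := Tb_word_lt; have iln : i < n by lia.
by cbv zeta; split; rewrite /= iln; [exact: w1|exact: w2|exact: w3|exact: w4].
Qed.
End Lt.

End Tb.

Section Tb_op.
Variables (n a : nat) (L R : nat -> bool).
Hypothesis n2 : 1 < n.
Hypothesis LR : forall k, k <= n -> cnt L k <= cnt R k + a.

Lemma Tb_op i : 1 <= i <= n -> let c : T_b_crystal n := (a, (bars n L, bars n R)) in
  [/\ eps i c = (beps n i R L)%:R%R, phi i c = (bphi n i R L)%:R%R,
      te i c = (if e_left n i R L then Some (a, (bars n L, bars n (gset i false R)))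
        else if e_right n i R L then Some (a, (bars n (gset i false L), bars n R)) else None) &
      tf i c = (if f_left n i R L then Some (a, (bars n L, bars n (gset i true R)))
        else if f_right n i R L then Some (a, (bars n (gset i true L), bars n R)) else None)].
Proof.
move=> Hi; case: (ltnP i n) => iln.
  by apply: (Tb_op_lt n2 LR); lia.
have Ei : i = n by lia.
subst i; have [R1 R2 R3 R4] := Tsp_op n2 R Hi; have [L1 L2 L3 L4] := Tsp_op n2 L Hi.
have pw (f : nat -> bool) : ((gphi n n f)%:R = (geps n n f)%:R +
    pairing (wt (bars n f : T_sp_crystal n)) n :> int)%R.
  rewrite /pairing ltnn /= coord2_mk ?leqnn ?andbT; last by lia.
  rewrite col_ok_count ?col_ok_bars // mem_bars leqnn (ltnW n2) /=.
  by rewrite /gphi /geps ltnn /= !andbT; case: (f n).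
have [t1 t2 t3 t4] := tens_bits (erefl (geps n n R)%:R%R) (erefl (gphi n n R)%:R%R)
   (erefl (geps n n L)%:R%R) (erefl (gphi n n L)%:R%R) (pw R) (pw L).
cbv zeta; split.
- rewrite /= ltnn -t1 -R1 -L1 //.
- rewrite /= ltnn -t2 -R2 -L2 //.
- rewrite /= ltnn -(@tens_te_bits n n _ _ _ R L (fun x => (a, (bars n L, x))) (fun x => (a, (x, bars n R)))).
  change (omap (T_b_untens a) (if (eps n (bars n L : T_sp_crystal n) <= phi n (bars n R : T_sp_crystal n))%R
     then omap (fun x => (x, bars n L)) (te n (bars n R : T_sp_crystal n))
     else omap (fun y => (bars n R, y)) (te n (bars n L : T_sp_crystal n))) =
    (if ~~ geps n n L || gphi n n R
   then omap (fun x => (a, (bars n L, x))) (if geps n n R then Some (bars n (gset n false R)) else None)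
   else omap (fun x => (a, (x, bars n R))) (if geps n n L then Some (bars n (gset n false L)) else None))).
  rewrite L1 R2 t3 R3 L3; case: ifP => _; by case: ifP.
- rewrite /= ltnn -(@tens_tf_bits n n _ _ _ R L (fun x => (a, (bars n L, x))) (fun x => (a, (x, bars n R)))).
  change (omap (T_b_untens a) (if (eps n (bars n L : T_sp_crystal n) < phi n (bars n R : T_sp_crystal n))%R
     then omap (fun x => (x, bars n L)) (tf n (bars n R : T_sp_crystal n))
     else omap (fun y => (bars n R, y)) (tf n (bars n L : T_sp_crystal n))) =
    (if gphi n n R && ~~ geps n n L
   then omap (fun x => (a, (bars n L, x))) (if gphi n n R then Some (bars n (gset n true R)) else None)
   else omap (fun x => (a, (x, bars n R))) (if gphi n n L then Some (bars n (gset n true L)) else None))).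
  rewrite L1 R2 t4 R4 L4; case: ifP => _; by case: ifP.
Qed.
End Tb_op.

Lemma cnt_gset n i b (X : nat -> bool) k : 1 <= i <= n -> k <= n ->
  (if b then gphi n i X else geps n i X) ->
  cnt (gset i b X) k + (k == i) * ~~ b = cnt X k + (k == i) * b.
Proof.
move=> Hi kn H.
have Xi : X i = ~~ b by case: b H => /andP[] //; case: (X i).
have Xj : i < n -> X i.+1 = b.
  by move=> iln; case: b H {Xi} => /andP[_]; rewrite iln //=; case: (X i.+1).
elim: k kn => [|k IH] kn; first by have -> : (0 == i) = false by lia.
have {}IH := IH (ltnW kn); rewrite !cntS {2}/gset.
case: (ltngtP k.+1 i) => Hk.
- have E : (k == i) = false by lia.
  by rewrite eqSS E; rewrite E in IH; lia.
- case: (eqVneq k i) IH => [E|ne] IH.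
    subst i; rewrite eqxx Xj; last by lia.
    by case: (b) IH => /=; lia.
  have -> : (k.+1 == i.+1) = false by lia.
  by lia.
- have E : (k == i) = false by lia.
  by rewrite E in IH; rewrite Hk Xi; case: (b) IH => /=; lia.
Qed.

Lemma nu_local n d (U V U' V' : nat -> bool) i : 1 <= i <= n ->
  (forall k, k <= n -> k != i -> cnt U' k = cnt U k /\ cnt V' k = cnt V k) ->
  minn (cnt V i.-1 - cnt U i.-1) (nu n d U' V' i) =
  minn (cnt V i.-1 - cnt U i.-1) (nu n d U V i) ->
  forall k, k <= n.+1 -> k != i -> nu n d U' V' k = nu n d U V k.
Proof.
move=> Hi same Hm k /subnK; move: (n.+1 - k) => j; elim: j k => [|j IH] k Ej ki.
  by rewrite add0n in Ej; rewrite Ej !nu_end.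
have kn : k <= n by lia.
have [s1 s2] := same k kn ki; rewrite !(nuS _ _ _ kn) s1 s2.
case: (eqVneq k.+1 i) => [E|ne]; last by rewrite IH //; lia.
by rewrite E; move: Hm; rewrite -E.
Qed.

Lemma local_lt (s np n0 nm : nat) (u0 u1 v0 v1 l0 l1 r0 r1 : bool) :
  u0 <= s + v0 -> u0 + u1 <= s + v0 + v1 ->
  np <= s + v0 + v1 - (u0 + u1) ->
  n0 = minn (s + v0 - u0) np -> nm = minn s n0 ->
  u0 + n0 = nm + l0 -> u1 + np = n0 + l1 -> v0 + nm = n0 + r0 -> v1 + n0 = np + r1 ->
  let ph x0 x1 := ~~ x0 && x1 in let ep x0 x1 := x0 && ~~ x1 in
  let f1 x0 x1 y0 y1 := ph x0 x1 && ~~ ep y0 y1 in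
  let f2 x0 x1 y0 y1 := ph y0 y1 && ~~ ph x0 x1 in
  let e1 x0 x1 y0 y1 := ep x0 x1 && ~~ ep y0 y1 in
  let e2 x0 x1 y0 y1 := ep y0 y1 && ~~ ph x0 x1 in
  [/\ ph u0 u1 + f1 v0 v1 u0 u1 = ph l0 l1 + f1 r0 r1 l0 l1,
      ep v0 v1 + e2 v0 v1 u0 u1 = ep r0 r1 + e2 r0 r1 l0 l1,
      f1 v0 v1 u0 u1 || f2 v0 v1 u0 u1 = f1 r0 r1 l0 l1 || f2 r0 r1 l0 l1 /\
      e1 v0 v1 u0 u1 || e2 v0 v1 u0 u1 = e1 r0 r1 l0 l1 || e2 r0 r1 l0 l1,
      f1 v0 v1 u0 u1 || f2 v0 v1 u0 u1 ->
        let x := f1 v0 v1 u0 u1 in let y := f1 r0 r1 l0 l1 in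
        let n0' := minn (s + v0 + x - (u0 + ~~ x)) np in
        [/\ u0 + ~~ x <= s + v0 + x, ~~ x + n0' = n0 + ~~ y, x + n0 = n0' + y &
            minn s n0' = minn s n0] &
      e1 v0 v1 u0 u1 || e2 v0 v1 u0 u1 ->
        let x := e1 v0 v1 u0 u1 in let y := e1 r0 r1 l0 l1 in
        let n0' := minn (s + v0 - x - (u0 - ~~ x)) np in
        [/\ u0 - ~~ x <= s + v0 - x, n0' + ~~ y = n0 + ~~ x, n0' + x = n0 + y &
            minn s n0' = minn s n0]].
Proof.
move=> h2 h3 h4 h5 h6 h7 h8 h9 h10 /=.
case: u0 h2 h3 h4 h5 h7 => /= h2 h3 h4 h5 h7; case: u1 h3 h4 h8 => /= h3 h4 h8;
case: v0 h2 h3 h4 h5 h9 => /= h2 h3 h4 h5 h9; case: v1 h3 h4 h10 => /= h3 h4 h10;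
case: l0 h7 => /= h7; try (exfalso; lia);
case: l1 h8 => /= h8; try (exfalso; lia);
case: r0 h9 => /= h9; try (exfalso; lia);
case: r1 h10 => /= h10; try (exfalso; lia);
by split=> //; try (move=> _; split); lia.
Qed.

Section Core.
Variables (n d : nat).
Hypothesis n2 : 1 < n.

(* V is the complement of the set of letters k in [n]; the first clause is
   (b-1), and the second says that the height is n - d. *)
Definition kn_state (V : nat -> bool) m (U : nat -> bool) : Prop :=
  (forall k, k <= n -> cnt U k <= cnt V k) /\ cnt V n = cnt U n + d + m.

Definition kcol (V : nat -> bool) m (U : nat -> bool) : col_crystal n :=
  kncol n (fun k => ~~ V k) m U.

Notation L U V := (lbit n d U V).
Notation R U V := (rbit n d U V).

Lemma nu_gt (U V U' V' : nat -> bool) i :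
  (forall k, k <= n -> k != i -> cnt U' k = cnt U k /\ cnt V' k = cnt V k) ->
  forall k, i < k <= n.+1 -> nu n d U' V' k = nu n d U V k.
Proof.
move=> same k /andP[ik /subnK]; move: (n.+1 - k) => j; elim: j k ik => [|j IH] k ik Ej.
  by rewrite add0n in Ej; rewrite Ej !nu_end.
have kn : k <= n by lia.
have [|s1 s2] := same k kn; first by lia.
by rewrite !(nuS _ _ _ kn) s1 s2 IH //; lia.
Qed.

(* State after an operator acted at i, changing V if x and U otherwise, and
   changing R if y and L otherwise; s = true for f and s = false for e. *)
Definition step (s : bool) (k i a b t : nat) : Prop :=
  if s then b = a + (k == i) * t else a = b + (k == i) * t.

Definition moved (s : bool) i (x y : bool) (V U V' U' : nat -> bool) : Prop :=
  forall k, k <= n ->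
  [/\ step s k i (cnt U k) (cnt U' k) (~~ x), step s k i (cnt V k) (cnt V' k) x,
      step s k i (cnt (L U V) k) (cnt (L U' V') k) (~~ y) &
      step s k i (cnt (R U V) k) (cnt (R U' V') k) y].

Lemma moved_core s i (x y : bool) V U V' U' m m' : 1 <= i <= n -> kn_state V m U ->
  (forall k, k <= n -> step s k i (cnt U k) (cnt U' k) (~~ x) /\
                       step s k i (cnt V k) (cnt V' k) x) ->
  cnt U' i <= cnt V' i -> cnt V' n = cnt U' n + d + m' ->
  let n0 := nu n d U V i in let n0' := minn (cnt V' i - cnt U' i) (nu n d U V i.+1) in
  minn (cnt V i.-1 - cnt U i.-1) n0' = minn (cnt V i.-1 - cnt U i.-1) n0 ->
  (if s then ~~ x + n0' = n0 + ~~ y /\ x + n0 = n0' + y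
   else n0' + ~~ y = n0 + ~~ x /\ n0' + x = n0 + y) ->
  kn_state V' m' U' /\ moved s i x y V U V' U'.
Proof.
move=> Hi [UV Sn] ch Hii Sn' n0 n0' Hm Hy.
have same k : k <= n -> k != i -> cnt U' k = cnt U k /\ cnt V' k = cnt V k.
  move=> kn /negbTE ki; have [] := ch k kn; rewrite /step ki.
  by case: (s); rewrite !mul0n !addn0.
have UV' k : k <= n -> cnt U' k <= cnt V' k.
  by move=> kn; case: (eqVneq k i) => [->//|ki]; have [-> ->] := same k kn ki; exact: UV.
have i_n : i <= n by lia.
have nui : nu n d U' V' i = n0'.
  by rewrite nuS // /n0'; congr minn; apply: nu_gt same _ _; lia.
have nuk k : k <= n -> k != i -> nu n d U' V' k = nu n d U V k.
  by move=> kn ki; apply: (nu_local Hi same) => //; [rewrite nui|lia].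
split=> // k kn; have [c1 c2] := ch k kn; split=> //.
  rewrite !cnt_lbit //; case: (eqVneq k i) => [Ek|ki]; last first.
    by have [-> _] := same k kn ki; rewrite nuk // /step (negbTE ki) mul0n !addn0; case: (s).
  subst k; rewrite nui -/n0; move: c1 Hy; rewrite /step eqxx !mul1n.
  by case: (s) => /= [-> []|-> []]; lia.
rewrite !cnt_rbit //; case: (eqVneq k i) => [Ek|ki]; last first.
  by have [_ ->] := same k kn ki; rewrite nuk // /step (negbTE ki) mul0n !addn0; case: (s).
subst k; rewrite nui -/n0; have := nu_le d U V kn; have := nu_le d U' V' kn; rewrite nui -/n0.
have := UV _ kn; have := UV' _ kn; move: c2 Hy; rewrite /step eqxx !mul1n.
by case: (s) => /= [-> []|-> []]; lia.
Qed.

Lemma step_gset_t i (X : nat -> bool) (t : bool) k : 1 <= i <= n -> k <= n ->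
  (t -> gphi n i X) ->
  step true k i (cnt X k) (cnt (if t then gset i true X else X) k) t.
Proof.
move=> Hi kn H; rewrite /step; case: t H => H; last by rewrite muln0 addn0.
by have := @cnt_gset n i true X k Hi kn (H isT); rewrite muln0 addn0.
Qed.

Lemma step_gset_f i (X : nat -> bool) (t : bool) k : 1 <= i <= n -> k <= n ->
  (t -> geps n i X) ->
  step false k i (cnt X k) (cnt (if t then gset i false X else X) k) t.
Proof.
move=> Hi kn H; rewrite /step; case: t H => H; last by rewrite muln0 addn0.
by have := @cnt_gset n i false X k Hi kn (H isT); rewrite muln0 addn0 => ->.
Qed.

Lemma core_lt i V m U : 1 <= i < n -> kn_state V m U ->
  let l := L U V in let r := R U V in
  [/\ beps n i V U = beps n i r l, bphi n i V U = bphi n i r l,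
    f_left n i V U || f_right n i V U = f_left n i r l || f_right n i r l /\
    e_left n i V U || e_right n i V U = e_left n i r l || e_right n i r l,
    f_left n i V U || f_right n i V U ->
      let V' := if f_left n i V U then gset i true V else V in
      let U' := if f_left n i V U then U else gset i true U in
      kn_state V' m U' /\ moved true i (f_left n i V U) (f_left n i r l) V U V' U' &
    e_left n i V U || e_right n i V U ->
      let V' := if e_left n i V U then gset i false V else V in
      let U' := if e_left n i V U then U else gset i false U in
      kn_state V' m U' /\ moved false i (e_left n i V U) (e_left n i r l) V U V' U'].
Proof.
move=> Hi St l r; have [UV Sn] := St; have Hi' : 1 <= i <= n by lia.
have iln : i < n by lia.
have i0 : 0 < i by lia.
have im : i.-1 <= n by lia.
have i_n : i <= n by lia.
have ni : (n == i) = false by lia.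
have cL := @cnt_lbit n d U V UV; have cR := @cnt_rbit n d U V UV.
have u0 := @cntP U i i0; have v0 := @cntP V i i0; have u1 := cntS U i; have v1 := cntS V i.
have l0 := @cntP l i i0; have r0 := @cntP r i i0; have l1 := cntS l i; have r1 := cntS r i.
rewrite /l !cL // in l0 l1; rewrite /r !cR // in r0 r1.
have N0 := @nuS n d U V i i_n; have Nm := @nuS n d U V i.-1 im; rewrite prednK // in Nm.
have Np := @nu_le n d U V i.+1 iln; have le0 := nu_le d U V i_n; have lem := nu_le d U V im.
have H0 := UV _ im; have H1 := UV _ i_n; have H2 := UV _ iln.
have P1 : U i <= cnt V i.-1 - cnt U i.-1 + V i by clear - H0 H1 u0 v0; lia.
have P2 : U i + U i.+1 <= cnt V i.-1 - cnt U i.-1 + V i + V i.+1.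
  by clear - H0 H2 u0 v0 u1 v1; lia.
have P3 : nu n d U V i.+1 <= cnt V i.-1 - cnt U i.-1 + V i + V i.+1 - (U i + U i.+1).
  by clear - H0 Np u0 v0 u1 v1; lia.
have P4 : nu n d U V i = minn (cnt V i.-1 - cnt U i.-1 + V i - U i) (nu n d U V i.+1).
  by rewrite N0; congr minn; clear - H0 u0 v0; lia.
have P5 : U i + nu n d U V i = nu n d U V i.-1 + l i by clear - l0 u0; rewrite /l; lia.
have P6 : U i.+1 + nu n d U V i.+1 = nu n d U V i + l i.+1 by clear - l1 u1; rewrite /l; lia.
have P7 : V i + nu n d U V i.-1 = nu n d U V i + r i.
  by clear - r0 v0 le0 lem H0 H1; rewrite /r; lia.
have P8 : V i.+1 + nu n d U V i = nu n d U V i.+1 + r i.+1.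
  by clear - r1 v1 le0 Np H1 H2; rewrite /r; lia.
have := local_lt P1 P2 P3 P4 Nm P5 P6 P7 P8.
clear P1 P2 P3 P4 P5 P6 P7 P8; cbv beta zeta.
have gph X : gphi n i X = ~~ X i && X i.+1 by rewrite /gphi iln.
have gep X : geps n i X = X i && ~~ X i.+1 by rewrite /geps iln.
rewrite -!gph -!gep -/(f_left n i V U) -/(f_right n i V U) -/(e_left n i V U) -/(e_right n i V U).
rewrite -/(f_left n i r l) -/(f_right n i r l) -/(e_left n i r l) -/(e_right n i r l).
case=> A1 A2 A3 A4 A5; split=> //.
- move=> Hf; have /= [B1 B2 B3 B4] := A4 Hf.
  set x := f_left n i V U in Hf B1 B2 B3 B4 *; set y := f_left n i r l in B1 B2 B3 B4 *.
  set V' := if x then _ else V; set U' := if x then U else _.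
  have ch k : k <= n -> step true k i (cnt U k) (cnt U' k) (~~ x) /\
                       step true k i (cnt V k) (cnt V' k) x.
    move=> kn; split; last by apply: step_gset_t => //; rewrite /x => /andP[].
    have -> : U' = if ~~ x then gset i true U else U by rewrite /U'; case: (x).
    by apply: step_gset_t => // /negbTE xF; move: Hf; rewrite xF => /andP[].
  have [/= ci1 ci2] := ch i i_n; rewrite eqxx !mul1n in ci1 ci2.
  have [/= cn1 cn2] := ch n (leqnn n).
  rewrite ni !mul0n !addn0 in cn1 cn2.
  have E0 : cnt V' i - cnt U' i = cnt V i.-1 - cnt U i.-1 + V i + x - (U i + ~~ x).
    by clear - ci1 ci2 u0 v0 H0; lia.
  have Q1 : cnt U' i <= cnt V' i by clear - ci1 ci2 u0 v0 H0 B1; lia.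
  have Q2 : cnt V' n = cnt U' n + d + m by rewrite cn1 cn2.
  clear - n2 Hi' St ch E0 B2 B3 B4 Q1 Q2.
  have := @moved_core _ i x y V U V' U' m m Hi' St ch Q1 Q2; rewrite E0 => H; exact: H.
- move=> Hf; have /= [B1 B2 B3 B4] := A5 Hf.
  set x := e_left n i V U in Hf B1 B2 B3 B4 *; set y := e_left n i r l in B1 B2 B3 B4 *.
  set V' := if x then _ else V; set U' := if x then U else _.
  have xV : x -> geps n i V by case/andP.
  have xU : ~~ x -> geps n i U by move/negbTE => xF; move: Hf; rewrite xF => /andP[].
  have ch k : k <= n -> step false k i (cnt U k) (cnt U' k) (~~ x) /\
                       step false k i (cnt V k) (cnt V' k) x.
    move=> kn; split; last exact: step_gset_f.
    have -> : U' = if ~~ x then gset i false U else U by rewrite /U'; case: (x).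
    exact: step_gset_f.
  have [/= ci1 ci2] := ch i i_n; rewrite eqxx !mul1n in ci1 ci2.
  have [/= cn1 cn2] := ch n (leqnn n).
  rewrite ni !mul0n !addn0 in cn1 cn2.
  have xV' : x <= V i by case: (x) xV => // /(_ isT); rewrite gep => /andP[->].
  have xU' : ~~ x <= U i by case: (x) xU => // /(_ isT); rewrite gep => /andP[->].
  have E0 : cnt V' i - cnt U' i = cnt V i.-1 - cnt U i.-1 + V i - x - (U i - ~~ x).
    by clear - ci1 ci2 u0 v0 H0 xV' xU'; lia.
  have Q1 : cnt U' i <= cnt V' i by clear - ci1 ci2 u0 v0 H0 B1 xV' xU'; lia.
  have Q2 : cnt V' n = cnt U' n + d + m by rewrite -cn1 -cn2.
  clear - n2 Hi' St ch E0 B2 B3 B4 Q1 Q2.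
  have := @moved_core _ i x y V U V' U' m m Hi' St ch Q1 Q2; rewrite E0 => H; exact: H.
Qed.

Lemma core_n V m U : kn_state V m U ->
  let l := L U V in let r := R U V in
  let t := [&& V n, ~~ U n & 0 < m] in
  [/\ 2 * (U n && V n) + t = beps n n r l, 2 * (~~ V n && ~~ U n) + t = bphi n n r l,
    (~~ V n && ~~ U n = f_left n n r l) /\ t = f_right n n r l,
    (U n && V n = e_right n n r l) /\ t = e_left n n r l &
    [/\ f_left n n r l -> kn_state (gset n true V) m.+1 U /\
          moved true n true true V U (gset n true V) U,
       f_right n n r l -> kn_state V m.-1 (gset n true U) /\
          moved true n false false V U V (gset n true U),
       e_left n n r l -> kn_state (gset n false V) m.-1 U /\
          moved false n true true V U (gset n false V) U &
       e_right n n r l -> kn_state V m.+1 (gset n false U) /\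
          moved false n false false V U V (gset n false U)]].
Proof.
move=> St l r t; have [UV Sn] := St; have Hi : 1 <= n <= n by rewrite leqnn andbT; lia.
have n0 : 0 < n by lia.
have im : n.-1 <= n by lia.
have cL := @cnt_lbit n d U V UV; have cR := @cnt_rbit n d U V UV.
have u0 := @cntP U n n0; have v0 := @cntP V n n0.
have l0 := @cntP l n n0; have r0 := @cntP r n n0.
rewrite /l !cL // in l0; rewrite /r !cR // in r0.
have N0 : nu n d U V n = d by apply: nu_n; lia.
have Nm := @nuS n d U V n.-1 im; rewrite prednK // N0 in Nm.
have le0 := nu_le d U V (leqnn n); have lem := nu_le d U V im.
have H0 := UV _ im; have H1 := UV _ (leqnn n).
have gph X : gphi n n X = ~~ X n by rewrite /gphi ltnn andbT.
have gep X : geps n n X = X n by rewrite /geps ltnn andbT.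
have A : [/\ 2 * (U n && V n) + t = beps n n r l, 2 * (~~ V n && ~~ U n) + t = bphi n n r l,
    (~~ V n && ~~ U n = f_left n n r l) /\ t = f_right n n r l &
    (U n && V n = e_right n n r l) /\ t = e_left n n r l].
  rewrite /beps /bphi /f_left /f_right /e_left /e_right !gph !gep /t -/l -/r.
  rewrite -/(l n) -/(r n) in l0 r0.
  case: (U n) u0 l0 => u0 l0; case: (V n) v0 r0 => v0 r0; case: (l n) l0 => l0;
    try (exfalso; lia); case: (r n) r0 => r0; try (exfalso; lia);
    case: (posnP m) => m0; try (exfalso; lia); rewrite /= ?m0 //.
have [A1 A2 [A3 A4] [A5 A6]] := A; split=> //; split.
- rewrite -A3 => /andP[Vn Un].
  have ch k : k <= n -> step true k n (cnt U k) (cnt U k) (~~ true) /\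
                       step true k n (cnt V k) (cnt (gset n true V) k) true.
    move=> kn; split; first by rewrite /step muln0 addn0.
    by apply: (@step_gset_t n V true k) => // _; rewrite gph.
  have [/= _ ci2] := ch n (leqnn n); rewrite eqxx mul1n in ci2.
  have Q1 : cnt (U) n <= cnt (gset n true V) n by clear - H1 Sn ci2; lia.
  have Q2 : cnt (gset n true V) n = cnt (U) n + d + m.+1 by clear - H1 Sn ci2; lia.
  have Q3 : minn (cnt (gset n true V) n - cnt (U) n) d = d by clear - Q2; lia.
  by apply: moved_core Hi St ch Q1 Q2 _ _; rewrite nu_end N0 Q3 //; split; rewrite addnC.
- rewrite -A4 => /and3P[Vn Un m0].
  have ch k : k <= n -> step true k n (cnt U k) (cnt (gset n true U) k) (~~ false) /\
                       step true k n (cnt V k) (cnt V k) false.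
    move=> kn; split; last by rewrite /step muln0 addn0.
    by apply: (@step_gset_t n U true k) => // _; rewrite gph.
  have [/= ci2 _] := ch n (leqnn n); rewrite eqxx mul1n in ci2.
  have Q1 : cnt (gset n true U) n <= cnt (V) n by clear - H1 Sn ci2 m0; lia.
  have Q2 : cnt (V) n = cnt (gset n true U) n + d + m.-1 by clear - H1 Sn ci2 m0; lia.
  have Q3 : minn (cnt (V) n - cnt (gset n true U) n) d = d by clear - Q2; lia.
  by apply: moved_core Hi St ch Q1 Q2 _ _; rewrite nu_end N0 Q3 //; split; rewrite addnC.
- rewrite -A6 => /and3P[Vn Un m0].
  have ch k : k <= n -> step false k n (cnt U k) (cnt U k) (~~ true) /\
                       step false k n (cnt V k) (cnt (gset n false V) k) true.
    move=> kn; split; first by rewrite /step muln0 addn0.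
    by apply: (@step_gset_f n V true k) => // _; rewrite gep.
  have [/= _ ci2] := ch n (leqnn n); rewrite eqxx mul1n in ci2.
  have Q1 : cnt (U) n <= cnt (gset n false V) n by clear - H1 Sn ci2 m0; lia.
  have Q2 : cnt (gset n false V) n = cnt (U) n + d + m.-1 by clear - H1 Sn ci2 m0; lia.
  have Q3 : minn (cnt (gset n false V) n - cnt (U) n) d = d by clear - Q2; lia.
  by apply: moved_core Hi St ch Q1 Q2 _ _; rewrite nu_end N0 Q3 //; split; rewrite addnC.
- rewrite -A5 => /andP[Un Vn].
  have ch k : k <= n -> step false k n (cnt U k) (cnt (gset n false U) k) (~~ false) /\
                       step false k n (cnt V k) (cnt V k) false.
    move=> kn; split; last by rewrite /step muln0 addn0.
    by apply: (@step_gset_f n U true k) => // _; rewrite gep.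
  have [/= ci2 _] := ch n (leqnn n); rewrite eqxx mul1n in ci2.
  have Q1 : cnt (gset n false U) n <= cnt (V) n by clear - H1 Sn ci2; lia.
  have Q2 : cnt (V) n = cnt (gset n false U) n + d + m.+1 by clear - H1 Sn ci2; lia.
  have Q3 : minn (cnt (V) n - cnt (gset n false U) n) d = d by clear - Q2; lia.
  by apply: moved_core Hi St ch Q1 Q2 _ _; rewrite nu_end N0 Q3 //; split; rewrite addnC.
Qed.
End Core.

Section Column.
Variables (n d : nat).
Hypothesis n2 : 1 < n.
Hypothesis dn : d <= n.
Implicit Types U V : nat -> bool.
Notation L U V := (lbit n d U V).
Notation R U V := (rbit n d U V).

Lemma gphi_n X : gphi n n X = ~~ X n. Proof. by rewrite /gphi ltnn andbT. Qed.
Lemma geps_n X : geps n n X = X n. Proof. by rewrite /geps ltnn andbT. Qed.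

Lemma size_kcol V m U : kn_state n d V m U -> size (kcol n V m U) = n - d.
Proof. by case=> _ E; rewrite size_kncol; have := cnt_negb V n; lia. Qed.

Lemma eq_kncol p p' m u u' : (forall k, 1 <= k <= n -> p k = p' k) ->
  (forall k, 1 <= k <= n -> u k = u' k) -> kncol n p m u = kncol n p' m u'.
Proof. by move=> H1 H2; rewrite /kncol (eq_bars H2) (eq_idx H1). Qed.

Lemma col_vals V m U i : kn_state n d V m U -> 1 <= i <= n ->
  let c := kcol n V m U in let l := L U V in let r := R U V in
  [/\ eps i c = (beps n i r l)%:R%R, phi i c = (bphi n i r l)%:R%R &
      i < n -> beps n i V U = beps n i r l /\ bphi n i V U = bphi n i r l].
Proof.
move=> St Hi; cbv zeta; case: (ltnP i n) => iln.
  have Hi' : 1 <= i < n by lia.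
  have [-> -> _ _] := kn_op_lt n2 m V U Hi'; have [E1 E2 _ _ _] := core_lt n2 Hi' St.
  by rewrite E1 E2.
have Ei : i = n by lia.
subst i; have [-> -> _ _] := kn_op_n n2 (fun k => ~~ V k) m U.
have [E1 E2 _ _ _] := core_n n2 St; rewrite -E1 -E2 negbK.
by split=> //; lia.
Qed.

Lemma col_tf V m U i : kn_state n d V m U -> 1 <= i <= n ->
  let c := kcol n V m U in let l := L U V in let r := R U V in
  let y := f_left n i r l in let x := if i < n then f_left n i V U else y in
  if f_left n i r l || f_right n i r l then
    exists V' m' U', [/\ tf i c = Some (kcol n V' m' U'), kn_state n d V' m' U',
      moved n d true i x y V U V' U' & i < n -> f_left n i V U || f_right n i V U]
  else tf i c = None.
Proof.
move=> St Hi; cbv zeta; case: (ltnP i n) => iln.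
  have Hi' : 1 <= i < n by lia.
  have [_ _ _ tE] := kn_op_lt n2 m V U Hi'; have [_ _ [E _] H _] := core_lt n2 Hi' St.
  rewrite -E; case: ifP => Hf; last first.
    by rewrite tE; move/norP: Hf => [/negbTE-> /negbTE->].
  have [S1 S2] := H Hf; do 3 eexists; split; [|exact: S1|exact: S2|by []].
  by rewrite tE; case: ifP Hf => //= _ ->.
have Ei : i = n by lia.
subst i; have [_ _ _ tE] := kn_op_n n2 (fun k => ~~ V k) m U.
have [_ _ [E1 E2] _ [H1 H2 _ _]] := core_n n2 St.
rewrite negbK E1 E2 in tE; case: ifP => [/orP[] Hf|/norP[Hf1 Hf2]]; last first.
- by rewrite tE (negbTE Hf1) (negbTE Hf2).
- have [S1 S2] := H2 Hf; have f1F : f_left n n (R U V) (L U V) = false.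
    by move: Hf; rewrite /f_left /f_right => /andP[_ /negbTE->].
  exists V, m.-1, (gset n true U); rewrite f1F; split=> //.
  rewrite tE f1F Hf; congr Some; apply: eq_kncol => // k Hk.
  by rewrite /gset /fset1; case: eqP => // _; case: eqP => //; lia.
- have [S1 S2] := H1 Hf.
  exists (gset n true V), m.+1, U; rewrite Hf; split=> //.
  rewrite tE Hf; congr Some; apply: eq_kncol => // k Hk.
  by rewrite /gset /fset1; case: eqP => // _; case: eqP => //; lia.
Qed.

Lemma col_te V m U i : kn_state n d V m U -> 1 <= i <= n ->
  let c := kcol n V m U in let l := L U V in let r := R U V in
  let y := e_left n i r l in let x := if i < n then e_left n i V U else y in
  if e_left n i r l || e_right n i r l then
    exists V' m' U', [/\ te i c = Some (kcol n V' m' U'), kn_state n d V' m' U',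
      moved n d false i x y V U V' U' & 
      (i < n -> e_left n i V U || e_right n i V U) /\ (i = n -> ~~ y -> U n)]
  else te i c = None.
Proof.
move=> St Hi; cbv zeta; case: (ltnP i n) => iln.
  have Hi' : 1 <= i < n by lia.
  have [_ _ tE _] := kn_op_lt n2 m V U Hi'; have [_ _ [_ E] _ H] := core_lt n2 Hi' St.
  rewrite -E; case: ifP => Hf; last first.
    by rewrite tE; move/norP: Hf => [/negbTE-> /negbTE->].
  have [S1 S2] := H Hf; do 3 eexists; split; [|exact: S1|exact: S2|].
    by rewrite tE; case: ifP Hf => //= _ ->.
  by split=> // Ei; lia.
have Ei : i = n by lia.
subst i; have [_ _ tE _] := kn_op_n n2 (fun k => ~~ V k) m U.
have [_ _ _ [E1 E2] [_ _ H1 H2]] := core_n n2 St.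
rewrite !negbK E1 E2 in tE; case: ifP => [/orP[] Hf|/norP[Hf1 Hf2]]; last first.
- by rewrite tE (negbTE Hf1) (negbTE Hf2).
- have [S1 S2] := H2 Hf; have f1F : e_left n n (R U V) (L U V) = false.
    by move: Hf; rewrite /e_left /e_right => /andP[-> _]; rewrite andbF.
  exists V, m.+1, (gset n false U); rewrite f1F; split=> //.
    rewrite tE Hf; congr Some; apply: eq_kncol => // k Hk.
    by rewrite /gset /fset1; case: eqP => // _; case: eqP => //; lia.
  by split=> // _ _; move: Hf; rewrite -E1 => /andP[].
- have [S1 S2] := H1 Hf; have e2F : e_right n n (R U V) (L U V) = false.
    by move: Hf; rewrite /e_left /e_right => /andP[_ /negbTE->].
  exists (gset n false V), m.-1, U; rewrite Hf; split=> //.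
  rewrite tE e2F Hf; congr Some; apply: eq_kncol => // k Hk.
  by rewrite /gset /fset1; case: eqP => // _; case: eqP => //; lia.
Qed.

Definition psi (c : col) : spinor :=
  (n - size c, odflt ([::], [::]) (Psi_col n (size c) c)).

Lemma minus_kcol V m U : minus_part n (kcol n V m U) = bars n U.
Proof.
rewrite /minus_part /kcol /kncol !filter_cat.
have /all_filterP -> := all_bars n U.
have -> : filter (is_bar n) (nseq m Zero) = [::] by elim: m => //= m ->.
have -> : filter (is_bar n) (rev (map Pos (idx n (fun k => ~~ V k)))) = [::].
  by rewrite filter_rev; elim: (idx n _) => //= k s; case: (filter _ _).
by rewrite !cats0.
Qed.

Lemma plus_kcol V m U : plus_compl n (kcol n V m U) = bars n V.
Proof.
rewrite /plus_compl /bars; congr map; apply: eq_idx => k Hk.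
by rewrite mem_kncol Hk /= negbK.
Qed.

Lemma psi_kcol V m U : kn_state n d V m U ->
  Psi_col n (n - d) (kcol n V m U) = Some (Fcols n d U V).
Proof.
move=> [UV Sn]; rewrite /Psi_col minus_kcol plus_kcol.
have -> : n - (n - d) = d by lia.
by apply: iter_calF => //; lia.
Qed.

Lemma psiE V m U : kn_state n d V m U ->
  psi (kcol n V m U) = (d, (bars n (L U V), bars n (R U V))).
Proof.
move=> St; rewrite /psi (size_kcol St) (psi_kcol St).
by have -> : n - (n - d) = d by lia.
Qed.

Lemma coord2_words (w : words n) k : 1 <= k <= n ->
  coord2 (wt w) k = ((count_mem (Pos k) w)%:R *+ 2 - (count_mem (Bar k) w)%:R *+ 2)%R.
Proof.
move=> Hk; elim: w => [|x w IH].
  by rewrite /= /coord2; case: insub => [j|] //; rewrite mxE.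
rewrite tseq_wt_cons coord2D IH /= coord2_mk //.
have -> : (x == Pos k) = (if x is Pos a then k == a else false).
  by case: x => [a||a] //; rewrite eq_sym; apply/eqP/eqP => [[->]|->].
have -> : (x == Bar k) = (if x is Bar a then k == a else false).
  by case: x => [a||a] //; rewrite eq_sym; apply/eqP/eqP => [[->]|->].
by case: x => [a||a]; try case: (k == a); lia.
Qed.

Lemma LR_bits V m U k : kn_state n d V m U -> 1 <= k <= n ->
  (L U V k + R U V k = U k + V k)%N.
Proof.
move=> [UV Sn] Hk.
have := @cntP (L U V) k; have := @cntP (R U V) k; have := @cntP U k; have := @cntP V k.
rewrite !cnt_lbit ?cnt_rbit //; try lia.
have := @nu_le n d U V k; have := @nu_le n d U V k.-1; have := UV k; have := UV k.-1; lia.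
Qed.

Lemma LR_le V m U : kn_state n d V m U ->
  forall k, k <= n -> cnt (L U V) k <= cnt (R U V) k + d.
Proof.
move=> [UV Sn] k kn; rewrite cnt_lbit // cnt_rbit //.
have := @nu_le n d U V k kn; have := @nu_led n d U V k; have := UV k kn; lia.
Qed.

Lemma psi_morph V m U : kn_state n d V m U ->
  @morph n (col_crystal n) (T_b_crystal n) psi (kcol n V m U).
Proof.
move=> St; have LR := LR_le St; split.
  rewrite (psiE St); apply: weight_eq => k Hk.
  change (coord2 (spinor_wt n 2 (bars n (L U V) ++ bars n (R U V))) k =
    coord2 (wt (rev (kcol n V m U) : words n)) k).
  rewrite coord2_mk // coord2_words // !count_rev count_cat.
  rewrite !col_ok_count ?col_ok_bars ?col_ok_kncol // !mem_bars !mem_kncol Hk /=.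
  have := LR_bits St Hk; case: (U k); case: (V k); case: (lbit _ _ _ _ _); case: (rbit _ _ _ _ _) => //=; lia.
move=> i Hi; have [v1 v2 _] := col_vals St Hi.
have [t1 t2 t3 t4] := Tb_op n2 LR Hi.
have TF := col_tf St Hi; have TE := col_te St Hi; cbv zeta in TF, TE.
rewrite v1 v2 (psiE St) t1 t2 t3 t4; split=> //.
  case: ifP TE => [/orP E|/norP[/negbTE-> /negbTE->] -> //] [V' [m' [U' [-> St' mv _]]]].
  rewrite /= (psiE St') => /=.
  case: ifP E => [e1T _|e1F [//|e2T]]; last rewrite e2T.
    congr (Some (_, (_, _))); apply: eq_bars; apply: cnt_inj => k kn; have [_ _ c1 c2] := mv k kn.
      by move: c1; rewrite /step e1T muln0 addn0.
    have H := @step_gset_f n i (R U V) true k Hi kn ltac:(by case/andP: e1T).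
    by move: c2 H; rewrite /step e1T !muln1 /=; lia.
  congr (Some (_, (_, _))); apply: eq_bars; apply: cnt_inj => k kn; have [_ _ c1 c2] := mv k kn.
    have H := @step_gset_f n i (L U V) true k Hi kn ltac:(by case/andP: e2T).
    by move: c1 H; rewrite /step e1F !muln1 /=; lia.
  by move: c2; rewrite /step e1F muln0 addn0.
case: ifP TF => [/orP E|/norP[/negbTE-> /negbTE->] -> //] [V' [m' [U' [-> St' mv _]]]].
rewrite /= (psiE St') => /=.
case: ifP E => [e1T _|e1F [//|e2T]]; last rewrite e2T.
  congr (Some (_, (_, _))); apply: eq_bars; apply: cnt_inj => k kn; have [_ _ c1 c2] := mv k kn.
    by move: c1; rewrite /step e1T muln0 addn0.
  have := @step_gset_t n i (R U V) true k Hi kn; move: c2; rewrite /step e1T muln1 => -> H.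
  by rewrite H //; case/andP: e1T.
congr (Some (_, (_, _))); apply: eq_bars; apply: cnt_inj => k kn; have [_ _ c1 c2] := mv k kn.
  have := @step_gset_t n i (L U V) true k Hi kn; move: c1; rewrite /step e1F muln1 => -> H.
  by rewrite H //; case/andP: e2T.
by move: c2; rewrite /step e1F muln0 addn0.
Qed.
End Column.

Definition lev (c : col) (i : nat) : option letter := if 0 < i then onth c i.-1 else None.

Lemma lev_kcol n d V m U i x : d <= n -> kn_state n d V m U ->
  lev (kcol n V m U) i = Some x <->
  match x with
  | Bar y => [/\ 1 <= y <= n, U y & cnt U y = i]
  | Zero => cnt U n < i <= cnt U n + m
  | Pos y => [/\ 1 <= y <= n, ~~ V y & i + y + d = n + cnt V y + 1]
  end.
Proof.
move=> dn [UV Sn]; rewrite /lev; have N := cnt_negb V n.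
case: i => [|i] /=.
  split=> //; case: x => [y||y] //.
    move=> [Hy Vy E]; have Ny := @cntP V y ltac:(lia); rewrite (negbTE Vy) in Ny.
    have := cnt_le V y; have := @cnt_lip V y n ltac:(lia); lia.
  by move=> [Hy Uy E]; have := @cntP U y; rewrite Uy; lia.
rewrite onth_kncol; case: x => [y||y]; [|by split; lia|by []].
have Ny := cnt_negb V y; split=> [[H1 H2 H3]|[H1 H2 H3]]; split=> //; lia.
Qed.

Lemma entry_straight T i j :
  entry (straight T) i j = if j is j'.+1 then lev (nth [::] T j') i else None.
Proof.
case: j => [|j] //; rewrite /entry /straight /lev.
case: (ltnP j (size T)) => jT; first by rewrite (nth_map [::]) //= subn0.
have -> : nth (0, [::]) [seq (0, c) | c <- T] j = (0, [::]) by rewrite nth_default ?size_map.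
by rewrite nth_default //=; case: i => [|[|i]].
Qed.

Definition rlt (x y : letter) : bool := lle x y && ~~ ((x == Zero) && (y == Zero)).

Definition pair_KN (n : nat) (c2 c1 : col) : Prop :=
  let S := straight [:: c1; c2] in
  [/\ forall i x y, lev c2 i = Some x -> lev c1 i = Some y -> rlt x y,
      KN_b2 n S 1, KN_b3 n S 1 & KN_b4 n S 1].

(* The common form of the conditions (b-2)-(b-4) together with semistandardness
   of the rows, and of the relation T_2 < T_1. *)
Definition pair_good (n d2 d1 : nat) (V2 U2 V1 U1 : nat -> bool) : Prop :=
  forall k, k <= n -> cnt (rbit n d2 U2 V2) k <= cnt U1 k /\
    cnt V2 k <= cnt (lbit n d1 U1 V1) k + (d2 - d1).

Lemma nu_ge n d U V x k : k <= n.+1 ->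
  (x <= nu n d U V k <-> x <= d /\ forall j, k <= j <= n -> x <= cnt V j - cnt U j).
Proof.
move=> /subnK; move: (n.+1 - k) => i; elim: i k => [|i IH] k Ek.
  rewrite add0n in Ek; subst k; rewrite nu_end; split=> [H|[]//]; split=> // j; lia.
have kn : k <= n by lia.
rewrite nuS // leq_min; split.
  move=> /andP[H1 /IH []]; first by lia.
  move=> H2 H3; split=> // j Hj; case: (eqVneq k j) => [<-//|ne].
  by apply: H3; lia.
move=> [H1 H2]; apply/andP; split; first by apply: H2; lia.
by apply/IH; [lia|split=> // j Hj; apply: H2; lia].
Qed.

Lemma imp_lt (P : Prop) a b : (P -> a < b) -> P -> ~ (b <= a).
Proof. by move=> H /H; lia. Qed.

Section Pair.
Variables (n d2 d1 : nat).
Hypothesis n2 : 1 < n.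
Hypothesis d12 : d1 <= d2.
Hypothesis d2n : d2 <= n.
Variables (V2 U2 V1 U1 : nat -> bool) (m2 m1 : nat).
Hypothesis St2 : kn_state n d2 V2 m2 U2.
Hypothesis St1 : kn_state n d1 V1 m1 U1.
Let c2 := kcol n V2 m2 U2.
Let c1 := kcol n V1 m1 U1.

Let d1n : d1 <= n. Proof. exact: leq_trans d12 d2n. Qed.

(* The condition pair_good once nu is expanded as a minimum. *)
Definition condA k j := cnt V2 k + cnt U2 j <= cnt U1 k + cnt V2 j.
Definition condB k j := cnt V2 k + cnt U1 j <= cnt U1 k + cnt V1 j + (d2 - d1).
Definition condC k := cnt V2 k <= cnt U1 k + d2.

Lemma pair_goodE : pair_good n d2 d1 V2 U2 V1 U1 <->
  [/\ forall k j, k <= j <= n -> condA k j, forall k j, k <= j <= n -> condB k j &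
      forall k, k <= n -> condC k].
Proof.
have [UV2 S2] := St2; have [UV1 S1] := St1; rewrite /condA /condB /condC.
have key k : k <= n ->
    (cnt (rbit n d2 U2 V2) k <= cnt U1 k /\ cnt V2 k <= cnt (lbit n d1 U1 V1) k + (d2 - d1)) <->
    (cnt V2 k - cnt U1 k <= nu n d2 U2 V2 k /\
     cnt V2 k - (d2 - d1) - cnt U1 k <= nu n d1 U1 V1 k).
  move=> kn; rewrite cnt_rbit // cnt_lbit //; have := nu_le d2 U2 V2 kn.
  by move=> H; split=> [[H1 H2]|[H1 H2]]; split; lia.
split=> [H|[HA HB HC] k kn]; last first.
  apply/key => //; split; apply/nu_ge; try lia; split.
  - by have := HC k kn; lia.
  - by move=> j Hj; have := HA k j Hj; have := UV2 j; lia.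
  - by have := HC k kn; lia.
  - by move=> j Hj; have := HB k j Hj; have := UV1 j; lia.
have {}H k : k <= n -> _ := fun kn => (key k kn).1 (H k kn).
split=> [k j Hj|k j Hj|k kn].
- have kn : k <= n by lia.
  have [/(nu_ge _ _ _ _ (leqW kn)) [_ H1] _] := H k kn.
  by have := H1 j Hj; have := UV2 j; lia.
- have kn : k <= n by lia.
  have [_ /(nu_ge _ _ _ _ (leqW kn)) [_ H1]] := H k kn.
  by have := H1 j Hj; have := UV1 j; lia.
- by have [/(nu_ge _ _ _ _ (leqW kn)) [H1 _] _] := H k kn; lia.
Qed.

Lemma rowsE : (forall i x y, lev c2 i = Some x -> lev c1 i = Some y -> rlt x y) <->
  [/\ forall k, k <= n -> condA k k, forall k, k <= n -> condB k k & condC n].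
Proof.
have [UV2 S2] := St2; have [UV1 S1] := St1; rewrite /condA /condB /condC.
have L2 i x := lev_kcol i x d2n St2; have L1 i x := lev_kcol i x d1n St1.
have ex1 i : 0 < i <= n - d1 -> exists y, lev c1 i = Some y.
  move=> Hi; rewrite /lev ifT; last by lia.
  by apply: onth_some; rewrite (size_kcol n2 d1n St1) //; lia.
have ex2 i : 0 < i <= n - d2 -> exists y, lev c2 i = Some y.
  move=> Hi; rewrite /lev ifT; last by lia.
  by apply: onth_some; rewrite (size_kcol n2 d2n St2) //; lia.
have cV2n := cnt_le V2 n; have cV1n := cnt_le V1 n.
split=> [H|[HA HB HC] i x y /L2 Hx /L1 Hy].
  split.
  - move=> k kn; rewrite [_ + cnt V2 k]addnC leq_add2l leqNgt; apply/negP => Hk.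
    have [a [a1 Ua ca]] : exists a, [/\ 1 <= a <= k, U2 a & cnt U2 a = (cnt U1 k).+1] by exact: cnt_ex.
    have La : lev c2 (cnt U2 a) = Some (Bar a) by apply/L2; split=> //; lia.
    have U2n := @cnt_mono U2 a n ltac:(lia).
    have [y Ly] := ex1 (cnt U2 a) ltac:(lia).
    have := H _ _ _ La Ly; case: y Ly => [b||b] /L1 Hb; rewrite /rlt /lle /= ?andbF //.
    case: Hb => Hb Ub cb; rewrite andbT => Hab.
    have ba : b <= a by case/orP: Hab => [/eqP[->]|] //; lia.
    by have := @cnt_mono U1 b k ltac:(lia); lia.
  - move=> k kn; rewrite addnAC -[X in _ <= X + _]addnC.
    suff : cnt V2 k <= cnt V1 k + (d2 - d1) by lia.
    rewrite leqNgt; apply/negP => Hk.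
    have N1 := cnt_negb V1 k; have N2 := cnt_negb V2 k.
    set q := cnt (fun j => ~~ V1 j) k in N1.
    have q0 : 0 < q by rewrite /q; have := cnt_le V2 k; lia.
    have [b [b1 Vb cb]] : exists b, [/\ 1 <= b <= k, ~~ V1 b & cnt (fun j => ~~ V1 j) b = q.-1.+1].
      by apply: cnt_ex; rewrite -/q; lia.
    have Nb := cnt_negb V1 b.
    have V1b := @cnt_lip V1 b n ltac:(lia); have V1k := @cnt_lip V1 k n kn.
    have V2k := @cnt_lip V2 k n kn.
    pose i := n + cnt V1 b + 1 - (b + d1).
    have Li : lev c1 i = Some (Pos b) by apply/L1; split=> //; rewrite /i; lia.
    have [x Lx] := ex2 i ltac:(rewrite /i; lia).
    have := H _ _ _ Lx Li; case: x Lx => [a||a] /L2 Ha; rewrite /rlt /lle /= ?andbF //.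
    case: Ha => Ha Va ca; rewrite andbT => Hab.
    have ab : a <= b by case/orP: Hab => [/eqP[->]|] //; lia.
    by have := @cnt_lip V2 a k ltac:(lia); rewrite /i in ca; lia.
  - rewrite leqNgt; apply/negP => Hn.
    have [x Lx] := ex2 (cnt V2 n - d2) ltac:(lia).
    have [y Ly] := ex1 (cnt V2 n - d2) ltac:(lia).
    have := H _ _ _ Lx Ly; move: Lx Ly => /L2 Hx /L1 Hy.
    have yb : ~ exists b, y = Bar b.
      by move=> [b Ey]; rewrite Ey in Hy; case: Hy => Hb _ cb; have := @cnt_mono U1 b n; lia.
    have xp : ~ exists a, x = Pos a.
      move=> [a Ea]; rewrite Ea in Hx; case: Hx => Ha Va ca.
      have := @cnt_lip V2 a n; have := @cnt_lt (fun j => ~~ V2 j) a.-1 a; lia.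
    case: x xp Hx => [a||a] xp Hx; first by case: xp; exists a.
      by case: y yb Hy => [b||b] yb Hy //; case: yb; exists b.
    by case: y yb Hy => [b||b] yb Hy //; case: yb; exists b.
case: x Hx => [a||a] Hx; case: y Hy => [b||b] Hy; rewrite /rlt /lle //=.
- case: Hx => Ha Va ca; case: Hy => Hb Vb cb; rewrite andbT.
  suff : a <= b by rewrite leq_eqVlt => /orP[/eqP->|->]; rewrite ?eqxx ?orbT.
  rewrite leqNgt; apply/negP => ba.
  have := HB b ltac:(lia); have := @cnt_lip V2 b a.-1 ltac:(lia).
  by have := @cntP V2 a ltac:(lia); rewrite (negbTE Va); lia.
- case: Hy => Hb Vb cb; have := @cnt_lip V1 b n ltac:(lia); have := @cntP V1 b; lia.
- by lia.
- by case: Hy => Hb Vb cb; case: Hx => Ha Ua ca; have := @cnt_lip V1 b n; have := @cnt_mono U2 a n; lia.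
- by case: Hx => Ha Ua ca; have := @cnt_mono U2 a n; lia.
- case: Hx => Ha Ua ca; case: Hy => Hb Ub cb; rewrite andbT.
  suff : b <= a by rewrite leq_eqVlt => /orP[/eqP->|->]; rewrite ?eqxx ?orbT.
  rewrite leqNgt; apply/negP => ab.
  by have := HA a ltac:(lia); have := @cnt_lt U1 a b ab Ub; lia.
Qed.

Lemma ent1 p : entry (straight [:: c1; c2]) p 1 = lev c1 p.
Proof. exact: entry_straight. Qed.

Lemma ent2 p : entry (straight [:: c1; c2]) p 2 = lev c2 p.
Proof. exact: entry_straight. Qed.

Let mid := [:: Some (Pos n); Some Zero; Some (Bar n)].

Lemma lev_mid1 l : cnt U1 n.-1 < l -> l + d1 <= cnt V1 n.-1 + 1 -> lev c1 l \in mid.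
Proof.
move=> H1 H2; have [UV Sn] := St1.
have Un := @cntP U1 n ltac:(lia); have Vn := @cntP V1 n ltac:(lia).
have L1 i x := lev_kcol i x d1n St1; rewrite /mid !inE.
case: (ltnP (cnt U1 n) l) => Hl.
  case: (leqP l (cnt U1 n + m1)) => Hm.
    have -> : lev c1 l = Some Zero; last by rewrite eqxx orbT.
    by apply/L1; lia.
  have Vf : V1 n = false by case: (V1 n) Vn => //=; lia.
  rewrite Vf in Vn; have -> : lev c1 l = Some (Pos n); last by rewrite eqxx.
  by apply/L1; split; rewrite ?Vf //; lia.
have Uf : U1 n by case: (U1 n) Un => //=; lia.
rewrite Uf in Un.
have -> : lev c1 l = Some (Bar n); last by rewrite eqxx !orbT.
by apply/L1; split=> //; lia.
Qed.

Lemma pair_KN_good : pair_KN n c2 c1 -> pair_good n d2 d1 V2 U2 V1 U1.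
Proof.
move=> [/rowsE [HA HB HC] b2 b3 b4]; have [UV2 S2] := St2; have [UV1 S1] := St1.
have L2 i x := lev_kcol i x d2n St2; have L1 i x := lev_kcol i x d1n St1.
have B k j : k <= j -> j < n -> condB k j.
  move=> /subnK; move: (j - k) => t; elim: t k j => [|t IH] k j Ej jn.
    by rewrite -Ej add0n; apply: HB; lia.
  have Hk : condB k j.-1 by apply: IH; lia.
  have Hj : condB k.+1 j by apply: IH; lia.
  rewrite /condB leqNgt; apply/negP => Hf; move: Hk Hj; rewrite /condB.
  have := @cntP U1 j ltac:(lia); have := @cntP V1 j ltac:(lia).
  have := cntS V2 k; have := cntS U1 k.
  case Ua: (U1 k.+1); case Va: (V2 k.+1); case Ub: (U1 j); case Vb: (V1 j); try (clear -Hf; lia).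
  move=> eUa eVa eVb eUb Hk Hj.
  have m1U := @cnt_mono U1 k.+1 j ltac:(lia); have lU := @cnt_lip U1 k.+1 j ltac:(lia).
  have lV1 := @cnt_lip V1 j n ltac:(lia); have mU1 := @cnt_mono U1 j n ltac:(lia).
  have lV2 := @cnt_lip V2 k.+1 n ltac:(lia).
  have := UV2 n (leqnn n); have uv := UV1 n (leqnn n).
  have cU := cnt_le U1 n; have cV := cnt_le V1 n; have uvj := UV1 j ltac:(lia) => uv2.
  set r := n + cnt V1 j + 1 - (j + d1); set t' := n + cnt V2 k.+1 + 1 - (k.+1 + d2).
  have Er : r + j + d1 = n + cnt V1 j + 1.
    by rewrite /r; clear -S1 lV1 mU1 uv jn; lia.
  have Es : t' + k.+1 + d2 = n + cnt V2 k.+1 + 1.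
    by rewrite /t'; clear -S2 lV2 uv2 jn Ej; lia.
  move: (r) (t') Er Es => {r t'} r t' Er Es.
  have N1 : cnt U1 j < r by clear - Er S1 mU1 lV1 jn; lia.
  have N2 : r <= t' by clear - Er Es eUa eVa eVb eUb Hk Hj Hf lU d12 Ej; lia.
  have := b2 k.+1 j _ _ _ _ isT ltac:(lia) jn m1U N1 N2; rewrite !ent1 !ent2 => /imp_lt; apply; first by left; split; [apply/L1|apply/L1|apply/L1|apply/L2]; split; rewrite ?Ua ?Va ?Ub ?Vb //; lia.
  by clear - Er Es eUa eVa eVb eUb Hk Hj Hf lU d12 m1U; lia.
have A k j : k <= j -> j < n -> condA k j.
  move=> /subnK; move: (j - k) => t; elim: t k j => [|t IH] k j Ej jn.
    by rewrite -Ej add0n; apply: HA; lia.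
  have Hk : condA k j.-1 by apply: IH; lia.
  have Hj : condA k.+1 j by apply: IH; lia.
  rewrite /condA leqNgt; apply/negP => Hf; move: Hk Hj; rewrite /condA.
  have := @cntP U2 j ltac:(lia); have := @cntP V2 j ltac:(lia).
  have := cntS V2 k; have := cntS U1 k.
  case Ua: (U1 k.+1); case Va: (V2 k.+1); case Ub: (U2 j); case Vb: (V2 j); try (clear -Hf; lia).
  move=> eUa eVa eVb eUb Hk Hj.
  have m1V := @cnt_mono V2 k.+1 j ltac:(lia); have lV := @cnt_lip V2 k.+1 j ltac:(lia).
  have lV1 := @cnt_lip V2 j n ltac:(lia); have mU1 := @cnt_mono U2 j n ltac:(lia).
  have lV2 := @cnt_lip V2 k.+1 n ltac:(lia); have uv2 := UV2 n (leqnn n).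
  set r := n + cnt V2 j + 1 - (j + d2); set t' := n + cnt V2 k.+1 + 1 - (k.+1 + d2).
  have Er : r + j + d2 = n + cnt V2 j + 1.
    by rewrite /r; clear -S2 lV1 mU1 uv2 jn; lia.
  have Es : t' + k.+1 + d2 = n + cnt V2 k.+1 + 1.
    by rewrite /t'; clear -S2 lV2 uv2 jn Ej; lia.
  move: (r) (t') Er Es => {r t'} r t' Er Es.
  have N0 : cnt U1 k.+1 <= cnt U2 j by clear - eUa eVa Hk Hj Hf m1V eVb eUb; lia.
  have N1 : cnt U2 j < r by clear - Er S2 mU1 lV1 jn; lia.
  have N2 : r <= t' by clear - Er Es lV Ej; lia.
  have := b2 k.+1 j _ _ _ _ isT ltac:(lia) jn N0 N1 N2; rewrite !ent1 !ent2 => /imp_lt; apply; first by right; split; [apply/L1|apply/L2|apply/L2|apply/L2]; split; rewrite ?Ua ?Va ?Ub ?Vb //; lia.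
  by clear - Er Es eUa eVa eVb eUb Hk Hj Hf lV N0; lia.
have C k : k <= n -> condC k.
  move=> /subnK; move: (n - k) => t; elim: t k => [|t IH] k Ek.
    by rewrite -(add0n k) Ek.
  have Hk : condC k.+1 by apply: IH; lia.
  rewrite /condC leqNgt; apply/negP => Hf; move: Hk; rewrite /condC.
  have := cntS V2 k; have := cntS U1 k.
  case Ua: (U1 k.+1); case Va: (V2 k.+1); try (clear -Hf; lia).
  move=> eUa eVa Hk.
  case: (ltnP k.+1 n) => kn; last first.
    have Ekn : k.+1 = n by lia.
    rewrite Ekn in Ua Va eUa eVa Hk; apply: (b4 (cnt U1 n) (cnt U1 n).+1 (leqnn _)).
    rewrite ent1 ent2; split; rewrite !inE.
      have -> : lev c1 (cnt U1 n) = Some (Bar n); last by rewrite eqxx orbT.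
      by apply/L1; split=> //; lia.
    have -> : lev c2 (cnt U1 n).+1 = Some (Pos n); last by rewrite eqxx.
    by apply/L2; split; rewrite ?Va //; clear - eUa eVa Hk Hf n2; lia.
  have HB' := B k n.-1 ltac:(lia) ltac:(lia); rewrite /condB in HB'.
  have lU := @cnt_lip U1 k.+1 n.-1 ltac:(lia); have mU := @cnt_mono U1 k.+1 n.-1 ltac:(lia).
  set s := n + cnt V2 k.+1 + 1 - (k.+1 + d2).
  have Es : s + k.+1 + d2 = n + cnt V2 k.+1 + 1.
    by rewrite /s; clear -eUa eVa Hk Hf kn; lia.
  move: (s) Es => {}s Es.
  have N1 : cnt U1 k.+1 <= (cnt U1 n.-1).+1 by lia.
  have N2 : (cnt U1 n.-1).+2 <= s by clear - Es lU eUa eVa Hk Hf kn n2; lia.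
  have := b3 k.+1 _ _ _ _ isT kn N1 (leqnn _) erefl N2; rewrite !ent1 !ent2 => /imp_lt; apply; last by clear - Es N1 N2 eUa eVa Hk Hf kn n2; lia.
    left; split; [apply/L1|apply/L2|apply: lev_mid1|apply: lev_mid1].
    - by split=> //; lia.
    - by split; rewrite ?Va //; lia.
    - by [].
    - by clear -HB' eUa eVa Hk Hf d12; lia.
    - by lia.
    - by clear -HB' eUa eVa Hk Hf d12; lia.
apply/pair_goodE; split=> // k j Hj.
  have [jn|jn] := ltnP j n; first by apply: A => //; lia.
  have -> : j = n by lia.
  by have := C k ltac:(lia); rewrite /condC /condA; clear -S2; lia.
have [jn|jn] := ltnP j n; first by apply: B => //; lia.
have -> : j = n by lia.
by have := C k ltac:(lia); rewrite /condC /condB; clear -S1 d12; lia.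
Qed.

Lemma pair_good_KN : pair_good n d2 d1 V2 U2 V1 U1 -> pair_KN n c2 c1.
Proof.
move=> /pair_goodE [HA HB HC]; have [UV2 S2] := St2; have [UV1 S1] := St1.
have L2 i x := lev_kcol i x d2n St2; have L1 i x := lev_kcol i x d1n St1.
split.
- by apply/rowsE; split=> [k kn|k kn|]; [apply: HA|apply: HB|apply: HC]; lia.
- move=> a b p q r s a1 ab bn pq qr rs; rewrite !ent1 !ent2.
  have eVa := @cntP V2 a a1; have eUa := @cntP U1 a a1.
  case=> [[/L1[_ Ua Ep] /L1[_ Ub Eq] /L1[_ Vb Er] /L2[_ Va Es]]
         |[/L1[_ Ua Ep] /L2[_ Ub Eq] /L2[_ Vb Er] /L2[_ Va Es]]].
    have := HB a.-1 b ltac:(lia); rewrite /condB; move: eVa eUa; rewrite Ua (negbTE Va) /=.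
    have := @cnt_mono U1 a b ab; clear -Ep Eq Er Es d12 rs; lia.
  have := HA a.-1 b ltac:(lia); rewrite /condA; move: eVa eUa; rewrite Ua (negbTE Va) /=.
  have := @cnt_mono U1 a b ab; clear -Ep Eq Er Es d12 pq rs; lia.
- move=> a p q r s a1 an pq qr Er rs mid'; rewrite !ent1 !ent2 => H.
  have [Ep Es] : lev c1 p = Some (Bar a) /\ lev c2 s = Some (Pos a) by case: H => [[? ? _ _]|[? ? _ _]].
  have eVa := @cntP V2 a a1; have eUa := @cntP U1 a a1.
  move/L1: Ep => [_ Ua Ep]; move/L2: Es => [_ Va Es].
  have := HC a.-1 ltac:(lia); rewrite /condC; move: eVa eUa; rewrite Ua (negbTE Va) /=.
  by clear -Ep Es Er rs pq an; lia.
- move=> p q pq; rewrite !ent1 !ent2 => -[].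
  have Cn := HC n (leqnn n); have Cn1 := HC n.-1 ltac:(lia); rewrite /condC in Cn Cn1.
  have eVn := @cntP V2 n ltac:(lia); have eUn := @cntP U1 n ltac:(lia).
  rewrite !inE => /orP[/eqP/L1 Hp|/eqP/L1[_ Hp Ep]] /orP[/eqP/L2[_ Hq Eq]|/eqP/L2 Hq].
  + by clear - Hp Eq pq Cn; lia.
  + by clear - Hp Hq pq Cn S2; lia.
  + by rewrite Hp (negbTE Hq) /= in eVn eUn; clear - Ep Eq pq Cn1 eVn eUn; lia.
  + by clear - Ep Hq pq Cn S2; lia.
Qed.
End Pair.

Lemma bars_lle d n (L R : nat -> bool) :
  (forall i, i + d < cnt L n -> i < cnt R n ->
     lle (nth Zero (bars n L) (i + d)) (nth Zero (bars n R) i)) <->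
  sst (two_col d (bars n L) (bars n R)).
Proof.
split=> [H|/sst_two_colP H i iL iR].
  apply/sst_two_colP => i a b Ra Lb.
  have := H i; rewrite -!(size_bars n) (onth_size Ra) (onth_size Lb) => /(_ isT isT).
  have nthE (s : col) j x : onth s j = Some x -> nth Zero s j = x.
    by elim: s j => [|y s IH] [|j] //=; [case|apply: IH].
  rewrite (nthE _ _ _ Ra) (nthE _ _ _ Lb) /lle /=.
  by case: eqP => [[->]//|_] /=; lia.
have [x Lx] : exists x, onth (bars n L) (i + d) = Some x by apply: onth_some; rewrite size_bars.
have [y Ry] : exists y, onth (bars n R) i = Some y by apply: onth_some; rewrite size_bars.
have nthE (s : col) j z : onth s j = Some z -> nth Zero s j = z.
  by elim: s j => [|t s IH] [|j] //=; [case|apply: IH].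
rewrite (nthE _ _ _ Lx) (nthE _ _ _ Ry).
case: x Lx => [a||a] Lx; try by move/onth_bars: Lx.
case: y Ry => [b||b] Ry; try by move/onth_bars: Ry.
have := H _ _ _ Ry Lx; rewrite /lle /= leq_eqVlt => /orP[/eqP->|->]; first by rewrite eqxx.
by rewrite orbT.
Qed.

Section Spinors.
Variable n : nat.
Hypothesis n2 : 1 < n.

Lemma outer_psi d V m U : d <= n -> kn_state n d V m U ->
  outer_cols (psi n (kcol n V m U)) = (bars n U, bars n V).
Proof.
move=> dn St; have [UV Sn] := St; rewrite /outer_cols (psiE n2 dn St) /=.
by have -> := @iter_calE n d U V UV ltac:(lia).
Qed.

Lemma cnt_LR d V m U : kn_state n d V m U ->
  cnt (lbit n d U V) n = cnt U n + d /\ cnt V n = cnt (rbit n d U V) n + d.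
Proof.
move=> [UV Sn]; rewrite cnt_lbit // cnt_rbit // nu_n //; lia.
Qed.

Lemma prec_colsE d2 d1 V2 m2 U2 (l1 U1 : nat -> bool) : d2 <= n ->
  kn_state n d2 V2 m2 U2 -> cnt l1 n = cnt U1 n + d1 -> d1 <= d2 ->
  prec_cols (psi n (kcol n V2 m2 U2)) d1 (bars n l1) (bars n U1) <->
  (forall k, k <= n -> cnt (rbit n d2 U2 V2) k <= cnt U1 k /\
     cnt V2 k <= cnt l1 k + (d2 - d1)).
Proof.
move=> d2n St E1 d12; rewrite /prec_cols.
have -> : psi n (kcol n V2 m2 U2) = (d2, (bars n (lbit n d2 U2 V2), bars n (rbit n d2 U2 V2))).
  exact: psiE.
rewrite -(psiE n2 d2n St) (outer_psi d2n St) /= !size_bars.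
have [_ EV] := cnt_LR St; split=> [[H1 H2 H3] k kn|H].
  have S2 : sst (two_col 0 (bars n (rbit n d2 U2 V2)) (bars n U1)).
    by apply/bars_lle => i; rewrite addn0; apply: H2.
  have S3 : sst (two_col (d2 - d1) (bars n V2) (bars n l1)) by apply/bars_lle.
  split.
    by have := (@sst_two_col 0 n (rbit n d2 U2 V2) U1 ltac:(lia)).1 S2 k kn; rewrite addn0.
  exact: (@sst_two_col (d2 - d1) n V2 l1 ltac:(lia)).1 S3 k kn.
have [Hn1 Hn2] := H n (leqnn n); split; first by lia.
  have S2 : sst (two_col 0 (bars n (rbit n d2 U2 V2)) (bars n U1)).
    by apply/sst_two_col; [lia|move=> k /H[]; rewrite addn0].
  by move=> i; have := (bars_lle 0 n _ _).2 S2 i; rewrite addn0.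
by apply/bars_lle/sst_two_col => // k /H[].
Qed.

Lemma prec_psi d2 d1 V2 m2 U2 V1 m1 U1 : d1 <= d2 -> d2 <= n ->
  kn_state n d2 V2 m2 U2 -> kn_state n d1 V1 m1 U1 ->
  prec (psi n (kcol n V2 m2 U2)) (psi n (kcol n V1 m1 U1)) <->
  pair_good n d2 d1 V2 U2 V1 U1.
Proof.
move=> d12 d2n St2 St1; have d1n := leq_trans d12 d2n.
rewrite /prec (outer_psi d1n St1) (psiE n2 d1n St1) /=; apply: prec_colsE => //.
by have [] := cnt_LR St1.
Qed.

Lemma lbit0 (U V : nat -> bool) k : (forall k, k <= n -> cnt U k <= cnt V k) ->
  k <= n -> cnt (lbit n 0 U V) k = cnt U k.
Proof. by move=> UV kn; rewrite cnt_lbit //; have := @nu_led n 0 U V k; lia. Qed.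

Lemma prec_sp_psi d2 V2 m2 U2 V1 U1 : d2 <= n ->
  kn_state n d2 V2 m2 U2 -> (forall k, k <= n -> cnt U1 k <= cnt V1 k) ->
  prec_sp (psi n (kcol n V2 m2 U2)) (bars n U1) <->
  pair_good n d2 0 V2 U2 V1 U1.
Proof.
move=> d2n St2 UV; rewrite /prec_sp (prec_colsE d2n St2) ?addn0 //.
by split=> H k kn; have := H k kn; rewrite lbit0.
Qed.

Lemma in_T_b_psi d V m U : d < n -> kn_state n d V m U ->
  in_T_b n d (psi n (kcol n V m U)).
Proof.
move=> dn St; have dn' := ltnW dn; rewrite (psiE n2 dn' St) /in_T_b eqxx dn all_cat !all_bars /=.
have LR := LR_le n2 dn' St; have [UV Sn] := St; have [E1 E2] := cnt_LR St.
have LRn := LR n (leqnn n).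
have Hs : d <= cnt (lbit n d U V) n <= cnt (rbit n d U V) n + d by lia.
rewrite !size_bars Hs /=; apply/andP; split; first by apply/sst_two_col.
apply/(slide_rank0 Hs LR).
have [k [kn Ek Hk]] := @last_eq n d U V ltac:(lia).
exists k => //; rewrite cnt_lbit // cnt_rbit //.
have -> : nu n d U V k = d; last by lia.
apply/eqP; rewrite eqn_leq nu_led; last by lia.
apply/nu_ge; first by lia.
split=> // j Hj; have [->|ne] := eqVneq j k; first by lia.
by have := Hk j ltac:(lia); lia.
Qed.

Definition KNc (d : nat) (c : col) : Prop :=
  exists V m U, c = kcol n V m U /\ kn_state n d V m U.

Lemma in_T_b_surj d T : in_T_b n d T -> exists2 c, KNc d c & psi n c = T.
Proof.
case: T => a [L R]; rewrite /in_T_b => /and5P[/eqP-> dn bLR Hs /andP[sT /eqP sr]].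
move: bLR; rewrite all_cat => /andP[bL bR].
have /andP[/= /and3P[oR oL _] _] := sT.
move: (bars_canon oL bL) (bars_canon oR bR) sT sr Hs => EL ER.
rewrite {}EL {}ER; move: (fun k => Bar k \in L) (fun k => Bar k \in R) => l r sT sr; rewrite !size_bars => Hs.
have LR : forall k, k <= n -> cnt l k <= cnt r k + d by apply/sst_two_col => //; lia.
have ex : exists2 k, k <= n & cnt l k = cnt r k + d by apply/slide_rank0 => //; apply/eqP.
have [U [V [UV EU EV Ef]]] := Fcols_surj LR ex.
have St : kn_state n d V (cnt V n - cnt U n - d) U by split=> //; lia.
exists (kcol n V (cnt V n - cnt U n - d) U); first by do 3 eexists.
have dn' := ltnW dn; rewrite /psi (size_kcol n2 dn' St) /Psi_col minus_kcol plus_kcol.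
have -> : n - (n - d) = d by lia.
by rewrite Ef.
Qed.

Lemma eq_bars_inv (f g : nat -> bool) : bars n f = bars n g ->
  forall k, 1 <= k <= n -> f k = g k.
Proof.
by move=> E k Hk; have := mem_bars n f (Bar k); rewrite E mem_bars Hk /=.
Qed.

Lemma psi_inj d c c' : d <= n -> KNc d c -> KNc d c' -> psi n c = psi n c' -> c = c'.
Proof.
move=> dn [V [m [U [-> St]]]] [V' [m' [U' [-> St']]]] E.
have := outer_psi dn St; rewrite E (outer_psi dn St') => -[EU EV].
have [_ Sn] := St; have [_ Sn'] := St'.
have := congr1 size EU; have := congr1 size EV; rewrite !size_bars => c1 c2.
have -> : m' = m by lia.
apply: eq_kncol => k Hk; first by rewrite (eq_bars_inv EV Hk).
by rewrite (eq_bars_inv EU Hk).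
Qed.

Lemma KNcP d c : d <= n -> KNc d c <->
  [/\ size c = n - d, all (in_J n) c, col_ok c &
      forall a i1 i2, 1 <= a -> i1 < i2 -> lev c i1 = Some (Bar a) ->
        lev c i2 = Some (Pos a) -> i1 + (size c - i2 + 1) <= a].
Proof.
move=> dn; split=> [[V [m [U [-> St]]]]|[Sc Jc Oc b1]].
  rewrite (size_kcol n2 dn St); split=> //; [exact: all_kncol|exact: col_ok_kncol|].
  move=> a i1 i2 a1 i12 /(lev_kcol _ _ dn St)[Ha Ua E1] /(lev_kcol _ _ dn St)[_ Va E2].
  have [UV Sn] := St; have := UV a ltac:(lia); have := cnt_negb V a.
  have := @cnt_lip V a n ltac:(lia); have := @cntP (fun j => ~~ V j) a a1.
  rewrite Va; have := cnt_le V n; clear - E1 E2 Ha i12; lia.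
have Ec := kncol_canon Oc Jc.
set u := (fun k => Bar k \in c) in Ec; set p := (fun k => Pos k \in c) in Ec.
set m := count_mem Zero c in Ec.
have Np := cnt_negb p n.
have Sn : cnt u n + m + cnt p n = n - d by rewrite -(size_kncol n p m u) -Ec.
exists (fun k => ~~ p k), m, u; split.
  by rewrite {1}Ec; apply: eq_kncol => // k _; rewrite negbK.
split; last by lia.
elim=> [|k IH] kn //; have {}IH := IH (ltnW kn).
rewrite leqNgt; apply/negP => Hk; move: Hk.
have := cntS u k; have := cntS (fun k => ~~ p k) k.
case pk: (p k.+1); case uk: (u k.+1) => E1 E2 Hk; try (move: E1 E2 Hk; clear -IH; lia).
have Nk := cnt_negb p k.+1; have mU := @cnt_mono u k.+1 n kn; have mp := @cnt_mono p k.+1 n kn.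
have := b1 k.+1 (cnt u k.+1) (cnt u n + m + cnt p n - cnt p k.+1).+1 isT ltac:(clear -mU mp; lia).
rewrite /lev /= => b1'.
have {}b1' : cnt u k.+1 + (size c - (cnt u n + m + cnt p n - cnt p k.+1).+1 + 1) <= k.+1.
  apply: b1'.
    rewrite ifT; last by lia.
    by rewrite Ec; apply/onth_kncol; split=> //; lia.
  rewrite {1}Ec; apply/onth_kncol; split=> //; lia.
have := @cntP p k.+1 isT; rewrite pk /=.
by move: b1' Nk mU mp E1 E2 Hk; rewrite Sc; clear -Sn Np; lia.
Qed.
End Spinors.

Definition pgood (n d e : nat) (V U U1 L1 : nat -> bool) : Prop :=
  forall k, k <= n -> cnt (rbit n d U V) k <= cnt U1 k /\ cnt V k <= cnt L1 k + e.

Lemma le_f n i (X Y : nat -> bool) e : 1 <= i < n ->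
  (forall k, k <= n -> cnt X k <= cnt Y k + e) ->
  gphi n i X -> ~~ gphi n i Y -> cnt X i + 1 <= cnt Y i + e.
Proof.
move=> Hi H; have iln : i < n by lia.
have i0 : 0 < i by lia.
have H0 := H i.-1 ltac:(lia); have H1 := H i ltac:(lia); have H2 := H i.+1 iln.
move: H0 H1 H2; rewrite !cntS (cntP X i0) (cntP Y i0) /gphi iln /=.
by case: (X i); case: (Y i); case: (X i.+1); case: (Y i.+1) => //=; clear; lia.
Qed.

Lemma le_e n i (X Y : nat -> bool) e : 1 <= i <= n ->
  (forall k, k <= n -> cnt X k <= cnt Y k + e) ->
  geps n i Y -> ~~ geps n i X -> cnt X i + 1 <= cnt Y i + e.
Proof.
move=> Hi H; have i0 : 0 < i by lia.
have H0 := H i.-1 ltac:(lia); have H1 := H i ltac:(lia); have H2 := H i.+1.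
move: H0 H1 H2; rewrite !cntS (cntP X i0) (cntP Y i0) /geps.
case: (ltnP i n) => iln /= H0 H1 H2.
  move: H0 H1 (H2 isT); clear H H2.
  by case: (X i); case: (Y i); case: (X i.+1); case: (Y i.+1) => //=; clear; lia.
by move: H0 H1; case: (X i); case: (Y i) => //=; clear; lia.
Qed.

Section Stability.
Variables (n d d1 i : nat).
Hypothesis n2 : 1 < n.
Hypothesis d1d : d1 <= d.
Hypothesis dn : d <= n.
Hypothesis Hi : 1 <= i <= n.
Variables (V U : nat -> bool) (m : nat).
Hypothesis St : kn_state n d V m U.
Variables (U1 L1 : nat -> bool).
Hypothesis EL : cnt L1 n = cnt U1 n + d1.
Hypothesis G : pgood n d (d - d1) V U U1 L1.
Let L := lbit n d U V.
Let R := rbit n d U V.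

Let beps_lt : i < n -> beps n i V U = beps n i R L.
Proof. by move=> iln; have [_ _ /(_ iln)[]] := col_vals n2 dn St Hi. Qed.

Lemma pgood_fl (V' U' : nat -> bool) :
  (beps n i R L = 0 -> (i < n -> ~~ gphi n i U1) /\ ~~ gphi n i L1) ->
  moved n d true i (if i < n then f_left n i V U else f_left n i R L) (f_left n i R L) V U V' U' ->
  pgood n d (d - d1) V' U' U1 L1.
Proof.
move=> H mv k kn; have [G1 G2] := G kn; have [_ /= sV _ /= sR] := mv k kn.
rewrite {}sV {}sR; have [ki|ki] := eqVneq k i; last by rewrite !mul0n !addn0.
subst k; rewrite !mul1n.
have f1b (X Y : nat -> bool) : f_left n i X Y -> beps n i X Y = 0.
  by rewrite /f_left /beps /e_right => /andP[/gphi_geps-> /negbTE->].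
case: (ltnP i n) => iln.
  have Hi' : 1 <= i < n by lia.
  split.
    case yE: (f_left n i R L); last by rewrite addn0.
    have [/(_ iln) nU _] := H (f1b _ _ yE).
    have := @le_f n i R U1 0 Hi'; rewrite !addn0; apply=> //.
      by move=> j /G[]; rewrite addn0.
    by case/andP: yE.
  case xE: (f_left n i V U); last by rewrite addn0.
  have [_ nL] : (i < n -> ~~ gphi n i U1) /\ ~~ gphi n i L1.
    by apply: H; rewrite -beps_lt //; apply: f1b.
  have := @le_f n i V L1 (d - d1) Hi'; apply=> //.
    by move=> j /G[].
  by case/andP: xE.
have Ei : i = n by lia.
case yE: (f_left n i R L); last by rewrite !addn0.
have [_ nL] := H (f1b _ _ yE).
move: yE nL; rewrite Ei /f_left !gphi_n geps_n negbK => /andP[Rn Ln] L1n.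
have [E1 E2] := cnt_LR n2 St; have B := LR_bits n2 dn St (k := n) ltac:(lia).
have Vn : V n = false.
  by move: B; rewrite -/L -/R (negbTE Rn) (negbTE Ln); case: (V n) => //; lia.
have := @cntP V n ltac:(lia); have := @cntP L1 n ltac:(lia); rewrite Vn L1n.
have [_] := G (k := n.-1) ltac:(lia).
by move: E2 EL d1d; clear; lia.
Qed.

Lemma pgood_er (U1' L1' : nat -> bool) (x y : bool) :
  (~~ x -> geps n i U1 /\ beps n i R L = 0) ->
  (i < n -> ~~ y -> geps n i L1 /\ beps n i R L = 0) -> (i = n -> x = y) ->
  (forall k, k <= n -> step false k i (cnt U1 k) (cnt U1' k) (~~ x) /\
                       step false k i (cnt L1 k) (cnt L1' k) (~~ y)) ->
  pgood n d (d - d1) V U U1' L1'.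
Proof.
move=> Hx Hy xy mv k kn; have [G1 G2] := G kn; have [/= sU sL] := mv k kn.
move: sU sL; have [ki|ki] := eqVneq k i; last first.
  by rewrite !mul0n !addn0 => <- <-.
subst k; rewrite !mul1n.
have bR : beps n i R L = 0 -> ~~ geps n i R by rewrite /beps; case: geps.
have HR : ~~ x -> cnt R i + 1 <= cnt U1 i.
  move=> /Hx[gU /bR gR]; have := @le_e n i R U1 0 Hi; rewrite addn0; apply=> //.
  by move=> j /G[]; rewrite addn0.
case: (ltnP i n) => iln sU sL.
  have HV : ~~ y -> cnt V i + 1 <= cnt L1 i + (d - d1).
    move=> /(Hy iln)[gL]; rewrite -beps_lt // => gV; apply: (@le_e n i) => //.
      by move=> j /G[].
    by move: gV; rewrite /beps; case: geps.
  split.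
    by move: sU HR G1; rewrite -/R; case: (x) => /= -> => [|/(_ isT)]; clear; lia.
  by move: sL HV G2; case: (y) => /= -> => [|/(_ isT)]; clear; lia.
have Ei : i = n by lia.
move: HR sU sL; rewrite -(xy Ei); have [_ E2] := cnt_LR n2 St.
move: G1 G2 E2; rewrite -/R Ei; case: (x) => /= G1 G2 E2.
  by clear -G1 G2 EL d1d E2 => _; lia.
by move=> /(_ isT); move: G1 G2 E2 EL d1d; clear; lia.
Qed.
End Stability.

Definition padj (n : nat) (c2 c1 : col) : Prop :=
  exists d2 d1 V2 m2 U2 V1 m1 U1,
  [/\ d1 <= d2 <= n, c2 = kcol n V2 m2 U2 /\ kn_state n d2 V2 m2 U2,
      c1 = kcol n V1 m1 U1 /\ kn_state n d1 V1 m1 U1 & pair_good n d2 d1 V2 U2 V1 U1].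

Section Adjacent.
Variable n : nat.
Hypothesis n2 : 1 < n.
Implicit Types c : col_crystal n.

Lemma padj_fl i c2 c1 c2' : 1 <= i <= n -> padj n c2 c1 -> tf i c2 = Some c2' ->
  (phi i c1 <= eps i c2)%R -> padj n c2' c1.
Proof.
move=> Hi [d2 [d1 [V2 [m2 [U2 [V1 [m1 [U1 [/andP[d12 d2n] [-> St2] [-> St1] G]]]]]]]]].
have d1n := leq_trans d12 d2n.
have := col_tf n2 d2n St2 Hi; cbv zeta; case: ifP => [_|_ -> //].
move=> [V' [m' [U' [-> St' mv _]]]] [<-].
have [-> _ _] := col_vals n2 d2n St2 Hi; have [_ -> bl] := col_vals n2 d1n St1 Hi.
rewrite ler_nat => Hpe.
exists d2, d1, V', m', U', V1, m1, U1; split=> //; first by rewrite d12.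
apply: (pgood_fl n2 d12 d2n Hi St2 _ G) mv => //.
  by have [] := cnt_LR n2 St1.
move=> b0; rewrite b0 leqn0 in Hpe.
split=> [iln|]; last by move: Hpe; rewrite /bphi; case: gphi.
by have [_ E] := bl iln; move: Hpe; rewrite -E /bphi; case: gphi.
Qed.

Lemma padj_fr i c2 c1 c1' : 1 <= i <= n -> padj n c2 c1 -> tf i c1 = Some c1' ->
  padj n c2 c1'.
Proof.
move=> Hi [d2 [d1 [V2 [m2 [U2 [V1 [m1 [U1 [/andP[d12 d2n] [-> St2] [-> St1] G]]]]]]]]].
have d1n := leq_trans d12 d2n.
have := col_tf n2 d1n St1 Hi; cbv zeta; case: ifP => [_|_ -> //].
move=> [V' [m' [U' [-> St' mv _]]]] [<-].
exists d2, d1, V2, m2, U2, V', m', U'; split=> //; first by rewrite d12.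
move=> k kn; have [G1 G2] := G k kn; have [/= sU _ /= sL _] := mv k kn.
by rewrite {}sU {}sL; move: G1 G2; clear; lia.
Qed.

Lemma padj_el i c2 c1 c2' : 1 <= i <= n -> padj n c2 c1 -> te i c2 = Some c2' ->
  padj n c2' c1.
Proof.
move=> Hi [d2 [d1 [V2 [m2 [U2 [V1 [m1 [U1 [/andP[d12 d2n] [-> St2] [-> St1] G]]]]]]]]].
have := col_te n2 d2n St2 Hi; cbv zeta; case: ifP => [_|_ -> //].
move=> [V' [m' [U' [-> St' mv _]]]] [<-].
exists d2, d1, V', m', U', V1, m1, U1; split=> //; first by rewrite d12.
move=> k kn; have [G1 G2] := G k kn; have [_ /= sV _ /= sR] := mv k kn.
by move: sV sR G1 G2; clear => -> ->; lia.
Qed.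

Lemma te_col_bits i d V m U : d <= n -> kn_state n d V m U -> 1 <= i <= n ->
  forall c', te i (kcol n V m U : col_crystal n) = Some c' ->
  let l := lbit n d U V in let r := rbit n d U V in
  exists x y V' m' U', [/\ c' = kcol n V' m' U', kn_state n d V' m' U',
    moved n d false i x y V U V' U' &
    [/\ ~~ x -> geps n i U /\ bphi n i r l = 0,
        ~~ y -> geps n i l /\ bphi n i r l = 0 & i = n -> x = y]].
Proof.
move=> dn St Hi c'; cbv zeta; have := col_te n2 dn St Hi; cbv zeta.
have [_ _ bl] := col_vals n2 dn St Hi.
case: ifP => [He|_ -> //] [V' [m' [U' [-> St' mv [H1 H2]]]]] [<-].
have e2b (X Y : nat -> bool) : e_right n i X Y -> geps n i Y /\ bphi n i X Y = 0.
  rewrite /e_right /bphi /f_left => /andP[gY gX]; rewrite gY (negbTE gX); split=> //.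
  by have := gphi_gepsN n i Y; rewrite gY andbT => /negbTE->.
exists (if i < n then e_left n i V U else e_left n i (rbit n d U V) (lbit n d U V)).
exists (e_left n i (rbit n d U V) (lbit n d U V)), V', m', U'; split=> //; split.
- case: ltnP => iln nx.
    have [_ <-] := bl iln; apply: e2b.
    by move: (H1 iln); rewrite (negbTE nx).
  have Ei : i = n by lia.
  split; first by rewrite Ei geps_n; apply: H2.
  by move: He; rewrite (negbTE nx) /= => /e2b[].
- by move=> ny; apply: e2b; move: He; rewrite (negbTE ny).
- by move=> Ei; rewrite ifF //; lia.
Qed.

Lemma padj_er i c2 c1 c1' : 1 <= i <= n -> padj n c2 c1 -> te i c1 = Some c1' ->
  (eps i c2 <= phi i c1)%R -> padj n c2 c1'.
Proof.
move=> Hi [d2 [d1 [V2 [m2 [U2 [V1 [m1 [U1 [/andP[d12 d2n] [-> St2] [-> St1] G]]]]]]]]].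
have d1n := leq_trans d12 d2n.
move=> /(te_col_bits d1n St1 Hi)[x [y [V' [m' [U' [-> St' mv [Hx Hy xy]]]]]]].
have [-> _ _] := col_vals n2 d2n St2 Hi; have [_ -> _] := col_vals n2 d1n St1 Hi.
rewrite ler_nat => Hpe.
exists d2, d1, V2, m2, U2, V', m', U'; split=> //; first by rewrite d12.
apply: (pgood_er n2 d12 d2n Hi St2 (x := x) (y := y) _ G _ _ xy) => //.
- by have [] := cnt_LR n2 St1.
- by move=> /Hx[gU b0]; split=> //; move: Hpe; rewrite b0; clear; lia.
- by move=> _ /Hy[gU b0]; split=> //; move: Hpe; rewrite b0; clear; lia.
- by move=> k kn; have [] := mv k kn.
Qed.

Lemma te_size i c c' : te i c = Some c' -> size c' = size c.
Proof.
rewrite -[te i c]/(omap rev (te i (rev c : words n))).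
by case E: (te i (rev c : words n)) => [w|] // [<-]; rewrite size_rev (word_te_size E) size_rev.
Qed.

Lemma tf_size i c c' : tf i c = Some c' -> size c' = size c.
Proof.
rewrite -[tf i c]/(omap rev (tf i (rev c : words n))).
by case E: (tf i (rev c : words n)) => [w|] // [<-]; rewrite size_rev (word_tf_size E) size_rev.
Qed.

Lemma KNc_tf i d c c' : d <= n -> 1 <= i <= n -> KNc n d c -> tf i c = Some c' -> KNc n d c'.
Proof.
move=> dn Hi [V [m [U [-> St]]]]; have := col_tf n2 dn St Hi; cbv zeta; case: ifP => [_|_ -> //].
by move=> [V' [m' [U' [-> St' _ _]]]] [<-]; exists V', m', U'.
Qed.

Lemma KNc_te i d c c' : d <= n -> 1 <= i <= n -> KNc n d c -> te i c = Some c' -> KNc n d c'.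
Proof.
move=> dn Hi [V [m [U [-> St]]]]; have := col_te n2 dn St Hi; cbv zeta; case: ifP => [_|_ -> //].
by move=> [V' [m' [U' [-> St' _ _]]]] [<-]; exists V', m', U'.
Qed.

Fixpoint chain (s : seq col) : Prop :=
  if s is c1 :: s' then
    [/\ exists2 d, d <= n & KNc n d c1, (if s' is c2 :: _ then padj n c2 c1 else True) &
        chain s']
  else True.

Lemma chain_J s : chain s -> all_in (fun c => all (in_J n) c) s.
Proof.
elim: s => //= c s IH [[d _ [V [m [U [-> _]]]]] _ /IH H]; split=> //.
exact: all_kncol.
Qed.

Lemma chain_tf i (s t : tensor_seq (col_crystal n)) : 1 <= i <= n -> chain s -> tf i s = Some t ->
  [/\ chain t, map size t = map size s &
    exists c s' c' t', [/\ s = c :: s', t = c' :: t' &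
      c' = c \/ tf i (c : col_crystal n) = Some c' /\ eps i s = eps i (c : col_crystal n)]].
Proof.
move=> Hi; elim: s t => [|c1 s IH] t //; rewrite [chain _]/= => -[K1 A C]; have [d dn Kd] := K1.
rewrite tseq_tf_cons; case: ifP => [ef|/negbT]; last rewrite -leNgt => fe.
  case E: tf => [c'|] // [<-]; split.
  - split=> //; first by exists d => //; apply: KNc_tf E.
    by case: s A {IH C ef} => // c2 s A; apply: padj_fr E.
  - by rewrite [LHS]/= (tf_size E).
  - exists c1, s, c', s; split=> //; right; split=> //.
    have [V [m [U [Ec St]]]] := Kd.
    have Jc : all (in_J n) c1 by rewrite Ec; apply: all_kncol.
    have [_ /(_ i Hi)[Ep _ _ _ _]] := (col_regular n2).1 c1 Jc.
    by rewrite tseq_eps_cons; move: ef Ep => /=; lia.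
case E: tf => [t'|] // [<-]; have [C' Es [c [s1 [c' [t1 [Es1 Et1 H]]]]]] := IH _ C E.
split; last (by exists c1, s, c1, t'; split=> //; left); last by rewrite /= Es.
split=> //; rewrite Et1; rewrite Es1 in A; case: H => [->|[E' Ee]] //.
by apply: (padj_fl Hi A E'); rewrite -Ee.
Qed.

Lemma chain_te i (s t : tensor_seq (col_crystal n)) : 1 <= i <= n -> chain s -> te i s = Some t ->
  [/\ chain t, map size t = map size s &
    exists c s' c' t', [/\ s = c :: s', t = c' :: t' &
      c' = c \/ te i (c : col_crystal n) = Some c']].
Proof.
move=> Hi; elim: s t => [|c1 s IH] t //; rewrite [chain _]/= => -[K1 A C]; have [d dn Kd] := K1.
rewrite tseq_te_cons; case: ifP => [ef|_].
  case E: te => [c'|] // [<-]; split.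
  - split=> //; first by exists d => //; apply: KNc_te E.
    case: s A ef {IH C} => // c2 s A; rewrite tseq_eps_cons => ef; apply: (padj_er Hi A E).
    by move: ef => /=; lia.
  - by rewrite [LHS]/= (te_size E).
  - by exists c1, s, c', s; split=> //; right.
case E: te => [t'|] // [<-]; have [C' Es [c [s1 [c' [t1 [Es1 Et1 H]]]]]] := IH _ C E.
split; last (by exists c1, s, c1, t'; split=> //; left); last by rewrite /= Es.
split=> //; rewrite Et1; rewrite Es1 in A; case: H => [->|E'] //.
exact: (padj_el Hi A E').
Qed.
End Adjacent.

Lemma sub_regular n (C : crystal_data n) (B B' : C -> Prop) : regular B ->
  (forall x, B' x -> B x) ->
  (forall x i y, 1 <= i <= n -> B' x -> te i x = Some y -> B' y) ->
  (forall x i y, 1 <= i <= n -> B' x -> tf i x = Some y -> B' y) -> regular B'.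
Proof.
move=> [K P] sub He Hf; split=> [x bx|x /sub]; last exact: P.
have [wx A] := K x (sub x bx); split=> // i Hi; have [E T F N M] := A i Hi; split=> // y Hy.
  by have [_ ? ? ? ?] := T y Hy; split=> //; apply: He Hy.
by have [_ ? ? ? ?] := F y Hy; split=> //; apply: Hf Hy.
Qed.

Lemma chain_regular n hs : 1 < n -> @regular n (tensor_seq (col_crystal n))
  (fun s => chain n s /\ map size s = hs).
Proof.
move=> n2; apply: (sub_regular (tseq_regular (col_regular n2))).
- by move=> s [/chain_J].
- by move=> s i t Hi [C <-] /(chain_te n2 Hi C)[].
- by move=> s i t Hi [C <-] /(chain_tf n2 Hi C)[].
Qed.

Section HalfWidth.
Variable n : nat.
Hypothesis n2 : 1 < n.

Definition spc (U : nat -> bool) : col := kncol n (fun k => ~~ U k) 0 U.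

Lemma spc_state U : kn_state n 0 U 0 U.
Proof. by split=> //; rewrite !addn0. Qed.

Lemma eq_spc U U' : (forall k, 1 <= k <= n -> U k = U' k) -> spc U = spc U'.
Proof. by move=> E; apply: eq_kncol => // k Hk; rewrite E. Qed.

Lemma in_KN_spP c : in_KN_sp n c <-> exists U, c = spc U.
Proof.
split=> [/and5P[/eqP Sc Jc Zc Oc /allP nb]|[U ->]]; last first.
  rewrite /in_KN_sp all_kncol col_ok_kncol mem_kncol /=.
  rewrite (size_kcol n2 (leq0n n) (spc_state U)) subn0 eqxx /=.
  by apply/allP => a _; rewrite !mem_kncol; case: (U a); rewrite /= ?andbF.
have Ec := kncol_canon Oc Jc.
rewrite (count_memPn Zc) in Ec.
set u := (fun k => Bar k \in c) in Ec; set p := (fun k => Pos k \in c) in Ec.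
have Np := cnt_negb p n.
have Sn : cnt u n + cnt p n = n by rewrite -[RHS]Sc Ec size_kncol addn0.
exists u; rewrite {1}Ec; apply: eq_kncol => //.
have up k j : k <= j <= n -> cnt (fun k => ~~ p k) k + cnt u j <= cnt (fun k => ~~ p k) j + cnt u k.
  move=> /andP[/subnK <-]; move: (j - k) => t; elim: t => [|t IH] tn; first by rewrite add0n addnC.
  have {}IH := IH (ltnW tn); have := cntS u (t + k); have := cntS (fun k => ~~ p k) (t + k).
  have := nb (t + k).+1; rewrite mem_iota -/(p _) -/(u _) => /(_ ltac:(lia)).
  by move: IH; rewrite addSn; case: (p _); case: (u _) => //=; clear; lia.
move=> k Hk; have := @cnt_inj n (fun k => ~~ p k) u _ k Hk => <-; first by rewrite negbK.
move=> j jn; have := up 0 j ltac:(lia); have := up j n ltac:(lia); rewrite !cnt0.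
by move: Np Sn; clear; lia.
Qed.

Lemma sp_wt_spc U k : 1 <= k <= n ->
  coord2 (sp_wt n (spc U)) k = (1 - (U k)%:R *+ 2)%R.
Proof. by move=> Hk; rewrite coord2_mk // !mem_kncol Hk /=; case: (U k). Qed.

Lemma mem_bitseqs m s : size s = m -> s \in bitseqs m.
Proof.
elim: m s => [|m IH] [|b s] // [/IH Hs]; apply/allpairsP; exists (b, s); split=> //.
by rewrite !inE; case: b.
Qed.

Lemma sp_colE s : sp_col n s = spc (fun k => ~~ nth false s k.-1).
Proof.
rewrite /sp_col /spc /kncol /bars /idx /= -map_rev -filter_rev; congr (_ ++ map _ _).
by apply: eq_filter => k; rewrite negbK.
Qed.

Lemma sp_of_wt_some (w : weight n) c : sp_of_wt w = Some c -> (exists U, c = spc U) /\ sp_wt n c = w.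
Proof.
rewrite /sp_of_wt; case E: [seq _ <- _ | _] => [|c' s] //= [<-].
have: c' \in c' :: s by rewrite mem_head.
rewrite -E mem_filter => /andP[/eqP <- /mapP[t _ ->]]; split=> //.
by rewrite sp_colE; eexists.
Qed.

Lemma sp_wt_inj U U' : sp_wt n (spc U) = sp_wt n (spc U') -> spc U = spc U'.
Proof.
move=> E; apply: eq_spc => k Hk; have := sp_wt_spc U Hk; rewrite E sp_wt_spc //.
by case: (U k); case: (U' k).
Qed.

Lemma sp_of_wtE U : sp_of_wt (sp_wt n (spc U)) = Some (spc U).
Proof.
case E: sp_of_wt => [c|].
  by have [[U' ->] /sp_wt_inj ->] := sp_of_wt_some E.
have : spc U \in [seq c <- [seq sp_col n s | s <- bitseqs n] | sp_wt n c == sp_wt n (spc U)].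
  rewrite mem_filter eqxx /=; apply/mapP; exists (mkseq (fun k => ~~ U k.+1) n).
    by apply: mem_bitseqs; rewrite size_mkseq.
  rewrite sp_colE; apply: eq_spc => k Hk; rewrite nth_mkseq; last by lia.
  by rewrite prednK ?negbK //; lia.
by move: E; rewrite /sp_of_wt; case: [seq _ <- _ | _].
Qed.

Lemma sp_f_spc i U : 1 <= i <= n ->
  sp_f n i (spc U) = if gphi n i U then Some (spc (gset i true U)) else None.
Proof.
move=> Hi; have ii : (i == i.+1) = false by lia.
rewrite /sp_f; case: ifP => H.
  rewrite -sp_of_wtE; congr sp_of_wt; apply: weight_eq => k Hk.
  rewrite coord2D coord2N coord2_alpha // !sp_wt_spc // /gset.
  move: H; rewrite /gphi => /andP[]; case: eqP => [->|_].
    by move=> /negbTE-> _; rewrite ii andbF.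
  case: (ltnP i n) => iln; case: (eqVneq k i.+1) => [Ek|_] /=; last by case: (U k).
  - by rewrite Ek; case: (U i.+1).
  - by case: (U k).
  - by lia.
case E: sp_of_wt => [c|] //; have [[U' ->] W] := sp_of_wt_some E.
suff : gphi n i U by rewrite H.
have c1 k : 1 <= k <= n -> _ := fun Hk => congr1 (fun w => coord2 w k) W.
apply/andP; split.
  have := c1 i Hi; rewrite coord2D coord2N coord2_alpha // !sp_wt_spc // eqxx.
  have -> : (i == i.+1) = false by lia.
  by rewrite andbF; case: (U i); case: (U' i).
apply/implyP => iln; have := c1 i.+1 ltac:(lia).
by rewrite coord2D coord2N coord2_alpha ?sp_wt_spc ?eqxx ?iln; lia.
Qed.

Lemma sp_e_spc i U : 1 <= i <= n ->
  sp_e n i (spc U) = if geps n i U then Some (spc (gset i false U)) else None.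
Proof.
move=> Hi; have ii : (i == i.+1) = false by lia.
rewrite /sp_e; case: ifP => H.
  rewrite -sp_of_wtE; congr sp_of_wt; apply: weight_eq => k Hk.
  rewrite coord2D coord2_alpha // !sp_wt_spc // /gset.
  move: H; rewrite /geps => /andP[]; case: eqP => [->|_].
    by move=> -> _; rewrite ii andbF.
  case: (ltnP i n) => iln; case: (eqVneq k i.+1) => [Ek|_] /=; last by case: (U k).
  - by rewrite Ek; case: (U i.+1).
  - by case: (U k).
  - by lia.
case E: sp_of_wt => [c|] //; have [[U' ->] W] := sp_of_wt_some E.
suff : geps n i U by rewrite H.
have c1 k : 1 <= k <= n -> _ := fun Hk => congr1 (fun w => coord2 w k) W.
apply/andP; split.
  have := c1 i Hi; rewrite coord2D coord2_alpha // !sp_wt_spc // eqxx.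
  have -> : (i == i.+1) = false by lia.
  by rewrite andbF; case: (U i); case: (U' i).
apply/implyP => iln; have := c1 i.+1 ltac:(lia).
by rewrite coord2D coord2_alpha ?sp_wt_spc ?eqxx ?iln; lia.
Qed.

Lemma gphi_gset i U : gphi n i (gset i true U) = false.
Proof. by rewrite /gphi /gset eqxx. Qed.

Lemma geps_gset i U : geps n i (gset i false U) = false.
Proof. by rewrite /geps /gset eqxx. Qed.

Lemma sp_op i U : 1 <= i <= n -> let c : KN_sp_crystal n := spc U in
  [/\ eps i c = (geps n i U)%:R%R, phi i c = (gphi n i U)%:R%R,
      te i c = (if geps n i U then Some (spc (gset i false U)) else None) &
      tf i c = (if gphi n i U then Some (spc (gset i true U)) else None)].
Proof.
move=> Hi c; rewrite /= /nb_app /c sp_e_spc // sp_f_spc //; split=> //.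
  by case: geps => //; rewrite sp_e_spc // geps_gset.
by case: gphi => //; rewrite sp_f_spc // gphi_gset.
Qed.

Lemma spc_gsetK i U b : 1 <= i <= n -> (if b then gphi n i U else geps n i U) ->
  spc (gset i (~~ b) (gset i b U)) = spc U /\
  (if b then geps n i (gset i b U) else gphi n i (gset i b U)).
Proof.
move=> Hi H; split.
  apply: eq_spc => k Hk; rewrite /gset; case: eqP => [->|_].
    by case: b H => /andP[]; case: (U i).
  case: eqP => [Ek|//]; have iln : i < n by lia.
  by rewrite Ek; case: b H; rewrite /gphi /geps iln => /andP[_] /=; case: (U i.+1).
rewrite /gphi /geps /gset !eqxx; have -> : (i.+1 == i) = false by lia.
by case: b H => /=; rewrite implybT.
Qed.

Lemma sp_regular : @regular n (KN_sp_crystal n) (in_KN_sp n).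
Proof.
split=> [x /in_KN_spP[U ->]|x /in_KN_spP[U ->] i Hi]; last by have [-> -> _ _] := sp_op U Hi.
split.
  move=> k l Hk Hl; change (coord2 (sp_wt n (spc U)) k = coord2 (sp_wt n (spc U)) l %[mod 2])%Z.
  by rewrite !sp_wt_spc //; case: (U k); case: (U l).
move=> i Hi; have [-> -> -> ->] := sp_op U Hi; split.
- change (wt (spc U : KN_sp_crystal n)) with (sp_wt n (spc U)).
  rewrite /pairing; case: ifP => iln.
    rewrite (sp_wt_spc U Hi) sp_wt_spc; last by lia.
    by rewrite /gphi /geps iln; case: (U i); case: (U i.+1).
  by rewrite sp_wt_spc // /gphi /geps iln /= !andbT; case: (U i).
- move=> y; case: ifP => // H [<-]; have [K G] := @spc_gsetK i U false Hi H.
  have [-> -> _ ->] := sp_op (gset i false U) Hi.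
  rewrite G geps_gset K; split=> //.
  + by apply/in_KN_spP; eexists.
  + have := sp_e_spc U Hi; rewrite H => E; by have [_] := sp_of_wt_some E.
  + by have := gphi_gepsN n i U; rewrite H andbT => /negbTE->.
- move=> y; case: ifP => // H [<-]; have [K G] := @spc_gsetK i U true Hi H.
  have [-> -> -> _] := sp_op (gset i true U) Hi.
  rewrite G gphi_gset (gphi_geps H) K; split=> //.
  + by apply/in_KN_spP; eexists.
  + have := sp_f_spc U Hi; rewrite H => E; by have [_] := sp_of_wt_some E.
- by case: ifP.
- by case: ifP.
Qed.

Lemma minus_spc U : minus_part n (spc U) = bars n U.
Proof. exact: (@minus_kcol n U 0 U). Qed.

Lemma sp_morph c : in_KN_sp n c ->
  @morph n (KN_sp_crystal n) (T_sp_crystal n) (minus_part n) c.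
Proof.
move=> /in_KN_spP[U ->]; split.
  apply: weight_eq => k Hk; rewrite minus_spc.
  change (coord2 (spinor_wt n 1 (bars n U)) k = coord2 (sp_wt n (spc U)) k).
  rewrite sp_wt_spc // coord2_mk // col_ok_count ?col_ok_bars // mem_bars Hk /=.
  by case: (U k).
move=> i Hi; have [-> -> -> ->] := sp_op U Hi; rewrite minus_spc.
have [-> -> -> ->] := Tsp_op n2 U Hi; split=> //; case: ifP => //= _; by rewrite minus_spc.
Qed.

Definition padj_sp (c2 c0 : col) : Prop :=
  exists d V m U U0, [/\ d <= n, c2 = kcol n V m U /\ kn_state n d V m U, c0 = spc U0 &
    pgood n d (d - 0) V U U0 U0].

Section Step.
Variables (i : nat) (c2 : col_crystal n) (c0 : KN_sp_crystal n).
Hypothesis Hi : 1 <= i <= n.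
Hypothesis A : padj_sp c2 c0.

Lemma padj_sp_fl c2' : tf i c2 = Some c2' -> (phi i c0 <= eps i c2)%R -> padj_sp c2' c0.
Proof.
have [d [V [m [U [U0 [dn [-> St] -> G]]]]]] := A.
have := col_tf n2 dn St Hi; cbv zeta; case: ifP => [_|_ -> //].
move=> [V' [m' [U' [-> St' mv _]]]] [<-].
have [-> _ _] := col_vals n2 dn St Hi; have [_ -> _ _] := sp_op U0 Hi.
rewrite ler_nat => Hpe.
exists d, V', m', U', U0; split=> //.
apply: (pgood_fl n2 (leq0n d) dn Hi St _ G) mv => //; first by rewrite addn0.
by move=> b0; move: Hpe; rewrite b0; case: gphi.
Qed.

Lemma padj_sp_el c2' : te i c2 = Some c2' -> padj_sp c2' c0.
Proof.
have [d [V [m [U [U0 [dn [-> St] -> G]]]]]] := A.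
have := col_te n2 dn St Hi; cbv zeta; case: ifP => [_|_ -> //].
move=> [V' [m' [U' [-> St' mv _]]]] [<-].
exists d, V', m', U', U0; split=> //.
move=> k kn; have [G1 G2] := G k kn; have [_ /= sV _ /= sR] := mv k kn.
by move: sV sR G1 G2; clear => -> ->; lia.
Qed.

Lemma padj_sp_fr c0' : tf i c0 = Some c0' -> padj_sp c2 c0'.
Proof.
have [d [V [m [U [U0 [dn [-> St] -> G]]]]]] := A.
have [_ _ _ ->] := sp_op U0 Hi; case: ifP => // H [<-].
exists d, V, m, U, (gset i true U0); split=> // k kn; have [G1 G2] := G k kn.
have := @step_gset_t n i U0 true k Hi kn (fun _ => H); rewrite /= => ->.
by move: G1 G2; clear; lia.
Qed.

Lemma padj_sp_er c0' : te i c0 = Some c0' -> (eps i c2 <= phi i c0)%R -> padj_sp c2 c0'.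
Proof.
have [d [V [m [U [U0 [dn [-> St] -> G]]]]]] := A.
have [_ -> -> _] := sp_op U0 Hi; case: ifP => // H [<-].
have [-> _ _] := col_vals n2 dn St Hi.
have -> : gphi n i U0 = false.
  by have := gphi_gepsN n i U0; rewrite H andbT => /negbTE.
rewrite ler_nat leqn0 => /eqP b0.
exists d, V, m, U, (gset i false U0); split=> //.
apply: (pgood_er n2 (leq0n d) dn Hi St (x := false) (y := false) _ G _ _) => //; first by rewrite addn0.
by move=> k kn; have := @step_gset_f n i U0 true k Hi kn (fun _ => H).
Qed.
End Step.

Definition half_chain (X : col * seq col) : Prop :=
  [/\ in_KN_sp n X.1, chain n X.2 & if X.2 is c2 :: _ then padj_sp c2 X.1 else True].

Lemma half_regular hs :
  @regular n (tensor (KN_sp_crystal n) (tensor_seq (col_crystal n)))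
    (fun X => half_chain X /\ map size X.2 = hs).
Proof.
have R := tensor_regular sp_regular (chain_regular hs n2).
have [Ksp _] := sp_regular.
apply: (sub_regular R).
- by move=> [c s] [[]].
- move=> [c s] i y Hi [[/= Bc Cs A] Es]; rewrite /= /tens_e.
  have [_ /(_ i Hi)[_ T _ _ _]] := Ksp c Bc; case: ifP => ef.
    case E: te => [c'|] //= [<-]; have [Bc' _ _ _ _] := T _ E; rewrite /= in E *.
    have {}ef : (eps i s <= phi i c)%R := ef.
    split=> //; split=> //=; case: s A ef {Cs Es} => // c2 s A; rewrite tseq_eps_cons => ef.
    by apply: (padj_sp_er Hi A E); move: ef => /=; lia.
  case E: te => [s'|] //= [<-]; have [C' Es' [c1 [s1 [c1' [s1' [E1 E2 H]]]]]] := chain_te n2 Hi Cs E.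
  rewrite /= Es'; split=> //; split=> //=; rewrite E2; rewrite E1 in A.
  by case: H => [->|E'] //; apply: (padj_sp_el Hi A E').
- move=> [c s] i y Hi [[/= Bc Cs A] Es]; rewrite /= /tens_f.
  have [_ /(_ i Hi)[_ _ T _ _]] := Ksp c Bc; case: ifP => [ef|/negbT]; last rewrite -leNgt => fe.
    case E: tf => [c'|] //= [<-]; have [Bc' _ _ _ _] := T _ E; rewrite /= in E *.
    split=> //; split=> //=; case: s A {ef Cs Es} => // c2 s A.
    exact: (padj_sp_fr Hi A E).
  case E: tf => [s'|] //= [<-]; have [C' Es' [c1 [s1 [c1' [s1' [E1 E2 H]]]]]] := chain_tf n2 Hi Cs E.
  rewrite /= Es'; split=> //; split=> //=; rewrite E2; rewrite E1 in A.
  case: H => [->|[E' Ee]] //; apply: (padj_sp_fl Hi A E').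
  by rewrite -Ee.
Qed.
End HalfWidth.

Lemma iso_of n (C D : crystal_data n) (B : C -> Prop) (B' : D -> Prop) (f : C -> D) :
  regular B -> (forall x, B x -> B' (f x)) ->
  (forall x y, B x -> B y -> f x = f y -> x = y) ->
  (forall z, B' z -> exists2 x, B x & f x = z) ->
  (forall x, B x -> morph f x) -> crystal_iso B B' f.
Proof.
move=> [K _] inB inj sur mor; split=> //; split=> //.
exact: transfer_crystal K inB sur mor.
Qed.

Lemma morph_factor n (C C' D : crystal_data n) (B : C -> Prop) (g : C -> C')
    (f : C -> D) (h : C' -> D) x :
  is_crystal B -> B x -> (forall y, B y -> h (g y) = f y) ->
  morph g x -> morph f x -> morph h (g x).
Proof.
move=> K bx E [wg Mg] [wf Mf]; split=> [|i Hi]; first by rewrite E // wf wg.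
have [_ /(_ i Hi)[_ T F _ _]] := K x bx.
have [e1 p1 t1 s1] := Mg i Hi; have [e2 p2 t2 s2] := Mf i Hi.
rewrite E // e1 p1 e2 p2 t1 s1 t2 s2; split=> //.
  by case H: te => [y|] //=; have [by_ _ _ _ _] := T _ H; rewrite E.
by case H: tf => [y|] //=; have [by_ _ _ _ _] := F _ H; rewrite E.
Qed.

Lemma rltE x y : rlt x y =
  match x, y with
  | Pos a, Pos b => a <= b
  | Pos _, _ => true
  | Zero, Bar _ => true
  | Bar a, Bar b => b <= a
  | _, _ => false
  end.
Proof.
rewrite /rlt /lle; case: eqP => [->|ne]; first by case: y => [b||b] //=; rewrite leqnn.
case: x y ne => [a||a] [b||b] ne //=; rewrite andbT ltn_neqAle.
  suff -> : a != b by [].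
  by apply/eqP => E; apply: ne; rewrite E.
suff -> : b != a by [].
by apply/eqP => E; apply: ne; rewrite E.
Qed.

Lemma rlt_trans : transitive (fun x y => rlt y x).
Proof. by move=> [a||a] [b||b] [c||c]; rewrite !rltE //; lia. Qed.

Lemma row_okE r : row_ok r = sorted (fun x y => rlt y x) r.
Proof.
rewrite /row_ok; apply/andP/idP => [[S C]|S]; last first.
  split; first by apply: sub_sorted S => x y /andP[].
  elim: r S => // x r IH S; have := order_path_min rlt_trans S.
  have := IH (path_sorted S); rewrite /= => {IH S}.
  case: eqP => [->|_] //= C A; suff -> : count_mem Zero r = 0 by [].
  apply/eqP; rewrite -leqn0 leqNgt -has_count; apply/hasP => -[y yr /eqP Ey].
  by have := allP A y yr; rewrite Ey rltE.
elim: r S C => // x [|y r] IH //= /andP[xy S] C.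
have {}IH : path (fun x y => rlt y x) y r by apply: IH => //; move: C => /=; lia.
rewrite IH andbT /rlt xy; apply/negP => /andP[/eqP Ey /eqP Ex].
by move: C; rewrite Ex Ey eqxx; lia.
Qed.

Definition row (T : seq col) (i : nat) : seq letter := pmap (fun c => lev c i) T.

Lemma row_atE T i : row_at (straight T) i = row T i.
Proof.
rewrite /row_at size_map /row; elim: T => // c T IH; rewrite [size _]/= [iota _ _]/=.
pose f := entry (straight (c :: T)) i.
have -> : pmap f (1 :: iota 2 (size T)) =
    oapp (cons^~ (pmap f (iota 2 (size T)))) (pmap f (iota 2 (size T))) (f 1) by [].
rewrite {3}/f entry_straight [nth _ _ _]/= [RHS]/=.
suff -> : pmap f (iota 2 (size T)) = pmap (lev^~ i) T by [].
rewrite -IH (_ : iota 2 _ = map S (iota 1 (size T))); last first.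
  by rewrite -(addn1 1) iotaDl; apply: eq_map.
have -> : pmap f (map S (iota 1 (size T))) = pmap (f \o S) (iota 1 (size T)).
  by move: (f) => g; elim: (iota 1 _) => //= k s ->.
by apply: eq_pmap_in => -[|j]; rewrite mem_iota.
Qed.

Lemma lev_none (c : col) i : lev c i = None <-> ~~ (0 < i <= size c).
Proof.
rewrite /lev; case: i => [|i] //=; split=> [H|H].
  by rewrite -leqNgt; case: ltnP => // /(@onth_some _ c)[x]; rewrite H.
by case E: onth => [x|] //; rewrite (onth_size E) in H.
Qed.

Lemma row_nil c T i : sorted geq (map size (c :: T)) -> lev c i = None -> row (c :: T) i = [::].
Proof.
move=> S /lev_none Hi; have : all (fun d => size d <= size c) T.
  have := order_path_min (fun a b c => fun h1 h2 => leq_trans h2 h1 : geq b c) S.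
  by rewrite all_map.
rewrite /row /= (_ : lev c i = None) /=; last exact/lev_none.
elim: T {S} => //= d T IH /andP[Hd /IH ->].
by rewrite (_ : lev d i = None) //; apply/lev_none; apply: contra Hi; lia.
Qed.

Definition adjrow (c2 c1 : col) : Prop :=
  forall i x y, lev c2 i = Some x -> lev c1 i = Some y -> rlt x y.

Lemma rowsP T : sorted geq (map size T) ->
  (forall i, row_ok (row T i)) <->
  (forall j, j.+1 < size T -> adjrow (nth [::] T j.+1) (nth [::] T j)).
Proof.
elim: T => [|c1 [|c2 T] IH] S; first by split.
  by split=> // _ i; rewrite row_okE /row /=; case: lev.
have S' : sorted geq (map size (c2 :: T)) by case/andP: S.
have {}IH := IH S'; have rE i : row [:: c1, c2 & T] i = oapp (cons^~ (row (c2 :: T) i)) (row (c2 :: T) i) (lev c1 i).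
  by [].
split=> [H|H i].
  have H12 : forall i, row_ok (row (c2 :: T) i).
    move=> i; have := H i; rewrite !row_okE rE; case: (lev c1 i) => //= x; exact: path_sorted.
  move=> [_ i x y E2 E1|j Hj]; last exact: IH.1.
  by have := H i; rewrite row_okE rE E1 /= /row /= E2 /= => /andP[].
have H2 : row_ok (row (c2 :: T) i) by apply: IH.2 => j Hj; apply: (H j.+1).
rewrite row_okE rE; rewrite row_okE in H2.
case E1: (lev c1 i) => [y|] //; case E2: (lev c2 i) => [x|]; last by rewrite row_nil.
move: H2; rewrite /row /= E2 /= => ->; rewrite andbT.
exact: (H 0 isT i).
Qed.

Lemma sst_straight T : sst (straight T) <-> all col_ok T /\ forall i, row_ok (row T i).
Proof.
rewrite /sst all_map; split=> [/andP[Hc /allP Hr]|[Hc Hr]]; last first.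
  by apply/andP; split=> //; apply/allP => i _; rewrite row_atE.
split=> // i; rewrite -row_atE; case: (boolP (i \in levels (straight T))) => Hi; first exact: Hr.
rewrite row_atE (_ : row T i = [::]) //.
move: Hi; rewrite /levels mem_iota -map_comp; elim: T {Hc Hr} => //= c T IH Hi.
rewrite (_ : lev c i = None) /=; last by apply/lev_none; apply: contra Hi; lia.
by apply: IH; apply: contra Hi; lia.
Qed.

Lemma chainP n T : chain n T <->
  (forall j, j < size T -> exists2 d, d <= n & KNc n d (nth [::] T j)) /\
  (forall j, j.+1 < size T -> padj n (nth [::] T j.+1) (nth [::] T j)).
Proof.
elim: T => [|c1 T IH]; first by split.
split=> [[K A /IH[HK HA]]|[HK HA]].
  split=> [[|j] Hj|[|j] Hj] //; [exact: HK| |exact: HA].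
  by case: T A {IH HK HA} Hj.
split; first exact: (HK 0).
  by case: T HA {IH HK} => // c2 T HA; apply: (HA 0).
by apply/IH; split=> j Hj; [apply: (HK j.+1)|apply: (HA j.+1)].
Qed.

Section Conditions.
Variables (n j : nat) (S S' : skew).
Hypothesis E1 : forall p, entry S p j = entry S' p 1.
Hypothesis E2 : forall p, entry S p j.+1 = entry S' p 2.

Lemma eq_KN_b : KN_b2 n S j /\ KN_b3 n S j /\ KN_b4 n S j <->
  KN_b2 n S' 1 /\ KN_b3 n S' 1 /\ KN_b4 n S' 1.
Proof.
split=> -[b2 [b3 b4]]; split; [|split| |split].
- by move=> a b p q r s; have := b2 a b p q r s; rewrite !E1 !E2.
- by move=> a p q r s; have := b3 a p q r s; rewrite !E1 !E2.
- by move=> p q; have := b4 p q; rewrite !E1 !E2.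
- by move=> a b p q r s; have := b2 a b p q r s; rewrite !E1 !E2.
- by move=> a p q r s; have := b3 a p q r s; rewrite !E1 !E2.
- by move=> p q; have := b4 p q; rewrite !E1 !E2.
Qed.
End Conditions.

Lemma KN_b_nil n S j : (forall p, entry S p j.+1 = None) ->
  [/\ KN_b2 n S j, KN_b3 n S j & KN_b4 n S j].
Proof.
move=> E; split.
- by move=> a b p q r s _ _ _ _ _ _; rewrite !E => -[[]|[]].
- by move=> a p q r s _ _ _ _ _ _ mid; rewrite !E => -[[]|[]].
- by move=> p q _; rewrite !E => -[].
Qed.

Lemma pair_KNP n T j : j.+1 < size T -> let S := straight T in
  let c2 := nth [::] T j.+1 in let c1 := nth [::] T j in
  pair_KN n c2 c1 <-> adjrow c2 c1 /\ [/\ KN_b2 n S j.+1, KN_b3 n S j.+1 & KN_b4 n S j.+1].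
Proof.
move=> Hj S c2 c1.
have H1 p : entry S p j.+1 = entry (straight [:: c1; c2]) p 1 by rewrite !entry_straight.
have H2 p : entry S p j.+2 = entry (straight [:: c1; c2]) p 2 by rewrite !entry_straight.
have E := @eq_KN_b n j.+1 S (straight [:: c1; c2]) H1 H2.
split=> [[r b2 b3 b4]|[r [b2 b3 b4]]].
  by have [|b2' [b3' b4']] := E.2.
by have [|b2' [b3' b4']] := E.1.
Qed.

Lemma padj_pair n d2 d1 c2 c1 : 1 < n -> d1 <= d2 <= n -> KNc n d2 c2 -> KNc n d1 c1 ->
  padj n c2 c1 <-> pair_KN n c2 c1.
Proof.
move=> n2 d12n K2 K1; split=> [A|].
  have [e2 [e1 [W2 [k2 [X2 [W1 [k1 [X1 [/andP[e12 e2n] [-> St2] [-> St1] G]]]]]]]]] := A.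
  exact: (pair_good_KN n2 e12 e2n St2 St1 G).
move: K2 K1 => [V2 [m2 [U2 [-> St2]]]] [V1 [m1 [U1 [-> St1]]]] /=.
have /andP[d12 d2n] := d12n => P.
exists d2, d1, V2, m2, U2, V1, m1, U1; split=> //.
exact: (pair_KN_good n2 d12 d2n St2 St1 P).
Qed.

Lemma ex_list (A : eqType) (B : Type) (x0 : A) (y0 : B) (P : nat -> A -> B -> Prop) (s : seq A) :
  (forall j, j < size s -> exists y, P j (nth x0 s j) y) ->
  exists t, size t = size s /\ forall j, j < size s -> P j (nth x0 s j) (nth y0 t j).
Proof.
elim: s P => [|x s IH] P H; first by exists [::].
have [y Hy] := H 0 isT; have [t [St Ht]] := IH (fun j => P j.+1) (fun j Hj => H j.+1 Hj).
by exists (y :: t); rewrite /= St; split=> // -[|j] // /Ht.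
Qed.

Lemma lev_nil i : lev [::] i = None.
Proof. by case: i => [|[|i]]. Qed.

Section Assembly.
Variables (n : nat) (la : seq nat).
Hypothesis n2 : 1 < n.
Hypothesis Hla : in_Pn n la.
Let h j := conj_part la j.
Let hs := [seq h j | j <- iota 1 (head 0 la)].

Lemma size_hs : size hs = head 0 la. Proof. by rewrite size_map size_iota. Qed.

Lemma nth_hs j : j < head 0 la -> nth 0 hs j = h j.+1.
Proof. by move=> Hj; rewrite (nth_map 0) ?size_iota // nth_iota. Qed.

Lemma h_le j : h j <= n.
Proof. by have /andP[/eqP <- _] := Hla; apply: count_size. Qed.

Lemma h_mono i j : i <= j -> h j <= h i.
Proof. by move=> ij; apply: sub_count => x; apply: leq_trans. Qed.

Lemma h_gt0 j : j <= head 0 la -> 0 < h j.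
Proof.
case: j => [|j] Hj; first by rewrite /h /conj_part; have /andP[/eqP] := Hla; case: (la) => //=; lia.
by rewrite /h /conj_part; case: la Hj => //= a s; rewrite /h => ->.
Qed.

Lemma hs_sorted : sorted geq hs.
Proof.
rewrite /hs; move: 1 (head 0 la) => a k; elim: k a => [|k IH] a //.
case: k IH => [|k] IH //; have := IH a.+1; rewrite /= => ->; rewrite andbT.
exact: h_mono.
Qed.

Lemma size_nth (T : seq col) j : map size T = hs -> j < size T ->
  j < head 0 la /\ size (nth [::] T j) = h j.+1.
Proof.
move=> E Hj; have S : size T = head 0 la by rewrite -(size_map size) E size_hs.
rewrite -S; split=> //; rewrite -nth_hs -?S // -E (nth_map [::]) //.
Qed.

Lemma KNc_size d c : d <= n -> KNc n d c -> size c = n - d.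
Proof. by move=> dn [V [m [U [-> St]]]]; apply: size_kcol. Qed.

Lemma KNc_d d c j : d <= n -> KNc n d c -> size c = h j -> d = n - h j.
Proof. by move=> dn K E; have := KNc_size dn K; have := h_le j; lia. Qed.

Lemma in_KNP T : in_KN n la T <-> chain n T /\ map size T = hs.
Proof.
split=> [[E J /sst_straight[O R] b]|[C E]].
  have S : sorted geq (map size T) by rewrite E; apply: hs_sorted.
  have K j : j < size T -> KNc n (n - size (nth [::] T j)) (nth [::] T j).
    move=> Hj; have [_ Sj] := size_nth E Hj; apply/KNcP => //; first by lia.
    split.
    - by have := h_le j.+1; lia.
    - by apply: (allP J); apply: mem_nth.
    - by apply: (allP O); apply: mem_nth.
    - move=> a i1 i2 a1 i12 L1 L2; have [b1 _ _ _] := b j.+1 isT.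
      have := b1 a i1 i2 a1 i12; rewrite !entry_straight /= (nth_map [::]) // => H.
      exact: H.
  split=> //; apply/chainP; split=> j Hj.
    by exists (n - size (nth [::] T j)); [lia|apply: K].
  have [_ S1] := size_nth E (ltnW Hj); have [_ S2] := size_nth E Hj.
  apply/(padj_pair n2 _ (K _ Hj) (K _ (ltnW Hj))).
    by have := @h_mono j.+1 j.+2 (leqnSn _); lia.
  apply/pair_KNP => //; split; first exact: (rowsP S).1 R j Hj.
  by have [_ ? ? ?] := b j.+1 isT.
have [K A] := (chainP n T).1 C.
have S : sorted geq (map size T) by rewrite E; apply: hs_sorted.
have P j : j.+1 < size T -> pair_KN n (nth [::] T j.+1) (nth [::] T j).
  move=> Hj; have [d2 d2n K2] := K _ Hj; have [d1 d1n K1] := K _ (ltnW Hj).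
  have [_ S1] := size_nth E (ltnW Hj); have [_ S2] := size_nth E Hj.
  have E1 := KNc_size d1n K1; have E2 := KNc_size d2n K2.
  have d12 : d1 <= d2 <= n by have := @h_mono j.+1 j.+2 (leqnSn _); lia.
  exact: (padj_pair n2 d12 K2 K1).1 (A j Hj).
split=> //.
- by apply/allP => c /(nthP [::])[j Hj <-]; have [d dn /KNcP[]] := K j Hj.
- apply/sst_straight; split.
    by apply/allP => c /(nthP [::])[j Hj <-]; have [d dn /KNcP[]] := K j Hj.
  by apply/rowsP => // j Hj; have [] := P j Hj.
case=> // j _.
have [Hj|Hj] := ltnP j (size T); last first.
  have N p : entry (straight T) p j.+1 = None.
    by rewrite entry_straight nth_default //; apply: lev_nil.
  have [| b2 b3 b4] := @KN_b_nil n (straight T) j.+1.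
    by move=> p; rewrite entry_straight nth_default ?lev_nil // leqW.
  by split=> // a i1 i2 _ _; rewrite N.
have b1 : KN_b1 (straight T) j.+1.
  have [d dn /(KNcP n2 _ dn)[_ _ _ H]] := K j Hj.
  move=> a i1 i2 a1 i12; rewrite !entry_straight /= (nth_map [::]) //.
  exact: H.
have [Hj'|Hj'] := ltnP j.+1 (size T).
  by have /(pair_KNP n Hj')[_ [? ? ?]] := P j Hj'.
have [| b2 b3 b4] := @KN_b_nil n (straight T) j.+1.
  by move=> p; rewrite entry_straight nth_default // lev_nil.
by split.
Qed.

Lemma Psi_map T : map size T = hs -> Psi n la T = map (psi n) T.
Proof.
move=> E; have S : size T = head 0 la by rewrite -(size_map size) E size_hs.
apply: (@eq_from_nth _ (0, ([::], [::]))); first by rewrite !size_map size_iota.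
rewrite size_map size_iota => j Hj; rewrite (nth_map 0) ?size_iota // nth_iota // add1n.
have Hj' : j < size T by rewrite S.
by rewrite (nth_map [::]) // /psi (size_nth E Hj').2.
Qed.

Lemma chain_inj T T' : chain n T -> map size T = hs -> chain n T' -> map size T' = hs ->
  map (psi n) T = map (psi n) T' -> T = T'.
Proof.
move=> /chainP[K _] E /chainP[K' _] E' Ep.
have S : size T = size T' by rewrite -(size_map size) E -E' size_map.
apply: (@eq_from_nth _ [::]) => // j Hj; have Hj' : j < size T' by rewrite -S.
have [d dn Kd] := K j Hj; have [d' dn' Kd'] := K' j Hj'.
have Ed := KNc_d dn Kd (size_nth E Hj).2; have Ed' := KNc_d dn' Kd' (size_nth E' Hj').2.
subst d'; rewrite -Ed in Kd'; apply: (psi_inj n2 dn Kd Kd').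
by rewrite -!(nth_map [::] (0, ([::], [::])) (psi n)) // Ep.
Qed.

Lemma in_T_map T : chain n T -> map size T = hs -> in_T n la (map (psi n) T).
Proof.
move=> /chainP[K A] E; have S : size T = head 0 la by rewrite -(size_map size) E size_hs.
split; first by rewrite size_map.
  case=> // j Hj; have Hj' : j < size T by lia.
  rewrite (nth_map [::]) //=; have [d dn Kd] := K j Hj'.
  have Ed := KNc_d dn Kd (size_nth E Hj').2; have h0 := @h_gt0 j.+1 ltac:(lia).
  rewrite -/(h j.+1) -Ed; have [V [m [U [-> St]]]] := Kd.
  by apply: (in_T_b_psi n2 _ St); lia.
case=> // j Hj; have Hj' : j.+1 < size T by lia.
have Hj2 := ltnW Hj'; rewrite !(nth_map [::]) //=.
have [d2 [d1 [V2 [m2 [U2 [V1 [m1 [U1 [/andP[d12 d2n] [-> St2] [-> St1] G]]]]]]]]] := A j Hj'.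
by apply/(prec_psi n2 d12 d2n St2 St1).
Qed.

Lemma in_T_surj Ts : in_T n la Ts -> exists T, [/\ chain n T, map size T = hs & map (psi n) T = Ts].
Proof.
move=> [S Hb Hp]; pose x0 : spinor := (0, ([::], [::])).
have [T [ST HT]] : exists T, size T = size Ts /\ forall j, j < size Ts ->
    KNc n (n - h j.+1) (nth [::] T j) /\ psi n (nth [::] T j) = nth x0 Ts j.
  apply: (@ex_list spinor col x0 [::] (fun j t c => KNc n (n - h j.+1) c /\ psi n c = t)) => j Hj.
  have Hj' : 1 <= j.+1 <= head 0 la by rewrite -S.
  by have [c K E] := in_T_b_surj n2 (Hb j.+1 Hj'); exists c.
have K j : j < size T -> KNc n (n - h j.+1) (nth [::] T j) by rewrite ST => /HT[].
have Ep : map (psi n) T = Ts.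
  apply: (@eq_from_nth _ x0); rewrite size_map // ST => j Hj.
  by rewrite (nth_map [::]) ?ST //; have [] := HT j Hj.
exists T; split=> //.
  apply/chainP; split=> j Hj; first by exists (n - h j.+1); [lia|apply: K].
  have Hj' : 1 <= j.+1 < head 0 la by rewrite -S -ST.
  have Hj2 := ltnW Hj; have := Hp j.+1 Hj'; rewrite -Ep !(nth_map [::]) //=.
  have [V1 [m1 [U1 [E1 St1]]]] := K j (ltnW Hj); have [V2 [m2 [U2 [E2 St2]]]] := K j.+1 Hj.
  have d12 : n - h j.+1 <= n - h j.+2 by apply: leq_sub2l; apply: h_mono.
  have d2n : n - h j.+2 <= n by lia.
  rewrite E1 E2 => /(prec_psi n2 d12 d2n St2 St1) G.
  by exists (n - h j.+2), (n - h j.+1), V2, m2, U2, V1, m1, U1; split=> //; rewrite d12.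
apply: (@eq_from_nth _ 0); first by rewrite size_map ST S size_hs.
rewrite size_map => j Hj; rewrite (nth_map [::]) // nth_hs; last by rewrite -S -ST.
by rewrite (KNc_size _ (K j Hj)); have := h_le j.+1; lia.
Qed.

Lemma chain_psi T : chain n T -> all_in (@morph n (col_crystal n) (T_b_crystal n) (psi n)) T.
Proof.
elim: T => //= c T IH [[d dn [V [m [U [-> St]]]]] _ /IH H]; split=> //.
exact: (psi_morph n2 dn St).
Qed.

Lemma KN_id T : chain n T ->
  @morph n (tensor_seq (col_crystal n)) (KN_crystal n) id T.
Proof.
move=> /chainP[K _]; apply: (KN_tensor n2).
apply/allP => c /(nthP [::])[j Hj <-].
by have [d dn [V [m [U [-> _]]]]] := K j Hj; apply: all_kncol.
Qed.

Lemma Psi_iso : @crystal_iso n (KN_crystal n) (tensor_seq (T_b_crystal n))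
  (in_KN n la) (in_T n la) (Psi n la).
Proof.
have R := chain_regular hs n2.
apply: iso_of.
- apply: (@transfer_regular n (tensor_seq (col_crystal n)) (KN_crystal n) _ _ id R).
  + by move=> T /in_KNP.
  + by move=> T /in_KNP ?; exists T.
  + by move=> T [C _]; apply: KN_id.
- by move=> T /in_KNP[C E]; rewrite Psi_map //; apply: in_T_map.
- move=> T T' /in_KNP[C E] /in_KNP[C' E']; rewrite !Psi_map //.
  exact: chain_inj.
- move=> Ts /in_T_surj[T [C E <-]]; exists T; last exact: Psi_map.
  exact/in_KNP.
- move=> T /in_KNP[C E].
  apply: (@morph_factor n (tensor_seq (col_crystal n)) (KN_crystal n) (tensor_seq (T_b_crystal n))
    _ id (map (psi n)) (Psi n la) T R.1 (conj C E)).
  + by move=> T' [_ E']; apply: Psi_map.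
  + exact: KN_id.
  + by apply: tseq_morph; apply: chain_psi.
Qed.

Lemma padj_spP c2 U d : d <= n -> KNc n d c2 ->
  padj_sp n c2 (spc n U) <-> pair_KN n c2 (spc n U).
Proof.
move=> dn K; have conv e V2 U2 V0 : pgood n e (e - 0) V2 U2 V0 V0 <-> pair_good n e 0 V2 U2 V0 V0.
  by split=> G k kn; have [G1 G2] := G k kn; split=> //; move: G2; rewrite lbit0.
split=> [[e [V [m [W [U0 [en [-> St] -> /conv G]]]]]]|P].
  exact: (pair_good_KN n2 (leq0n e) en St (spc_state n U0) G).
have [V [m [W [E St]]]] := K; exists d, V, m, W, U; split=> //.
apply/conv; rewrite E in P.
exact: (pair_KN_good n2 (leq0n d) dn St (spc_state n U) P).
Qed.

Lemma in_KN_halfP X : in_KN_half n la X <-> half_chain n X /\ map size X.2 = hs.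
Proof.
case: X => c0 T.
have sz c : in_KN_sp n c -> size c = n by case/andP => /eqP.
have S c : in_KN_sp n c -> map size T = hs -> sorted geq (map size (c :: T)).
  move=> /sz Ec E; rewrite /= Ec E; have := hs_sorted; rewrite /hs.
  by case: iota => //= j s ->; rewrite andbT; apply: h_le.
split=> [[B0 /in_KNP[C E] ST b]|[[B0 C A] E]].
  have {ST}/sst_straight[_ R] : sst (straight (c0 :: T)) := ST; have {}B0 : in_KN_sp n c0 := B0.
  have {}b : let S := straight (c0 :: T) in [/\ KN_b2 n S 1, KN_b3 n S 1 & KN_b4 n S 1] := b.
  have {}C : chain n T := C; have {}E : map size T = hs := E.
  split=> //; split=> //; case: T C E R b S => // c2 T C E R b S.
  have [U EU] := (in_KN_spP n2 c0).1 B0; have [[d dn K] _ _] := C.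
  rewrite EU; apply/(padj_spP U dn K); rewrite -EU.
  apply/(@pair_KNP n [:: c0, c2 & T] 0 isT); split=> //.
  exact: (rowsP (S c0 B0 E)).1 R 0 isT.
have {}B0 : in_KN_sp n c0 := B0; have {}C : chain n T := C; have {}E : map size T = hs := E.
have {}A : if T is c2 :: _ then padj_sp n c2 c0 else True := A.
have KT : in_KN n la T by apply/in_KNP.
have [_ _ /sst_straight[O R] _] := KT.
have O0 : col_ok c0 by case/and5P: B0.
have S0 := S c0 B0 E.
have P c2 T' : T = c2 :: T' -> pair_KN n c2 c0.
  move=> ET; rewrite ET in C A; have [[d dn K] _ _] := C; have [U EU] := (in_KN_spP n2 c0).1 B0.
  by rewrite EU; apply/(padj_spP U dn K); rewrite -EU.
have Sh : sst (straight (c0 :: T)).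
  apply/sst_straight; rewrite /= O0; split=> //; apply/(rowsP S0) => -[|j] Hj.
    by case: T P Hj {C A E KT O R S S0} => // c2 T P _; have [] := P c2 T erefl.
  have S1 : sorted geq (map size T) by rewrite E; apply: hs_sorted.
  exact: (rowsP S1).1 R j Hj.
suff Hb : let S := straight (c0 :: T) in [/\ KN_b2 n S 1, KN_b3 n S 1 & KN_b4 n S 1] by split.
case: T P {Sh C A E KT O R S S0} => [|c2 T] P.
  by apply: KN_b_nil => p; rewrite entry_straight; apply: lev_nil.
by have /(@pair_KNP n [:: c0, c2 & T] 0 isT)[_] := P c2 T erefl.
Qed.

Lemma Psi_half_iso : @crystal_iso n (tensor (KN_sp_crystal n) (KN_crystal n))
  (tensor (T_sp_crystal n) (tensor_seq (T_b_crystal n)))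
  (in_KN_half n la) (in_T_half n la) (Psi_half n la).
Proof.
have R := half_regular n2 hs.
have idm c : @morph n (KN_sp_crystal n) (KN_sp_crystal n) id c.
  by split=> // i _; split=> //; case: (_ i c).
have M X : half_chain n X /\ map size X.2 = hs ->
    @morph n (tensor (KN_sp_crystal n) (tensor_seq (col_crystal n)))
      (tensor (KN_sp_crystal n) (KN_crystal n)) (fun b => (id b.1, id b.2)) X.
  by case: X => c T [[_ C _] _]; apply: (tensor_morph (idm c) (KN_id C)).
have prec_half d V m W U : d <= n -> kn_state n d V m W ->
    prec_sp (psi n (kcol n V m W)) (bars n U) <-> pair_good n d 0 V W U U.
  by move=> dn St; apply: prec_sp_psi.
apply: iso_of.
- apply: (@transfer_regular n (tensor (KN_sp_crystal n) (tensor_seq (col_crystal n)))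
    (tensor (KN_sp_crystal n) (KN_crystal n)) _ _ (fun b => (id b.1, id b.2)) R).
  + by move=> [c T] /in_KN_halfP.
  + by move=> [c T] /in_KN_halfP ?; exists (c, T).
  + exact: M.
- move=> [c T] /in_KN_halfP[[/= B0 C A] E]; rewrite /Psi_half /= Psi_map //.
  have [U EU] := (in_KN_spP n2 c).1 B0; rewrite EU minus_spc //.
  split=> /=; [by rewrite /in_T_sp all_bars col_ok_bars|exact: in_T_map|].
  case: T A C {E} => // c2 T A [[d dn K] _ _].
  have [V [m [W [E2 St]]]] := K; rewrite /= E2; apply/(prec_half _ _ _ _ _ dn St).
  move: A; rewrite EU => /(padj_spP U dn K); rewrite E2 => P.
  exact: (pair_KN_good n2 (leq0n d) dn St (spc_state n U) P).
- move=> [c T] [c' T'] /in_KN_halfP[[/= B0 C A] E] /in_KN_halfP[[/= B0' C' A'] E'].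
  rewrite /Psi_half /= !Psi_map // => -[Em /(chain_inj C E C' E') ->]; congr pair.
  have [U EU] := (in_KN_spP n2 c).1 B0; have [U' EU'] := (in_KN_spP n2 c').1 B0'.
  move: Em; rewrite EU EU' !minus_spc // => /eq_bars_inv Eb.
  by apply: eq_spc => k /Eb.
- move=> [c Ts] [/= /andP[bc oc] /in_T_surj[T [C E Ep]] Hp].
  pose U k := Bar k \in c; have Ec : c = bars n U := bars_canon oc bc.
  exists (spc n U, T); last by rewrite /Psi_half /= minus_spc // Psi_map // Ep -Ec.
  apply/in_KN_halfP; split=> //; split=> //=; first by apply/in_KN_spP => //; exists U.
  case: T C E Ep => // c2 T C E Ep; have [[d dn K] _ _] := C.
  apply/(padj_spP U dn K); have [V [m [W [E2 St]]]] := K; rewrite E2.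
  apply: (pair_good_KN n2 (leq0n d) dn St (spc_state n U)).
  by apply/(prec_half _ _ _ _ _ dn St); move: Hp; rewrite -Ep /= -E2 -Ec.
- move=> [c T] /in_KN_halfP B; have [[/= B0 C A] E] := B.
  apply: (@morph_factor n (tensor (KN_sp_crystal n) (tensor_seq (col_crystal n)))
    (tensor (KN_sp_crystal n) (KN_crystal n)) (tensor (T_sp_crystal n) (tensor_seq (T_b_crystal n)))
    _ (fun b => (id b.1, id b.2))
    (fun b => (minus_part n b.1, map (psi n) b.2)) (Psi_half n la) (c, T) R.1 B).
  + by move=> [c' T'] [_ E']; rewrite /Psi_half /= Psi_map.
  + exact: M.
  + apply: tensor_morph; first exact: (sp_morph n2 B0).
    by apply: tseq_morph; apply: chain_psi.
Qed.
End Assembly.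

(* The first part is the case lambda = mu in P_n, the second the case
   lambda = mu + sigma_n in P_n^sp. *)
Theorem theorem3p19 (n : nat) (mu : seq nat) (hn : 2 <= n) (hmu : in_Pn n mu) :
  @crystal_iso n (KN_crystal n) (tensor_seq (T_b_crystal n))
    (in_KN n mu) (in_T n mu) (Psi n mu) /\
  @crystal_iso n
    (tensor (KN_sp_crystal n) (KN_crystal n))
    (tensor (T_sp_crystal n) (tensor_seq (T_b_crystal n)))
    (in_KN_half n mu) (in_T_half n mu) (Psi_half n mu).
Proof. by split; [apply: Psi_iso|apply: Psi_half_iso]. Qed.
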